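(* Let $\bar\sigma$ be a conformal unit defining density for a hypersurface $\Sigma\hookrightarrow M$ in a conformal manifold $(M,\boldsymbol c)$ of dimension $d\ge3$. Suppose that $P$ is a weight $w$ coupled conformal invariant of $(M,\boldsymbol c,\bar\sigma)$ such that at each point it depends on at most the $d$-jet of $\bar\sigma$. Then the restriction of $P$ to $\Sigma$ is a conformal hypersurface invariant of weight $w$.
   Context: $(M,\boldsymbol c)$ is a smooth oriented $d$-manifold with a conformal class of Riemannian metrics. $\mathcal E[w]$ is the bundle of conformal densities of weight $w$ (oriented $\frac w{2d}$-th root of $(\Lambda^dTM)^2$; a section is represented by functions $f_g$, $g\in\boldsymbol c$, with $f_{\Omega^2g}=\Omega^wf_g$); $\boldsymbol g$ is the conformal metric. For $\sigma\in\Gamma(\mathcal E[1])$, $I_\sigma^2:=\boldsymbol g^{ab}(\nabla_a\sigma)(\nabla_b\sigma)-\frac2d\sigma(\Delta\sigma+\mathrm J\sigma)$ with $\nabla$, $\Delta=\boldsymbol g^{ab}\nabla_a\nabla_b$, $\mathrm J=\mathrm{Sc}/(2(d-1))$ those of any $g\in\boldsymbol c$. A defining density for $\Sigma$ is a $\sigma\in\Gamma(\mathcal E[1])$ with zero locus $\Sigma$ and $\nabla\sigma\ne0$ along $\Sigma$; it is a conformal unit defining density if $I^2_\sigma=1+\sigma^dB$ with $B$ smooth. Riemannian hypersurface invariants: a scalar Riemannian pre-invariant assigns to each Riemannian $d$-manifold $(M,g)$ (with volume form $\omega$) and hypersurface defining function $s$ ($\boldsymbol ds\neq0$ on $\Sigma=\{s=0\}$)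 a function $P(s;g)$ such that (i) $P(\phi^*s;\phi^*g)=\phi^*P(s;g)$ for every diffeomorphism $\phi$; (ii) $P(s;g)|_\Sigma=P(s';g)|_\Sigma$ whenever $s,s'$ are compatibly oriented defining functions of the same $\Sigma$; (iii) $P$ is given in local coordinates by a universal polynomial in $g_{ab}$ and its partial derivatives up to some finite order, $(\det g)^{-1}$, $s$ and its partial derivatives up to some finite order, $\|\boldsymbol ds\|_g^{-1}$, and the components of $\omega$. The restriction $P(\Sigma;g)=P(s;g)|_\Sigma$ is a Riemannian hypersurface invariant; it defines a conformal hypersurface invariant of weight $w$ (a section of $\mathcal E\Sigma[w]$) if $P(\Sigma;\Omega^2g)=\Omega^wP(\Sigma;g)$ for all smooth positive $\Omega$. Tensor-valued invariants are defined analogously. Coupled invariants: for a scalar function $s$, a coupled Riemannian invariant $P(s,g)$ is defined in the same way as a pre-invariant, except that $\|\boldsymbol ds\|_g^{-1}$ is not allowed in (iii) (polynomial dependence on the jets of $s$ is allowed). A weight $w$ coupled conformal covariant is a coupled Riemannian invariant with $P(\Omega^us,\Omega^2g)=\Omega^wP(s,g)$ for all smooth positive $\Omega$ (for given $u,w\in\mathbb R$); it determines a section $P(\sigma,\boldsymbol g)$ of $\mathcal E[w]$ for $\sigma\in\Gamma(\mathcal E[u])$, called a coupled conformal invariant of weight $w$. Here it is applied with $u=1$, $\sigma=\bar\sigma$. *)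

(* Defs.v *)
From mathcomp Require Import all_boot all_order all_algebra.
From mathcomp Require Import all_classical all_reals all_analysis.
(* not imported: its notations clash with those of MathComp-Analysis *)
From mathcomp Require mpoly.

Set Implicit Arguments.
Unset Strict Implicit.
Unset Printing Implicit Defensive.

Import Order.TTheory GRing.Theory Num.Theory.
Import numFieldNormedType.Exports.

Local Open Scope classical_set_scope.
Local Open Scope ring_scope.

Section Euclidean.
Variables (R : realType) (d : nat).
Implicit Types (f : 'rV[R]_d -> R) (G : 'rV[R]_d -> 'M[R]_d) (x : 'rV[R]_d).

Definition partial (i : 'I_d) f : 'rV[R]_d -> R :=
  fun x => 'D_(delta_mx 0 i) f x.

Definition partials (a : seq 'I_d) f : 'rV[R]_d -> R := foldr partial f a.

(* C^oo; only used with U open *)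
Definition smooth_on (U : set 'rV[R]_d) f : Prop :=
  forall (a : seq 'I_d) x, U x ->
    {for x, continuous (partials a f)} /\
    forall i, derivable (partials a f) x (delta_mx 0 i).

Definition smooth_map_on (U : set 'rV[R]_d) (F : 'rV[R]_d -> 'rV[R]_d) : Prop :=
  forall j, smooth_on U (fun x => F x 0 j).

Definition gradient f x : 'rV[R]_d := \row_i partial i f x.

(* g^{ab} (d_a f) (d_b f) *)
Definition grad_sqnorm G f x : R :=
  \sum_a \sum_b invmx (G x) a b * partial a f x * partial b f x.

Definition christoffel G (k i j : 'I_d) x : R :=
  2^-1 * \sum_l invmx (G x) k l *
    (partial i (fun y => G y l j) x + partial j (fun y => G y i l) x
     - partial l (fun y => G y i j) x).

Definition laplacian G f x : R :=
  \sum_a \sum_b invmx (G x) a b *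
    (partials [:: a; b] f x - \sum_k christoffel G k a b x * partial k f x).

(* normalised so that the round unit sphere has Sc = d(d-1) *)
Definition ricci G (i j : 'I_d) x : R :=
  \sum_k (partial k (christoffel G k i j) x
          - partial j (christoffel G k i k) x
          + \sum_l (christoffel G k k l x * christoffel G l i j x
                    - christoffel G k j l x * christoffel G l i k x)).

Definition scalar_curvature G x : R :=
  \sum_i \sum_j invmx (G x) i j * ricci G i j x.

Definition schouten_trace G x : R :=
  scalar_curvature G x / (2 * (d%:R - 1)).

(* I^2_sigma, where f represents sigma in the scale g *)
Definition I_squared G f x : R :=
  grad_sqnorm G f x
  - 2 / d%:R * f x * (laplacian G f x + schouten_trace G x * f x).

End Euclidean.

Section Charts.
Variables (R : realType) (d : nat).

(* [fwd] is only meaningful on [dom], and [bwd] on [fwd @` dom]. *)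
Record chart (T : topologicalType) := Chart {
  dom : set T;
  fwd : T -> 'rV[R]_d;
  bwd : 'rV[R]_d -> T }.

Definition img (T : topologicalType) (c : chart T) : set 'rV[R]_d :=
  fwd c @` dom c.

Definition is_chart (T : topologicalType) (c : chart T) : Prop :=
  [/\ open (dom c) /\ open (img c),
      forall p, dom c p -> bwd c (fwd c p) = p,
      {within dom c, continuous (fwd c)} &
      {within img c, continuous (bwd c)}].

Definition in_coords (T T' : topologicalType) (phi : T -> T')
    (c : chart T) (c' : chart T') : 'rV[R]_d -> 'rV[R]_d :=
  fun x => fwd c' (phi (bwd c x)).

Definition coords_dom (T T' : topologicalType) (phi : T -> T')
    (c : chart T) (c' : chart T') : set 'rV[R]_d :=
  fwd c @` (dom c `&` phi @^-1` dom c').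

(* d c'/d c at p; entry (i, j) is the i-th partial of the j-th component *)
Definition jac (T T' : topologicalType) (phi : T -> T')
    (c : chart T) (c' : chart T') (p : T) : 'M[R]_d :=
  jacobian (in_coords phi c c') (fwd c p).

Definition compatible (T : topologicalType) (c c' : chart T) : Prop :=
  smooth_map_on (coords_dom id c c') (in_coords id c c') /\
  smooth_map_on (coords_dom id c' c) (in_coords id c' c).

End Charts.

(* A smooth oriented d-manifold, given by a maximal smooth atlas; [orient c] is
   the set of points of [dom c] at which the chart [c] is positively oriented. *)
Record omanifold (R : realType) (d : nat) := OManifold {
  carrier :> topologicalType;
  atlas : set (chart R d carrier);
  orient : chart R d carrier -> set carrier;
  carrier_hausdorff : hausdorff_space carrier;
  carrier_second_countable : @second_countable carrier;
  atlas_chart : forall c, atlas c -> is_chart c;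
  atlas_cover : forall p, exists2 c, atlas c & dom c p;
  atlas_compatible : forall c c', atlas c -> atlas c' -> compatible c c';
  atlas_maximal : forall c, is_chart c ->
    (forall c', atlas c' -> compatible c c') -> atlas c;
  orient_locally_constant : forall c, atlas c ->
    open (dom c `&` orient c) /\ open (dom c `\` orient c);
  orient_coherent : forall c c' p, atlas c -> atlas c' -> dom c p -> dom c' p ->
    (orient c p <-> orient c' p) <-> 0 < \det (jac id c c' p) }.

Section Manifolds.
Variables (R : realType) (d : nat).
Implicit Types (M N : omanifold R d).

Definition smooth_fun M (f : M -> R) : Prop :=
  forall c, atlas c -> smooth_on (img c) (fun x => f (bwd c x)).

Definition smooth_positive M (f : M -> R) : Prop :=
  smooth_fun f /\ forall p, 0 < f p.

Definition smooth_mfd_map M N (phi : M -> N) : Prop :=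
  continuous phi /\
  forall (c : chart R d M) (c' : chart R d N), atlas c -> atlas c' ->
    smooth_map_on (coords_dom phi c c') (in_coords phi c c').

Definition diffeomorphism M N (phi : M -> N) : Prop :=
  exists psi : N -> M,
    [/\ cancel phi psi, cancel psi phi,
        smooth_mfd_map phi & smooth_mfd_map psi].

Definition preserves_orientation M N (phi : M -> N) : Prop :=
  forall (c : chart R d M) (c' : chart R d N) p,
    atlas c -> atlas c' -> dom c p -> dom c' (phi p) ->
    (orient c p <-> orient c' (phi p)) <-> 0 < \det (jac phi c c' p).

(* [metric_at c x] is the component matrix in the chart [c] at coordinate x;
   it is only meaningful for [c] in the atlas and x in [img c]. *)
Record metric M := Metric {
  metric_at :> chart R d M -> 'rV[R]_d -> 'M[R]_d;
  metric_smooth : forall c, atlas c ->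
    forall i j, smooth_on (img c) (fun x => metric_at c x i j);
  metric_sym : forall c x, atlas c -> img c x ->
    (metric_at c x)^T = metric_at c x;
  metric_pos : forall c x, atlas c -> img c x ->
    forall v : 'rV[R]_d, v != 0 -> 0 < (v *m metric_at c x *m v^T) 0 0;
  metric_tensorial : forall c c' p, atlas c -> atlas c' -> dom c p -> dom c' p ->
    metric_at c (fwd c p) =
    jac id c c' p *m metric_at c' (fwd c' p) *m (jac id c c' p)^T }.

(* g = phi^* h *)
Definition is_pullback M N (phi : M -> N) (h : metric N) (g : metric M) : Prop :=
  forall (c : chart R d M) (c' : chart R d N) p,
    atlas c -> atlas c' -> dom c p -> dom c' (phi p) ->
    g c (fwd c p) = jac phi c c' p *m h c' (fwd c' (phi p)) *m (jac phi c c' p)^T.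

(* h = Omega^2 g *)
Definition is_rescaling M (Omega : M -> R) (g h : metric M) : Prop :=
  forall c p, atlas c -> dom c p -> h c (fwd c p) = Omega p ^+ 2 *: g c (fwd c p).

(* the component omega_{1...d} of the volume form; the other components of the
   d-form are 0 or plus or minus this one *)
Definition volume_component M (g : metric M) (c : chart R d M) (p : M) : R :=
  (if `[< orient c p >] then 1 else -1) * Num.sqrt (\det (g c (fwd c p))).

Definition chart_gradient M (c : chart R d M) (f : M -> R) (p : M) : 'rV[R]_d :=
  gradient (fun x => f (bwd c x)) (fwd c p).

Definition defining_function M (Sigma : set M) (s : M -> R) : Prop :=
  [/\ smooth_fun s, Sigma = [set p | s p = 0] &
      forall c p, atlas c -> dom c p -> Sigma p -> chart_gradient c s p != 0].

Definition compatibly_oriented M (Sigma : set M) (s s' : M -> R) : Prop :=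
  forall c p, atlas c -> dom c p -> Sigma p ->
    exists2 l : R, 0 < l & chart_gradient c s' p = l *: chart_gradient c s p.

Definition same_jet (k : nat) M (s s' : M -> R) (p : M) : Prop :=
  forall c, atlas c -> dom c p -> forall a : seq 'I_d, (size a <= k)%N ->
    partials a (fun x => s (bwd c x)) (fwd c p) =
    partials a (fun x => s' (bwd c x)) (fwd c p).

End Manifolds.

Section Invariants.
Variables (R : realType) (d : nat).
Implicit Types (M N : omanifold R d).

(* A value P(s; g) : M -> R for each oriented Riemannian manifold and function. *)
Definition scalar_assignment :=
  forall M : omanifold R d, metric M -> (M -> R) -> M -> R.

Inductive jet_variable :=
  | JetMetric of 'I_d & 'I_d & seq 'I_d  (* partial derivative of g_{ab} *)
  | JetInvDet                            (* (det g)^{-1} *)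
  | JetFun of seq 'I_d                   (* partial derivative of s *)
  | JetInvNorm                           (* |ds|_g^{-1} *)
  | JetVolume.                           (* omega_{1...d} *)

Definition jet_value M (g : metric M) (s : M -> R) (c : chart R d M) (p : M)
    (v : jet_variable) : R :=
  let x := fwd c p in
  match v with
  | JetMetric i j a => partials a (fun y => g c y i j) x
  | JetInvDet => (\det (g c x))^-1
  | JetFun a => partials a (fun y => s (bwd c y)) x
  | JetInvNorm => (Num.sqrt (grad_sqnorm (g c) (fun y => s (bwd c y)) x))^-1
  | JetVolume => volume_component g c p
  end.

(* A polynomial in finitely many jet variables v 0, ..., v (n-1), hence in
   derivatives up to some finite order. *)
Definition jet_polynomial_value (n : nat) (v : 'I_n -> jet_variable)
    (q : mpoly.mpoly n R) M (g : metric M) (s : M -> R) (c : chart R d M) (p : M)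
    : R :=
  mpoly.meval (fun i => jet_value g s c p (v i)) q.

(* Invariance under all diffeomorphisms with the orientation, hence the volume
   form, transported along phi: an orientation-reversing diffeomorphism of a
   manifold is an orientation-preserving one onto the same manifold with the
   opposite orientation. *)
Definition natural_on (adm : forall M, (M -> R) -> Prop)
    (P : scalar_assignment) : Prop :=
  forall M N (phi : M -> N) (g : metric M) (h : metric N) (s : N -> R),
    diffeomorphism phi -> preserves_orientation phi -> is_pullback phi h g ->
    adm N s -> forall p, P M g (fun q => s (phi q)) p = P N h s (phi p).

Definition is_defining M (s : M -> R) : Prop :=
  exists Sigma : set M, defining_function Sigma s.

(* The formula in the third clause involves |ds|^{-1}, hence is only imposed
   where ds is nonzero; this includes a neighbourhood of Sigma. *)
Definition riemannian_pre_invariant (P : scalar_assignment) : Prop :=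
  [/\ natural_on is_defining P,
      forall M (g : metric M) (Sigma : set M) (s s' : M -> R),
        defining_function Sigma s -> defining_function Sigma s' ->
        compatibly_oriented Sigma s s' ->
        forall p, Sigma p -> P M g s p = P M g s' p &
      exists (n : nat) (v : 'I_n -> jet_variable) (q : mpoly.mpoly n R),
        forall M (g : metric M) (s : M -> R) (c : chart R d M) p,
          is_defining s -> atlas c -> dom c p -> chart_gradient c s p != 0 ->
          P M g s p = jet_polynomial_value v q g s c p].

Definition conformal_hypersurface_invariant (w : R) (P : scalar_assignment)
    : Prop :=
  riemannian_pre_invariant P /\
  forall M (g h : metric M) (Omega : M -> R) (Sigma : set M) (s : M -> R),
    smooth_positive Omega -> is_rescaling Omega g h ->
    defining_function Sigma s ->
    forall p, Sigma p -> P M h s p = Omega p `^ w * P M g s p.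

(* There is no analogue of independence of the defining function here: s is an
   arbitrary smooth function on which P is allowed to depend. *)
Definition coupled_riemannian_invariant (P : scalar_assignment) : Prop :=
  natural_on (@smooth_fun R d) P /\
  exists (n : nat) (v : 'I_n -> jet_variable) (q : mpoly.mpoly n R),
    (forall i, v i <> JetInvNorm) /\
    forall M (g : metric M) (s : M -> R) (c : chart R d M) p,
      smooth_fun s -> atlas c -> dom c p ->
      P M g s p = jet_polynomial_value v q g s c p.

Definition coupled_conformal_covariant (u w : R) (P : scalar_assignment)
    : Prop :=
  coupled_riemannian_invariant P /\
  forall M (g h : metric M) (Omega s : M -> R),
    smooth_positive Omega -> is_rescaling Omega g h -> smooth_fun s ->
    forall p, P M h (fun q => Omega q `^ u * s q) p = Omega p `^ w * P M g s p.

Definition depends_on_jet (k : nat) (P : scalar_assignment) : Prop :=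
  forall M (g : metric M) (s s' : M -> R) p,
    smooth_fun s -> smooth_fun s' -> same_jet k s s' p ->
    P M g s p = P M g s' p.

End Invariants.

Section Conformal.
Variables (R : realType) (d : nat) (M : omanifold R d).

Definition conformal_class (cc : set (metric M)) : Prop :=
  (exists g, cc g) /\
  forall g, cc g -> forall h, cc h <->
    exists2 Omega : M -> R, smooth_positive Omega & is_rescaling Omega g h.

(* A section of E[w] on (M, cc), as the family of functions f_g; the value of f
   at metrics outside cc is irrelevant. *)
Definition density (cc : set (metric M)) (w : R) (f : metric M -> M -> R)
    : Prop :=
  (forall g, cc g -> smooth_fun (f g)) /\
  forall g h (Omega : M -> R), cc g -> cc h ->
    smooth_positive Omega -> is_rescaling Omega g h ->
    forall p, f h p = Omega p `^ w * f g p.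

Definition defining_density (cc : set (metric M)) (Sigma : set M)
    (sigma : metric M -> M -> R) : Prop :=
  density cc 1 sigma /\ forall g, cc g -> defining_function Sigma (sigma g).

(* B has weight -d because I^2_sigma has weight 0. *)
Definition unit_defining_density (cc : set (metric M)) (Sigma : set M)
    (sigma : metric M -> M -> R) : Prop :=
  defining_density cc Sigma sigma /\
  exists2 B : metric M -> M -> R, density cc (- d%:R) B &
    forall g, cc g -> forall c p, atlas c -> dom c p ->
      I_squared (g c) (fun x => sigma g (bwd c x)) (fwd c p) =
      1 + sigma g p ^+ d * B g p.

(* Along Sigma, oriented by sigma, the section P(sigma, g) of E[w] agrees in
   every scale with the hypersurface invariant Q(Sigma; g) = Q(s; g)|_Sigma. *)
Definition restricts_to (cc : set (metric M)) (Sigma : set M)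
    (sigma : metric M -> M -> R) (P Q : scalar_assignment R d) : Prop :=
  forall g, cc g -> forall s : M -> R,
    defining_function Sigma s -> compatibly_oriented Sigma (sigma g) s ->
    forall p, Sigma p -> P M g (sigma g) p = Q M g s p.

End Conformal.

(* Main.v *)
(* Along [Sigma] the equation [I^2 = 1 + O(sigma ^ d)] determines the [d]-jet of
   a unit defining density: if [I^2 - 1] vanishes to order [k] then, among
   corrections of [f] of order [k + 1], the linearised operator is [2 (d - k) / d]
   times the derivative along the gradient of [f], which is invertible modulo
   higher order for [k < d].
   Hence the [d]-jet depends only on the oriented hypersurface and the metric,
   and conformal covariance of [I^2] transfers to it.

   To obtain an invariant [Q] of a pair [(g, s)] that is a polynomial in jets, the
   function [s / |ds|] from which the iteration starts is replaced, near a point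
   [p], by [s] times a Newton approximation of [1 / |ds|] started at the constant
   [m = 1 / |ds|(p)]. The resulting function [f] is smooth on all of [M],
   polynomial in [m] and the jets of [s] and [g], and has the right [d]-jet at
   [p]; one sets [Q (g, s) (p) = P (g, f) (p)]. *)

From HB Require Import structures.
Require Import Defs.
From mathcomp Require Import all_boot all_order all_algebra.
From mathcomp Require Import all_classical all_reals all_analysis.
From mathcomp Require Import perm ring lra zify.
From mathcomp Require mpoly.

Set Implicit Arguments.
Unset Strict Implicit.
Unset Printing Implicit Defensive.

Import Order.TTheory GRing.Theory Num.Theory.
Import numFieldNormedType.Exports.

Local Open Scope classical_set_scope.
Local Open Scope ring_scope.
Import(canonicals, coercions) mpoly.

(** * Smooth functions on open subsets of Euclidean space *)

(** Two demands pull against each other. The field [s / |ds|] exists only where [ds] is nonzero and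
    is not polynomial in jets, whereas [P] is controlled only on functions smooth on the whole
    manifold and its value has to come out as a polynomial. A cut-off would destroy naturality and
    polynomiality. Freezing [1 / |ds|] to a number [m] destroys neither: a constant has no
    derivatives, so only the value of [1 / |ds|] at the point survives, and this is an allowed
    variable of a hypersurface invariant.

    Orders of vanishing are measured by derivatives along [Z] instead of powers of [f], which avoids
    both adapted coordinates and division by a defining function. This calculus rests on Lagrange
    multipliers, on tangential derivatives preserving the order, and on Euler's relation in the
    normal direction. Naturality and conformal invariance of [I_squared] both come from the
    uniqueness of the Levi-Civita connection, with connection and curvature handled as matrices. *)

Section SmoothFunctions.
Context {R : realType} {d : nat}.
Local Notation E := 'rV[R]_d.
Implicit Types (U V : set E) (f g : E -> R) (x y : E) (i j : 'I_d).

Lemma near_in_open U (Q : E -> Prop) x :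
  open U -> U x -> (forall y, U y -> Q y) -> \forall y \near x, Q y.
Proof.
move=> oU Ux UQ; near=> y; apply: UQ; near: y; exact: open_nbhs_nbhs.
Unshelve. all: end_near. Qed.

Lemma partial_ext U i f g x : open U -> U x -> (forall y, U y -> f y = g y) ->
  partial i f x = partial i g x.
Proof. by move=> oU Ux fg; apply: near_eq_derive; exact: near_in_open fg. Qed.

Lemma partials_ext U a f g : open U -> (forall y, U y -> f y = g y) ->
  forall x, U x -> partials a f x = partials a g x.
Proof.
move=> oU fg; elim: a => [|i a IH] x Ux //=; first exact: fg.
exact: partial_ext IH.
Qed.

(** Despite the name, the partial derivatives are not asked to be continuous: this is a single layer
    of [smooth_on], and continuity of a derivative comes from the next layer. *)
Definition C1_on U f := forall x, U x ->
  {for x, continuous f} /\ forall i, derivable f x (delta_mx 0 i).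

Lemma C1_on_ext U f g : open U -> (forall y, U y -> f y = g y) ->
  C1_on U f -> C1_on U g.
Proof.
move=> oU fg Cf x Ux; have [cf df] := Cf _ Ux.
have nfg : \forall y \near x, f y = g y by exact: near_in_open fg.
split=> [|i]; last exact: near_eq_derivable (df i).
change (g @ x --> g x); rewrite -(fg x Ux).
exact: cvg_trans (near_eq_cvg nfg) cf.
Qed.

(** The recursion differentiates innermost, whereas [partials] adds its derivatives outermost. In
    this form the product, quotient and chain rules pass to higher orders by induction on [n] with
    the functions generalised. *)
Fixpoint Cn_on n U f : Prop :=
  C1_on U f /\ if n is m.+1 then forall i, Cn_on m U (partial i f) else True.

Lemma Cn_onC1 n U f : Cn_on n U f -> C1_on U f.
Proof. by case: n => [|n] []. Qed.

Lemma smooth_onC1 U f : smooth_on U f -> C1_on U f.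
Proof. by move=> sf x Ux; have := sf [::] x Ux. Qed.

Lemma smooth_on_partial U f i : smooth_on U f -> smooth_on U (partial i f).
Proof.
move=> sf a x Ux; have := sf (rcons a i) x Ux.
by rewrite /partials foldr_rcons.
Qed.

Lemma smooth_onP U f : smooth_on U f <-> forall n, Cn_on n U f.
Proof.
split=> [sf n|Cf].
  elim: n f sf => [|n IH] f sf /=; split=> //; try exact: smooth_onC1.
  by move=> i; apply/IH/smooth_on_partial.
move=> a; suff: C1_on U (partials a f) by move=> C x Ux; exact: C.
elim/last_ind: a f Cf => [|a i IH] f Cf; first exact: Cn_onC1 (Cf 0%N).
rewrite /partials foldr_rcons; apply: IH => n.
by have [_] := Cf n.+1; exact.
Qed.

Lemma Cn_on_le n m U f : (m <= n)%N -> Cn_on n U f -> Cn_on m U f.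
Proof.
elim: n m f => [|n IH] [|m] f //= mn [C1 Cf]; split=> // i.
exact: IH.
Qed.

Lemma Cn_on_ext n U f g : open U -> (forall y, U y -> f y = g y) ->
  Cn_on n U f -> Cn_on n U g.
Proof.
move=> oU; elim: n f g => [|n IH] f g fg [C1 Cf];
  (split; first exact: C1_on_ext C1); first by [].
by move=> i; apply: IH (Cf i) => y Uy; exact: partial_ext Uy fg.
Qed.

Lemma smooth_on_ext U f g : open U -> (forall y, U y -> f y = g y) ->
  smooth_on U f -> smooth_on U g.
Proof. by move=> oU fg /smooth_onP Cf; apply/smooth_onP => n; exact: Cn_on_ext (Cf n). Qed.

Lemma smooth_onS U V f : V `<=` U -> smooth_on U f -> smooth_on V f.
Proof. by move=> VU sf a x /VU; exact: sf. Qed.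

Lemma C1_cst U c : C1_on U (fun=> c).
Proof. by move=> x Ux; split=> [|i]; [exact: cst_continuous|exact: derivable_cst]. Qed.

Lemma partial_cst i c x : partial i (fun=> c) x = 0.
Proof. exact: derive_cst. Qed.

Lemma Cn_cst n U c : Cn_on n U (fun=> c).
Proof.
elim: n c => [|n IH] c /=; split=> //; try exact: C1_cst.
by move=> i; rewrite (_ : partial _ _ = fun=> 0) ?funeqE// => x; rewrite partial_cst.
Qed.

Lemma smooth_cst U c : smooth_on U (fun=> c).
Proof. by apply/smooth_onP => n; exact: Cn_cst. Qed.

Section Ops.
Variables (U : set E).
Hypothesis oU : open U.

Lemma C1D f g : C1_on U f -> C1_on U g -> C1_on U (fun x => f x + g x).
Proof.
move=> Cf Cg x Ux; have [cf df] := Cf _ Ux; have [cg dg] := Cg _ Ux.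
by split=> [|i]; [exact: continuousD|exact: derivableD].
Qed.

Lemma C1N f : C1_on U f -> C1_on U (fun x => - f x).
Proof.
move=> Cf x Ux; have [cf df] := Cf _ Ux.
by split=> [|i]; [exact: continuousN|exact: derivableN].
Qed.

Lemma C1M f g : C1_on U f -> C1_on U g -> C1_on U (fun x => f x * g x).
Proof.
move=> Cf Cg x Ux; have [cf df] := Cf _ Ux; have [cg dg] := Cg _ Ux.
by split=> [|i]; [exact: continuousM|exact: derivableM].
Qed.

Lemma C1V f : (forall x, U x -> f x != 0) -> C1_on U f ->
  C1_on U (fun x => (f x)^-1).
Proof.
move=> f0 Cf x Ux; have [cf df] := Cf _ Ux.
by split=> [|i]; [exact: continuousV (f0 _ Ux) cf|exact: derivableV (f0 _ Ux) _].
Qed.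

Lemma C1_partialD f g i x : U x -> C1_on U f -> C1_on U g ->
  partial i (fun x => f x + g x) x = partial i f x + partial i g x.
Proof. by move=> Ux /(_ x Ux)[_ df] /(_ x Ux)[_ dg]; exact: deriveD. Qed.

Lemma C1_partialN f i x : U x -> C1_on U f ->
  partial i (fun x => - f x) x = - partial i f x.
Proof. by move=> Ux /(_ x Ux)[_ df]; exact: deriveN. Qed.

Lemma C1_partialM f g i x : U x -> C1_on U f -> C1_on U g ->
  partial i (fun x => f x * g x) x = f x * partial i g x + partial i f x * g x.
Proof.
move=> Ux /(_ x Ux)[_ df] /(_ x Ux)[_ dg].
by rewrite /partial [LHS]deriveM //= [X in _ + X = _]mulrC.
Qed.

Lemma C1_partialV f i x : U x -> f x != 0 -> C1_on U f ->
  partial i (fun x => (f x)^-1) x = - (f x)^-1 ^+ 2 * partial i f x.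
Proof.
move=> Ux f0 /(_ x Ux)[_ df]; rewrite /partial [LHS]deriveV //=.
by rewrite exprVn.
Qed.

Lemma CnD n f g : Cn_on n U f -> Cn_on n U g -> Cn_on n U (fun x => f x + g x).
Proof.
elim: n f g => [|n IH] f g [Cf Pf] [Cg Pg];
  (split; first exact: C1D); first by [].
move=> i; apply: (Cn_on_ext oU _ (IH _ _ (Pf i) (Pg i))) => y Uy.
by rewrite (C1_partialD _ Uy).
Qed.

Lemma CnN n f : Cn_on n U f -> Cn_on n U (fun x => - f x).
Proof.
elim: n f => [|n IH] f [Cf Pf]; (split; first exact: C1N); first by [].
move=> i; apply: (Cn_on_ext oU _ (IH _ (Pf i))) => y Uy.
by rewrite (C1_partialN _ Uy).
Qed.

Lemma CnM n f g : Cn_on n U f -> Cn_on n U g -> Cn_on n U (fun x => f x * g x).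
Proof.
elim: n f g => [|n IH] f g Cf Cg; have /= [Cf1 Pf] := Cf; have /= [Cg1 Pg] := Cg;
  (split; first exact: C1M); first by [].
move=> i; have Cf' := Cn_on_le (leqnSn n) Cf; have Cg' := Cn_on_le (leqnSn n) Cg.
apply: (Cn_on_ext oU _ (CnD (IH _ _ Cf' (Pg i)) (IH _ _ (Pf i) Cg'))) => y Uy.
by rewrite (C1_partialM _ Uy).
Qed.

Lemma CnV n f : (forall x, U x -> f x != 0) -> Cn_on n U f ->
  Cn_on n U (fun x => (f x)^-1).
Proof.
move=> f0; elim: n f f0 => [|n IH] f f0 Cf; have /= [Cf1 Pf] := Cf;
  (split; first exact: C1V); first by [].
move=> i; have Cf' := IH _ f0 (Cn_on_le (leqnSn n) Cf).
apply: (Cn_on_ext oU _ (CnN (CnM (CnM Cf' Cf') (Pf i)))) => y Uy.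
by rewrite (C1_partialV _ Uy) ?f0// expr2 mulNr.
Qed.

Lemma smoothD f g : smooth_on U f -> smooth_on U g ->
  smooth_on U (fun x => f x + g x).
Proof. by move=> /smooth_onP Cf /smooth_onP Cg; apply/smooth_onP => n; exact: CnD. Qed.

Lemma smoothN f : smooth_on U f -> smooth_on U (fun x => - f x).
Proof. by move=> /smooth_onP Cf; apply/smooth_onP => n; exact: CnN. Qed.

Lemma smoothB f g : smooth_on U f -> smooth_on U g ->
  smooth_on U (fun x => f x - g x).
Proof. by move=> sf sg; exact/smoothD/smoothN. Qed.

Lemma smoothM f g : smooth_on U f -> smooth_on U g ->
  smooth_on U (fun x => f x * g x).
Proof. by move=> /smooth_onP Cf /smooth_onP Cg; apply/smooth_onP => n; exact: CnM. Qed.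

Lemma smoothX f n : smooth_on U f -> smooth_on U (fun x => f x ^+ n).
Proof.
move=> sf; elim: n => [|n IH]; first exact: smooth_cst.
by apply: (smooth_on_ext oU _ (smoothM sf IH)) => y _; rewrite exprS.
Qed.

Lemma smoothV f : (forall x, U x -> f x != 0) -> smooth_on U f ->
  smooth_on U (fun x => (f x)^-1).
Proof. by move=> f0 /smooth_onP Cf; apply/smooth_onP => n; exact: CnV. Qed.

Lemma smooth_sum (I : Type) (r : seq I) (Q : pred I) (F : I -> E -> R) :
  (forall k, Q k -> smooth_on U (F k)) ->
  smooth_on U (fun x => \sum_(k <- r | Q k) F k x).
Proof.
move=> sF; elim: r => [|k r IH].
  by apply: (smooth_on_ext oU _ (smooth_cst 0)) => y _; rewrite big_nil.
case: (boolP (Q k)) => Qk; last first.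
  by apply: (smooth_on_ext oU _ IH) => y _; rewrite big_cons (negbTE Qk).
apply: (smooth_on_ext oU _ (smoothD (sF _ Qk) IH)) => y _.
by rewrite big_cons Qk.
Qed.

Lemma smooth_prod (I : Type) (r : seq I) (Q : pred I) (F : I -> E -> R) :
  (forall k, Q k -> smooth_on U (F k)) ->
  smooth_on U (fun x => \prod_(k <- r | Q k) F k x).
Proof.
move=> sF; elim: r => [|k r IH].
  by apply: (smooth_on_ext oU _ (smooth_cst 1)) => y _; rewrite big_nil.
case: (boolP (Q k)) => Qk; last first.
  by apply: (smooth_on_ext oU _ IH) => y _; rewrite big_cons (negbTE Qk).
apply: (smooth_on_ext oU _ (smoothM (sF _ Qk) IH)) => y _.
by rewrite big_cons Qk.
Qed.

Lemma partialD f g i x : U x -> smooth_on U f -> smooth_on U g ->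
  partial i (fun x => f x + g x) x = partial i f x + partial i g x.
Proof. by move=> Ux /smooth_onC1 Cf /smooth_onC1 Cg; exact: C1_partialD Ux _ _. Qed.

Lemma partialN f i x : U x -> smooth_on U f ->
  partial i (fun x => - f x) x = - partial i f x.
Proof. by move=> Ux /smooth_onC1 Cf; exact: C1_partialN Ux _. Qed.

Lemma partialB f g i x : U x -> smooth_on U f -> smooth_on U g ->
  partial i (fun x => f x - g x) x = partial i f x - partial i g x.
Proof.
move=> Ux sf sg; rewrite -(partialN i Ux sg).
exact: partialD Ux sf (smoothN sg).
Qed.

Lemma partialM f g i x : U x -> smooth_on U f -> smooth_on U g ->
  partial i (fun x => f x * g x) x = f x * partial i g x + partial i f x * g x.
Proof. by move=> Ux /smooth_onC1 Cf /smooth_onC1 Cg; exact: C1_partialM Ux _ _. Qed.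

Lemma partialMl f i c x : U x -> smooth_on U f ->
  partial i (fun x => c * f x) x = c * partial i f x.
Proof.
move=> Ux sf; rewrite (partialM i Ux (smooth_cst c) sf) partial_cst.
by rewrite mul0r addr0.
Qed.

Lemma partialV f i x : U x -> f x != 0 -> smooth_on U f ->
  partial i (fun x => (f x)^-1) x = - (f x)^-1 ^+ 2 * partial i f x.
Proof. by move=> Ux f0 /smooth_onC1 Cf; exact: C1_partialV Ux _ _. Qed.

Lemma partial_sum (I : Type) (r : seq I) (Q : pred I) (F : I -> E -> R) i x :
  U x -> (forall k, Q k -> smooth_on U (F k)) ->
  partial i (fun x => \sum_(k <- r | Q k) F k x) x =
  \sum_(k <- r | Q k) partial i (F k) x.
Proof.
move=> Ux sF; elim: r => [|k r IH].
  rewrite big_nil -[RHS](partial_cst i 0 x).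
  by apply: (partial_ext i oU Ux) => y _; rewrite big_nil.
rewrite big_cons; case: (boolP (Q k)) => Qk; last first.
  rewrite -IH; apply: (partial_ext i oU Ux) => y _.
  by rewrite big_cons (negbTE Qk).
rewrite -IH -(partialD i Ux (sF _ Qk) (smooth_sum r sF)).
by apply: (partial_ext i oU Ux) => y _; rewrite big_cons Qk.
Qed.

End Ops.
End SmoothFunctions.

(** * Mean value estimates and differentiability *)

Section MeanValue.
Context {R : realType} {d : nat}.
Local Notation E := 'rV[R]_d.
Local Notation e_ i := (delta_mx 0 i : E).
Implicit Types (U V : set E) (f g : E -> R) (x y : E) (i j : 'I_d).

Lemma is_derive_line f y v t : derivable f (y + t *: v) v ->
  is_derive t 1 (fun u : R => f (y + u *: v)) ('D_v f (y + t *: v)).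
Proof.
move=> df; apply: DeriveDef.
  apply/derivable1P; move/derivable1P: df.
  have -> // : (fun h : R => f (h *: v + (y + t *: v))) =
    (fun h : R => f (y + (h *: (1 : R) + t) *: v)).
  apply/funext => h; congr f.
  by rewrite [_ *: 1]mulr1 scalerDl addrCA.
rewrite /derive (_ : (fun h : R => h^-1 *: (((fun u : R => f (y + u *: v)) \o
    shift t) (h *: (1 : R)) - f (y + t *: v))) =
  (fun h : R => h^-1 *: ((f \o shift (y + t *: v)) (h *: v) - f (y + t *: v)))) //.
apply/funext => h /=; congr (_ *: (f _ - _)).
by rewrite [_ *: 1]mulr1 scalerDl addrCA.
Qed.

Lemma ball_line (x y v : E) (r t u : R) :
  `|u| <= `|t| -> `|y - x| + `|t| * `|v| < r -> ball x r (y + u *: v).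
Proof.
move=> ut yr; rewrite -ball_normE /= distrC; apply: le_lt_trans yr.
rewrite addrAC; apply: le_trans (ler_normD _ _) _.
by rewrite lerD2l normrZ ler_wpM2r.
Qed.

Lemma norm_delta_mx i : `|e_ i| = 1.
Proof.
apply/eqP; rewrite eq_le; apply/andP; split.
  rewrite [leLHS]/Num.Def.normr /= mx_normrE; apply: bigmax_le => // -[a b] _ /=.
  by rewrite !mxE; case: (_ && _); rewrite ?normr0 ?normr1.
rewrite [leRHS]/Num.Def.normr /= mx_normrE.
by apply: le_trans (le_bigmax _ _ (0, i)); rewrite /= !mxE !eqxx normr1.
Qed.

(** The one-variable theorem asks for ordered end points, hence the two cases on the sign of [t]. Of
    the intermediate point only the bound by [|t|] is kept. *)
Lemma partial_mvt x y (r : R) f i (t : R) : C1_on (ball x r) f ->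
  `|y - x| + `|t| < r ->
  exists2 u : R, `|u| <= `|t| &
    f (y + t *: e_ i) - f y = t * partial i f (y + u *: e_ i).
Proof.
move=> Cf yr.
have inb (u : R) : `|u| <= `|t| -> ball x r (y + u *: e_ i).
  by move=> ut; apply: ball_line ut _; rewrite norm_delta_mx mulr1.
pose F (u : R) := f (y + u *: e_ i).
have dF (u : R) : `|u| <= `|t| -> is_derive u 1 F (partial i f (y + u *: e_ i)).
  by move=> /inb b; have [_ df] := Cf _ b; exact: is_derive_line.
have cF (u : R) : `|u| <= `|t| -> {for u, continuous F}.
  move=> /dF [dF1 _]; apply: differentiable_continuous.
  exact/derivable1_diffP.
have F0 : F 0 = f y by rewrite /F scale0r addr0.
have [t0|t0] := leP 0 t.
- have [||c] := @MVT_segment R F (fun u => partial i f (y + u *: e_ i)) 0 t t0.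
  + move=> u; rewrite in_itv /= => /andP[u0 ut]; apply: dF.
    by rewrite !ger0_norm// ltW.
  + apply: continuous_in_subspaceT => u; rewrite inE /= in_itv /= => /andP[u0 ut].
    by apply: cF; rewrite !ger0_norm.
  + rewrite in_itv /= => /andP[c0 ct]; rewrite F0 subr0 => Fc.
    by exists c; [rewrite !ger0_norm|rewrite -/(F t) Fc mulrC].
- have [||c] := @MVT_segment R F (fun u => partial i f (y + u *: e_ i)) t 0 (ltW t0).
  + move=> u; rewrite in_itv /= => /andP[ut u0]; apply: dF.
    by rewrite !ler0_norm ?lerN2// ltW.
  + apply: continuous_in_subspaceT => u; rewrite inE /= in_itv /= => /andP[ut u0].
    by apply: cF; rewrite !ler0_norm ?lerN2// ltW.
  + rewrite in_itv /= => /andP[ct c0]; rewrite F0 sub0r => Fc.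
    exists c; first by rewrite !ler0_norm ?lerN2// ltW.
    by rewrite -/(F t) -[LHS]opprB Fc mulrN opprK mulrC.
Qed.

Lemma ball_nbhs_ex U x (Q : E -> Prop) : open U -> U x ->
  (\forall y \near x, Q y) ->
  exists2 r : R, 0 < r & forall y, ball x r y -> U y /\ Q y.
Proof.
move=> oU Ux nQ.
have /nbhs_ballP[r /= r0 rQ] : nbhs x (U `&` [set y | Q y]).
  by apply: filterI; [exact: open_nbhs_nbhs|exact: nQ].
by exists r => // y /rQ.
Qed.

Lemma continuous_partials_near U f x (eps : R) : 0 < eps -> U x ->
  (forall i, C1_on U (partial i f)) ->
  \forall y \near x, forall i, `|partial i f y - partial i f x| <= eps.
Proof.
move=> e0 Ux Cf.
apply: (@filter_forall E 'I_d
  (fun i => [set y | `|partial i f y - partial i f x| <= eps]) (nbhs x)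
  (nbhs_filter x)) => i.
have [/cvgrPdist_le /(_ _ e0) ci _] := Cf i x Ux.
by apply: filterS ci => y; rewrite distrC.
Qed.

(** Passing from [k] to [k.+1] moves along one coordinate line, so the increment of a function from
    [x] to [x + h] telescopes into increments that [partial_mvt] controls. *)
Definition truncate_row (h : E) k : E := \row_i (if (i < k)%N then h 0 i else 0).

Lemma truncate_row0 h : truncate_row h 0 = 0.
Proof. by apply/rowP => i; rewrite !mxE. Qed.

Lemma truncate_row_all h : truncate_row h d = h.
Proof. by apply/rowP => i; rewrite !mxE ltn_ord. Qed.

Lemma truncate_rowS h k (kd : (k < d)%N) :
  truncate_row h k.+1 = truncate_row h k + h 0 (Ordinal kd) *: e_ (Ordinal kd).
Proof.
apply/rowP => i; rewrite !mxE ltnS leq_eqVlt eqxx /=.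
case: (eqVneq i (Ordinal kd)) => [->|ne] /=.
  by rewrite eqxx ltnn mulr1 add0r.
rewrite (_ : (_ == _ :> nat) = false) /= ?mulr0 ?addr0 //.
by apply/negbTE; apply: contra ne => /eqP ik; apply/eqP/val_inj.
Qed.

Lemma norm_coord_le (h : E) i : `|h 0 i| <= `|h|.
Proof.
rewrite [leRHS]/Num.Def.normr /= mx_normrE.
exact: (le_bigmax _ (fun ij => `|h ij.1 ij.2|) (0, i)).
Qed.

Lemma norm_truncate_row (h : E) k : `|truncate_row h k| <= `|h|.
Proof.
rewrite [leLHS]/Num.Def.normr /= mx_normrE; apply: bigmax_le => // -[a b] _ /=.
rewrite !mxE; case: ifP => _; last by rewrite normr0.
exact: norm_coord_le.
Qed.

(** Each of the [d] coordinate moves replaces a partial derivative at [x] by one at a nearby point,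
    at cost [eps * |h|]. A move starts within [|h|] of [x] and has length at most [|h|], which is
    why [|h| + |h|] has to stay below the radius. *)
Lemma partial_linear_approx (r eps : R) f x :
  C1_on (ball x r) f ->
  (forall y i, ball x r y -> `|partial i f y - partial i f x| <= eps) ->
  forall h : E, `|h| + `|h| < r ->
  `|f (x + h) - f x - \sum_i h 0 i * partial i f x| <= d%:R * eps * `|h|.
Proof.
move=> Cf ep h hr.
suff H k : (k <= d)%N ->
    `|f (x + truncate_row h k) - f x
      - \sum_i truncate_row h k 0 i * partial i f x| <= k%:R * eps * `|h|.
  by have := H d (leqnn d); rewrite truncate_row_all.
elim: k => [|k IH] kd.
  rewrite truncate_row0 addr0 subrr !mul0r big1 ?subrr ?normr0//.
  by move=> i _; rewrite mxE mul0r.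
have {}IH := IH (ltnW kd).
set i0 := Ordinal kd; set y := x + truncate_row h k in IH *.
have yx : `|y - x| <= `|h| by rewrite /y addrAC subrr add0r norm_truncate_row.
have hr' : `|y - x| + `|h 0 i0| < r.
  by apply: le_lt_trans hr; apply: lerD => //; exact: norm_coord_le.
have [u ut fu] := partial_mvt i0 Cf hr'.
have bu : ball x r (y + u *: e_ i0).
  by apply: ball_line ut _; rewrite norm_delta_mx mulr1.
rewrite truncate_rowS addrA -/y -/i0.
have -> : \sum_i (truncate_row h k + h 0 i0 *: e_ i0) 0 i * partial i f x =
    \sum_i truncate_row h k 0 i * partial i f x + h 0 i0 * partial i0 f x.
  rewrite (eq_bigr (fun i => truncate_row h k 0 i * partial i f x
    + (h 0 i0 *: e_ i0) 0 i * partial i f x)); last first.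
    by move=> i _; rewrite !mxE mulrDl.
  rewrite big_split /=; congr (_ + _); rewrite (bigD1 i0) //= big1.
    by rewrite !mxE !eqxx mulr1 addr0.
  by move=> j /negbTE ji; rewrite !mxE ji mulr0 mul0r.
have -> : f (y + h 0 i0 *: e_ i0) - f x
  - (\sum_i truncate_row h k 0 i * partial i f x + h 0 i0 * partial i0 f x) =
  (f y - f x - \sum_i truncate_row h k 0 i * partial i f x)
  + h 0 i0 * (partial i0 f (y + u *: e_ i0) - partial i0 f x).
  by rewrite mulrBr -fu; ring.
apply: le_trans (ler_normD _ _) _.
rewrite -[in leRHS]natr1 [in leRHS]mulrDl [in leRHS]mulrDl mul1r.
apply: lerD => //; rewrite normrM mulrC.
by apply: ler_pM => //; [exact: ep|exact: norm_coord_le].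
Qed.

Lemma C2_differentiable U f x : open U -> U x -> C1_on U f ->
  (forall i, C1_on U (partial i f)) ->
  differentiable f x /\
  forall h, 'd f x h = \sum_i h 0 i * partial i f x.
Proof.
move=> oU Ux Cf Cf2.
pose L (h : E) := \sum_i h 0 i * partial i f x.
have linL : linear (L : E -> R).
  move=> c u v; rewrite /L scaler_sumr -big_split /=; apply: eq_bigr => i _.
  by rewrite !mxE mulrDl -mulrA.
pose L1 := GRing.isLinear.Build _ _ _ _ _ linL.
pose L2 : {linear E -> R} := HB.pack (L : E -> R) L1.
have cL : continuous L2.
  have cS (s : seq 'I_d) (g : E -> R) :
      (forall u, g u = \sum_(i <- s) u 0 i * partial i f x) -> continuous g.
    elim: s g => [|i s IH] g gE.
      have -> : g = cst 0 by apply/funext => u; rewrite gE big_nil.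
      exact: cst_continuous.
    have -> : g = (fun u : E => u 0 i * partial i f x) \+
        (fun u : E => \sum_(j <- s) u 0 j * partial j f x).
      by apply/funext => u; rewrite gE big_cons.
    move=> h; apply: continuousD; last by apply: IH.
    by apply: continuousM; [exact: coord_continuous|exact: cst_continuous].
  exact: (cS (index_enum _)).
have fL : (f : E -> R^o) \o shift x = cst (f x : R^o) + (L2 : E -> R^o) +o_ (0 : E) (id : E -> E).
  apply/(@eqaddoP R E R^o E) => eps e0.
  (* The [d] coordinate moves may each use up this much of [eps]; dividing by [d.+1] also covers
     [d = 0]. *)
  have e1 : 0 < eps / d.+1%:R by rewrite divr_gt0.
  have [r r0 rU] := ball_nbhs_ex oU Ux (continuous_partials_near e1 Ux Cf2).
  have Cr : C1_on (ball x r) f by move=> y /rU[Uy _]; exact: Cf.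
  have A := partial_linear_approx Cr (fun y i by_ => (rU y by_).2 i).
  have nr : \forall h \near (0 : E), `|h| < r / 2.
    by apply: nbhs0_lt; rewrite divr_gt0.
  near=> h; change (`|f (h + x) - (f x + L h)| <= eps * `|h|).
  rewrite (addrC h) opprD addrA.
  have hr : `|h| + `|h| < r.
    rewrite [ltRHS](splitr r); apply: ltrD; near: h; exact: nr.
  apply: le_trans (A h hr) _; rewrite ler_wpM2r//.
  by rewrite mulrC -mulrA ler_piMr ?(ltW e0)// mulrC ler_pdivrMr// mul1r ler_nat.
have dE := diff_unique cL fL; split; last by move=> h; rewrite dE.
by apply/diff_locallyP; rewrite dE.
Unshelve. all: end_near. Qed.

Lemma smooth_differentiable U f x : open U -> U x -> smooth_on U f ->
  differentiable f x.
Proof.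
move=> oU Ux sf; have [] // := C2_differentiable oU Ux (smooth_onC1 sf) _.
by move=> i; exact/smooth_onC1/smooth_on_partial.
Qed.

Lemma smooth_diffE U f x (h : E) : open U -> U x -> smooth_on U f ->
  'd f x h = \sum_i h 0 i * partial i f x.
Proof.
move=> oU Ux sf; have [] // := C2_differentiable oU Ux (smooth_onC1 sf) _.
by move=> i; exact/smooth_onC1/smooth_on_partial.
Qed.

End MeanValue.

(** * Symmetry of second derivatives and the chain rule *)

Section Schwarz.
Context {R : realType} {d : nat}.
Local Notation E := 'rV[R]_d.
Local Notation e_ i := (delta_mx 0 i : E).
Implicit Types (U V : set E) (f g : E -> R) (x y : E) (i j : 'I_d).

Lemma derivable_translate f (c y v : E) :
  derivable f (y + c) v -> derivable (fun z => f (z + c)) y v.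
Proof.
move=> /derivable1P df; apply/derivable1P.
have -> // : (fun h : R => f (h *: v + y + c)) =
  (fun h : R => f (h *: v + (y + c))).
by apply/funext => h; rewrite addrA.
Qed.

Lemma partial_translate i f (c y : E) :
  partial i (fun z => f (z + c)) y = partial i f (y + c).
Proof.
rewrite /partial /derive.
rewrite (_ : (fun h : R => h^-1 *: (((fun z => f (z + c)) \o
    shift y) (h *: e_ i) - f (y + c))) =
  (fun h : R => h^-1 *: ((f \o shift (y + c)) (h *: e_ i) - f (y + c)))) //.
by apply/funext => h /=; rewrite addrA.
Qed.

Lemma C1_translate U V f (c : E) : (forall y, V y -> U (y + c)) ->
  C1_on U f -> C1_on V (fun z => f (z + c)).
Proof.
move=> VU Cf y /VU Uy; have [cf df] := Cf _ Uy; split=> [|i].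
  apply: (@continuous_comp _ _ _ (fun z : E => z + c) f); last exact: cf.
  by apply: continuousD; [exact: cvg_id|exact: cst_continuous].
exact: derivable_translate.
Qed.

(** The mean value theorem is used twice: in direction [i] for [y |-> f (y + t e_j) - f y], then in
    direction [j] for [partial i f]. The left-hand side is symmetric in [i] and [j], which is what
    Schwarz's theorem exploits. *)
Lemma second_difference (r t : R) f x i j : 0 < t -> t + t < r ->
  C1_on (ball x r) f -> C1_on (ball x r) (partial i f) ->
  exists2 y, ball x r y &
    f (x + t *: e_ i + t *: e_ j) - f (x + t *: e_ i)
      - (f (x + t *: e_ j) - f x) = t ^+ 2 * partial j (partial i f) y.
Proof.
move=> t0 tr Cf Cif.
have bs y : ball x (r - t) y -> ball x r (y + t *: e_ j).
  rewrite -!ball_normE /= distrC => yr; apply: le_lt_trans (_ : `|y - x| + t < r).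
    rewrite distrC addrAC; apply: le_trans (ler_normD _ _) _.
    by rewrite lerD2l normrZ norm_delta_mx mulr1 gtr0_norm.
  by rewrite -ltrBrDr.
have bw y : ball x (r - t) y -> ball x r y.
  by apply: le_ball; rewrite lerBlDr lerDl ltW.
pose g y := f (y + t *: e_ j) - f y.
have Cg : C1_on (ball x (r - t)) g.
  apply: (@C1D _ _ _ _ (fun y => - f y)); first exact: C1_translate bs Cf.
  by apply: C1N => y /bw; exact: Cf.
have [|u ut gu] := @partial_mvt _ _ x x (r - t) g i t Cg.
  by rewrite subrr normr0 add0r gtr0_norm// ltrBrDr.
have bu : ball x (r - t) (x + u *: e_ i).
  apply: ball_line ut _.
  by rewrite norm_delta_mx mulr1 subrr normr0 add0r gtr0_norm// ltrBrDr.
have gE : partial i g (x + u *: e_ i) =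
    partial i f (x + u *: e_ i + t *: e_ j) - partial i f (x + u *: e_ i).
  have Cf1 : C1_on (ball x (r - t)) (fun z => f (z + t *: e_ j)).
    exact: C1_translate bs Cf.
  have Cf2 : C1_on (ball x (r - t)) f by move=> y /bw; exact: Cf.
  rewrite -(partial_translate i f (t *: e_ j)) -(C1_partialN i bu Cf2).
  by rewrite -(C1_partialD i bu Cf1 (C1N Cf2)).
have [|u' ut' hu] := @partial_mvt _ _ x (x + u *: e_ i) r (partial i f) j t Cif.
  rewrite addrAC subrr add0r normrZ norm_delta_mx mulr1.
  by apply: le_lt_trans tr; rewrite (gtr0_norm t0) lerD2r -(gtr0_norm t0).
exists (x + u *: e_ i + u' *: e_ j).
  apply: ball_line ut' _; rewrite norm_delta_mx mulr1.
  rewrite addrAC subrr add0r normrZ norm_delta_mx mulr1.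
  by apply: le_lt_trans tr; rewrite (gtr0_norm t0) lerD2r -(gtr0_norm t0).
by rewrite expr2 -mulrA -hu -gE -gu.
Qed.

Lemma partial_comm U f x i j : open U -> U x -> smooth_on U f ->
  partial i (partial j f) x = partial j (partial i f) x.
Proof.
move=> oU Ux sf; apply/eqP; rewrite -subr_eq0 -normr_le0; apply/ler_addgt0Pl => e e0.
rewrite addr0.
have e2 : 0 < e / 2 by rewrite divr_gt0.
have C2 k l : C1_on U (partial k (partial l f)).
  exact/smooth_onC1/smooth_on_partial/smooth_on_partial.
have [r1 r10 r1U] := ball_nbhs_ex oU Ux (continuous_partials_near e2 Ux (C2 ^~ j)).
have [r2 r20 r2U] := ball_nbhs_ex oU Ux (continuous_partials_near e2 Ux (C2 ^~ i)).
pose r := Num.min r1 r2; have r0 : 0 < r by rewrite lt_min r10.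
have b1 y : ball x r y -> ball x r1 y by apply: le_ball; rewrite ge_min lexx.
have b2 y : ball x r y -> ball x r2 y by apply: le_ball; rewrite ge_min lexx orbT.
have Cf : C1_on (ball x r) f by move=> y /b1/r1U[Uy _]; exact: smooth_onC1 sf y Uy.
have Cp k : C1_on (ball x r) (partial k f).
  by move=> y /b1/r1U[Uy _]; exact: smooth_onC1 (smooth_on_partial k sf) y Uy.
have t0 : 0 < r / 4 by rewrite divr_gt0.
have tr : r / 4 + r / 4 < r by lra.
have [y by_ yE] := second_difference j t0 tr Cf (Cp i).
have [z bz zE] := second_difference i t0 tr Cf (Cp j).
(* Both mixed derivatives, at their respective points, are the same second difference divided by
   [t ^+ 2]. Continuity then compares each with its value at [x]. *)
have yz : partial j (partial i f) y = partial i (partial j f) z.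
  apply: (@mulfI _ ((r / 4) ^+ 2)); first by rewrite expf_neq0// gt_eqF.
  have swap (a b c e' : R) : a - b - (c - e') = a - c - (b - e') by ring.
  rewrite (addrAC x ((r / 4) *: e_ j)) in zE.
  by apply: etrans (esym yE) _; apply: etrans zE; exact: swap.
have {}yE := (r2U _ (b2 _ by_)).2 j; have {}zE := (r1U _ (b1 _ bz)).2 i.
rewrite -yz distrC in zE.
rewrite (splitr e) -(subrKA (partial j (partial i f) y)).
exact: le_trans (ler_normD _ _) (lerD zE yE).
Qed.

End Schwarz.

Section ChainRule.
Context {R : realType} {d : nat}.
Local Notation E := 'rV[R]_d.
Local Notation e_ i := (delta_mx 0 i : E).
Implicit Types (U V W : set E) (f g : E -> R) (F : E -> E) (x y : E) (i j : 'I_d).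

Lemma smooth_map_differentiable W F x : open W -> W x -> smooth_map_on W F ->
  differentiable F x.
Proof.
move=> oW Wx sF.
have -> : F = \sum_j (fun y => F y 0 j *: e_ j).
  apply/funext => y; rewrite fct_sumE; exact: row_sum_delta.
apply: differentiable_sum => j; apply: differentiableZl.
exact: smooth_differentiable oW Wx (sF j).
Qed.

Lemma smooth_map_diffE W F x i j : open W -> W x -> smooth_map_on W F ->
  ('d F x (e_ i)) 0 j = partial i (fun y => F y 0 j) x.
Proof.
move=> oW Wx sF; have dF := smooth_map_differentiable oW Wx sF.
rewrite -deriveE// derive_mx ?mxE//; exact: diff_derivable.
Qed.

Lemma jacobianE W F x i j : open W -> W x -> smooth_map_on W F ->
  jacobian F x i j = partial i (fun y => F y 0 j) x.
Proof.
move=> oW Wx sF; have dF := smooth_map_differentiable oW Wx sF.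
by rewrite -(smooth_map_diffE i j oW Wx sF) -deriveE // deriveEjacobian // -rowE [RHS]mxE.
Qed.

Section Composition.
Variables (W V : set E) (F : E -> E).
Hypotheses (oW : open W) (oV : open V) (sF : smooth_map_on W F)
  (FWV : forall x, W x -> V (F x)).

Lemma differentiable_smooth_comp f x : W x -> smooth_on V f ->
  differentiable (f \o F) x.
Proof.
move=> Wx sf; apply: differentiable_comp.
  exact: smooth_map_differentiable oW Wx sF.
exact: smooth_differentiable oV (FWV Wx) sf.
Qed.

Lemma C1_comp f : smooth_on V f -> C1_on W (f \o F).
Proof.
move=> sf x Wx; have df := differentiable_smooth_comp Wx sf.
by split=> [|i]; [exact: differentiable_continuous|exact: diff_derivable].
Qed.

Lemma partial_comp f x i : W x -> smooth_on V f ->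
  partial i (f \o F) x = \sum_j partial i (fun y => F y 0 j) x * partial j f (F x).
Proof.
move=> Wx sf; rewrite /partial deriveE; last exact: differentiable_smooth_comp.
rewrite diff_comp; first last.
- exact: smooth_differentiable oV (FWV Wx) sf.
- exact: smooth_map_differentiable oW Wx sF.
rewrite /= (smooth_diffE _ oV (FWV Wx) sf); apply: eq_bigr => j _.
by rewrite (smooth_map_diffE _ _ oW Wx sF).
Qed.

(** Induction on the order for all [f] at once: by the chain rule a derivative of [f \o F] is a sum
    of products of derivatives of [F] with functions [partial j f \o F], to which the induction
    hypothesis applies. *)
Lemma smooth_comp f : smooth_on V f -> smooth_on W (f \o F).
Proof.
move=> sf; apply/smooth_onP => n; elim: n f sf => [|n IH] f sf;
  (split; first exact: C1_comp); first by [].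
move=> i; apply: (Cn_on_ext oW (f := fun x =>
  \sum_j partial i (fun y => F y 0 j) x * (partial j f \o F) x)).
  by move=> y Wy; rewrite partial_comp.
elim: (index_enum _) => [|j s IHs].
  apply: (Cn_on_ext oW _ (Cn_cst n W 0)) => y _.
  by rewrite big_nil.
apply: (Cn_on_ext oW _ (CnD oW (CnM oW
  ((smooth_onP _ _).1 (smooth_on_partial i (sF j)) n)
  (IH _ (smooth_on_partial j sf))) IHs)) => y _.
by rewrite big_cons.
Qed.

End Composition.

Section InverseSquareRoot.
Variables (U : set E) (f : E -> R).
Hypotheses (oU : open U) (sf : smooth_on U f) (f0 : forall x, U x -> 0 < f x).

Let differentiable_sqrt_comp x : U x -> differentiable (Num.sqrt \o f) x.
Proof.
move=> Ux; apply: differentiable_comp; first exact: smooth_differentiable oU Ux sf.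
by apply/derivable1_diffP; have [] := is_derive1_sqrt (f0 Ux).
Qed.

Lemma partial_sqrt x i : U x ->
  partial i (fun y => Num.sqrt (f y)) x = (2 * Num.sqrt (f x))^-1 * partial i f x.
Proof.
move=> Ux; rewrite /partial (_ : (fun y => Num.sqrt (f y)) = Num.sqrt \o f) //.
have [ds dsE] := is_derive1_sqrt (f0 Ux).
rewrite deriveE; last exact: differentiable_sqrt_comp.
rewrite diff_comp; first last.
- exact/derivable1_diffP.
- exact: smooth_differentiable oU Ux sf.
rewrite /= deriv1E // derive1E dsE -deriveE; last first.
  exact: smooth_differentiable oU Ux sf.
exact: mulrC.
Qed.

(** A bootstrap: the derivative of the root is [partial i f] divided by twice the root, so
    regularity of order [n] of the root yields order [n.+1]. *)
Lemma smooth_sqrt : smooth_on U (fun y => Num.sqrt (f y)).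
Proof.
have C1 : C1_on U (fun y => Num.sqrt (f y)).
  move=> x Ux; have df := differentiable_sqrt_comp Ux.
  by split=> [|i]; [exact: differentiable_continuous df|exact: diff_derivable df].
apply/smooth_onP; elim=> [|n IH]; (split; first exact: C1); first by [].
move=> i; have C2 := CnM oU (Cn_cst n U 2) IH.
have C3 : Cn_on n U (fun x => (2 * Num.sqrt (f x))^-1).
  by apply: CnV C2 => // x Ux; rewrite mulf_neq0 ?pnatr_eq0// gt_eqF// sqrtr_gt0 f0.
have C4 := (smooth_onP _ _).1 (smooth_on_partial i sf) n.
by apply: (Cn_on_ext oU _ (CnM oU C3 C4)) => y Uy; rewrite partial_sqrt.
Qed.

End InverseSquareRoot.
End ChainRule.

(** * Universal polynomials in the jets of a metric and a function *)

Section Universal.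
Context {R : realType} {d : nat}.
Local Notation E := 'rV[R]_d.
Implicit Types (U : set E) (G : E -> 'M[R]_d) (f : E -> R) (x : E) (m o : R).

(** The two real arguments stand for [1 / |ds|] and for the component of the volume form, both
    frozen at the base point; as plain numbers they are constant under differentiation. *)
Definition field_functional := (E -> 'M[R]_d) -> (E -> R) -> R -> R -> E -> R.

Definition regular_on U G f : Prop :=
  [/\ open U, forall i j, smooth_on U (fun x => G x i j),
      forall x, U x -> \det (G x) != 0 & smooth_on U f].

(** Polynomials in the jets of the metric and the function, the inverse determinant and the two
    frozen constants. The last constructor allows any formula that agrees with such a polynomial on
    smooth data with invertible metric, since rules such as Cramer's or Leibniz' hold only there. *)
Inductive universal : field_functional -> Prop :=
| universal_cst c : universal (fun _ _ _ _ _ => c)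
| universal_par : universal (fun _ _ m _ _ => m)
| universal_vol : universal (fun _ _ _ o _ => o)
| universal_metric i j a :
    universal (fun G _ _ _ => partials a (fun y => G y i j))
| universal_invdet : universal (fun G _ _ _ x => (\det (G x))^-1)
| universal_fun a : universal (fun _ f _ _ => partials a f)
| universal_add Phi Psi : universal Phi -> universal Psi ->
    universal (fun G f m o x => Phi G f m o x + Psi G f m o x)
| universal_mul Phi Psi : universal Phi -> universal Psi ->
    universal (fun G f m o x => Phi G f m o x * Psi G f m o x)
| universal_ext Phi Psi : (forall U G f m o x, regular_on U G f -> U x ->
      Phi G f m o x = Psi G f m o x) ->
    universal Psi -> universal Phi.

Lemma universal_opp Phi : universal Phi ->
  universal (fun G f m o x => - Phi G f m o x).
Proof.
move=> uP; apply: universal_ext (universal_mul (universal_cst (-1)) uP).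
by move=> *; rewrite mulN1r.
Qed.

Lemma universal_sub Phi Psi : universal Phi -> universal Psi ->
  universal (fun G f m o x => Phi G f m o x - Psi G f m o x).
Proof. by move=> uP uQ; exact: universal_add uP (universal_opp uQ). Qed.

Lemma universal_sum (I : Type) (r : seq I) (Q : pred I) (Phi : I -> field_functional) :
  (forall k, Q k -> universal (Phi k)) ->
  universal (fun G f m o x => \sum_(k <- r | Q k) Phi k G f m o x).
Proof.
move=> uP; elim: r => [|k r IH].
  by apply: universal_ext (universal_cst 0) => *; rewrite big_nil.
have [Qk|nQk] := boolP (Q k).
  by apply: universal_ext (universal_add (uP k Qk) IH) => *; rewrite big_cons Qk.
by apply: universal_ext IH => *; rewrite big_cons (negbTE nQk).
Qed.

Lemma universal_prod (I : Type) (r : seq I) (Q : pred I) (Phi : I -> field_functional) :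
  (forall k, Q k -> universal (Phi k)) ->
  universal (fun G f m o x => \prod_(k <- r | Q k) Phi k G f m o x).
Proof.
move=> uP; elim: r => [|k r IH].
  by apply: universal_ext (universal_cst 1) => *; rewrite big_nil.
have [Qk|nQk] := boolP (Q k).
  by apply: universal_ext (universal_mul (uP k Qk) IH) => *; rewrite big_cons Qk.
by apply: universal_ext IH => *; rewrite big_cons (negbTE nQk).
Qed.

Lemma universal_exp Phi n : universal Phi ->
  universal (fun G f m o x => Phi G f m o x ^+ n).
Proof.
move=> uP; elim: n => [|n IH].
  by apply: universal_ext (universal_cst 1) => *; rewrite expr0.
by apply: universal_ext (universal_mul uP IH) => *; rewrite exprS.
Qed.

Lemma universal_det n
    (A : (E -> 'M[R]_d) -> (E -> R) -> R -> R -> E -> 'M[R]_n) :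
  (forall i j, universal (fun G f m o x => A G f m o x i j)) ->
  universal (fun G f m o x => \det (A G f m o x)).
Proof.
move=> uA; apply: universal_sum => s _; apply: universal_mul.
  exact: universal_cst.
by apply: universal_prod => i _; exact: uA.
Qed.

(** Cramer's rule: a cofactor times the inverse determinant, so that [(det g)^-1] is the only
    denominator ever required. *)
Lemma universal_invmx i j : universal (fun G _ _ _ x => invmx (G x) i j).
Proof.
apply: (@universal_ext _ (fun G _ _ _ x => (\det (G x))^-1 *
    ((-1) ^+ (j + i) * \det (row' j (col' i (G x)))))).
  move=> U G f m o x [_ _ det0 _] Ux.
  by rewrite /invmx unitmxE unitfE det0// !mxE.
apply: universal_mul; first exact: universal_invdet.
apply: universal_mul; first exact: universal_cst.
apply: universal_det => a b.
apply: universal_ext (universal_metric (lift j a) (lift i b) [::]).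
by move=> U G f m o x _ _; rewrite !mxE.
Qed.

Lemma smooth_on_partials U f a : smooth_on U f -> smooth_on U (partials a f).
Proof.
move=> sf; elim: a => [|i a IH]; first exact: sf.
exact: (smooth_on_partial i IH).
Qed.

Lemma smooth_det U (n : nat) (A : E -> 'M[R]_n) : open U ->
  (forall i j, smooth_on U (fun x => A x i j)) -> smooth_on U (fun x => \det (A x)).
Proof.
move=> oU sA; apply: (smooth_sum oU) => s _; apply: (smoothM oU).
  exact: smooth_cst.
by apply: (smooth_prod oU) => i _; exact: sA.
Qed.

Lemma universal_smooth Phi U G f m o : universal Phi -> regular_on U G f ->
  smooth_on U (Phi G f m o).
Proof.
move=> uP rU; have [oU sG det0 sf] := rU.
elim: uP => {Phi}.
- by move=> c; exact: smooth_cst.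
- exact: smooth_cst.
- exact: smooth_cst.
- by move=> i j a; exact/smooth_on_partials/sG.
- exact (smoothV oU det0 (smooth_det oU sG)).
- by move=> a; exact: smooth_on_partials.
- by move=> Phi Psi _ sP _ sQ; exact: smoothD.
- by move=> Phi Psi _ sP _ sQ; exact: smoothM.
- move=> Phi Psi PQ _ sQ; apply: (smooth_on_ext oU _ sQ) => y Uy.
  by rewrite (PQ _ _ _ _ _ _ rU Uy).
Qed.

Section Partial.
Variable i : 'I_d.

(** The Leibniz rule requires smooth factors, and smoothness follows from universality; the
    induction therefore carries both statements together. *)
Let derivable_universal Phi :=
  universal Phi /\ universal (fun G f m o => partial i (Phi G f m o)).

Let derivable_cst c : derivable_universal (fun _ _ _ _ _ => c).
Proof.
split; first exact: universal_cst.
by apply: universal_ext (universal_cst 0) => *; exact: partial_cst.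
Qed.

Let derivable_add Phi Psi : derivable_universal Phi -> derivable_universal Psi ->
  derivable_universal (fun G f m o x => Phi G f m o x + Psi G f m o x).
Proof.
move=> [uP dP] [uQ dQ]; split; first exact: universal_add.
apply: universal_ext (universal_add dP dQ) => U G f m o x rU Ux.
have [oU _ _ _] := rU.
by rewrite (partialD i Ux (universal_smooth m o uP rU) (universal_smooth m o uQ rU)).
Qed.

Let derivable_mul Phi Psi : derivable_universal Phi -> derivable_universal Psi ->
  derivable_universal (fun G f m o x => Phi G f m o x * Psi G f m o x).
Proof.
move=> [uP dP] [uQ dQ]; split; first exact: universal_mul.
apply: universal_ext (universal_add (universal_mul uP dQ) (universal_mul dP uQ)).
move=> U G f m o x rU Ux; have [oU _ _ _] := rU.
by rewrite (partialM i Ux (universal_smooth m o uP rU) (universal_smooth m o uQ rU)).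
Qed.

Let derivable_ext Phi Psi : (forall U G f m o x, regular_on U G f -> U x ->
    Phi G f m o x = Psi G f m o x) -> derivable_universal Psi -> derivable_universal Phi.
Proof.
move=> PQ [uQ dQ]; split; first exact: universal_ext PQ uQ.
apply: universal_ext dQ => U G f m o x rU Ux; have [oU _ _ _] := rU.
by apply: (partial_ext i oU Ux) => y Uy; exact: PQ rU Uy.
Qed.

Let derivable_det : derivable_universal (fun G _ _ _ x => \det (G x)).
Proof.
rewrite /determinant; elim: (index_enum _) => [|s r IH].
  by apply: derivable_ext (derivable_cst 0) => *; rewrite big_nil.
have dp : derivable_universal
      (fun (G : E -> 'M[R]_d) _ _ _ x => \prod_k G x k (s k)).
  elim: (index_enum _) => [|k t IHt] /=.
    by apply: derivable_ext (derivable_cst 1) => *; rewrite big_nil.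
  have dk : derivable_universal (fun (G : E -> 'M[R]_d) _ _ _ x => G x k (s k)).
    by split; [exact: (universal_metric k (s k) [::])|
               exact: (universal_metric k (s k) [:: i])].
  by apply: derivable_ext (derivable_mul dk IHt) => *; rewrite big_cons.
apply: derivable_ext (derivable_add (derivable_mul (derivable_cst ((-1) ^+ s)) dp) IH).
by move=> *; rewrite big_cons.
Qed.

Lemma universal_partial Phi : universal Phi ->
  universal (fun G f m o => partial i (Phi G f m o)).
Proof.
move=> uP; suff [] : derivable_universal Phi by [].
elim: uP => {Phi}.
- exact: derivable_cst.
- split; first exact: universal_par.
  by apply: universal_ext (universal_cst 0) => *; exact: partial_cst.
- split; first exact: universal_vol.
  by apply: universal_ext (universal_cst 0) => *; exact: partial_cst.
- move=> j k a; split; first exact: universal_metric.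
  exact: (universal_metric j k (i :: a)).
- split; first exact: universal_invdet.
  have [uD dD] := derivable_det.
  apply: universal_ext (universal_mul
    (universal_opp (universal_exp 2 universal_invdet)) dD).
  move=> U G f m o x [oU sG det0 _] Ux.
  by rewrite (partialV i Ux (det0 x Ux) (smooth_det oU sG)).
- move=> a; split; first exact: universal_fun.
  exact: (universal_fun (i :: a)).
- by move=> Phi Psi _ dP _ dQ; exact: derivable_add.
- by move=> Phi Psi _ dP _ dQ; exact: derivable_mul.
- by move=> Phi Psi PQ _ dQ; exact: derivable_ext PQ dQ.
Qed.

End Partial.

Lemma universal_partials a Phi : universal Phi ->
  universal (fun G f m o => partials a (Phi G f m o)).
Proof. by move=> uP; elim: a => //= i a IH; exact: universal_partial IH. Qed.

Lemma universal_fun0 : universal (fun _ f _ _ => f).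
Proof. exact: (universal_fun [::]). Qed.

Lemma universal_christoffel k i j :
  universal (fun G _ _ _ => christoffel G k i j).
Proof.
apply: universal_mul; first exact: universal_cst.
apply: universal_sum => l _; apply: universal_mul; first exact: universal_invmx.
apply: universal_sub; last exact: (universal_metric i j [:: l]).
apply: universal_add; first exact: (universal_metric l j [:: i]).
exact: (universal_metric i l [:: j]).
Qed.

Lemma universal_grad_inner Phi Psi : universal Phi -> universal Psi ->
  universal (fun G f m o x => \sum_a \sum_b
    invmx (G x) a b * partial a (Phi G f m o) x * partial b (Psi G f m o) x).
Proof.
move=> uP uQ; apply: universal_sum => a _; apply: universal_sum => b _.
apply: universal_mul (universal_partial b uQ).
exact: universal_mul (universal_invmx a b) (universal_partial a uP).
Qed.

Lemma universal_laplacian Phi : universal Phi ->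
  universal (fun G f m o => laplacian G (Phi G f m o)).
Proof.
move=> uP; apply: universal_sum => a _; apply: universal_sum => b _.
apply: universal_mul; first exact: universal_invmx.
apply: universal_sub; first exact: universal_partials [:: a; b] _ uP.
apply: universal_sum => k _.
exact: universal_mul (universal_christoffel k a b) (universal_partial k uP).
Qed.

Lemma universal_schouten_trace : universal (fun G _ _ _ => schouten_trace G).
Proof.
apply: universal_mul; last exact: universal_cst.
apply: universal_sum => i _; apply: universal_sum => j _.
apply: universal_mul; first exact: universal_invmx.
apply: universal_sum => k _; apply: universal_add.
  apply: universal_sub; first exact: universal_partial k _ (universal_christoffel k i j).
  exact: universal_partial j _ (universal_christoffel k i k).
have uc := universal_christoffel.
by apply: universal_sum => l _; apply: universal_sub; apply: universal_mul; exact: uc.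
Qed.

(** Serves to substitute the jets of the unit field for the variables of the polynomial that gives
    [P]. *)
Lemma universal_meval n (q : mpoly.mpoly n R) (Phi : 'I_n -> field_functional) :
  (forall k, universal (Phi k)) ->
  universal (fun G f m o x => mpoly.meval (fun k => Phi k G f m o x) q).
Proof.
move=> uP; refine (@universal_ext _ (fun G f m o x =>
   \sum_(e <- mpoly.msupp q) mpoly.mcoeff e q *
     \prod_k Phi k G f m o x ^+ (mpoly.fun_of_multinom e k)) _ _).
  by move=> *; rewrite mpoly.mevalE.
apply: universal_sum => e _; apply: universal_mul; first exact: universal_cst.
by apply: universal_prod => k _; exact: universal_exp.
Qed.

(** The chart-level counterpart of [jet_value], with the inverse norm and the volume component
    replaced by the free constants [m] and [o]. *)
Definition universal_jet_value G f m o x (v : jet_variable d) : R :=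
  match v with
  | JetMetric i j a => partials a (fun y => G y i j) x
  | JetInvDet => (\det (G x))^-1
  | JetFun a => partials a f x
  | JetInvNorm => m
  | JetVolume => o
  end.

Lemma universal_mpoly Phi : universal Phi ->
  exists (n : nat) (v : 'I_n -> jet_variable d) (q : mpoly.mpoly n R),
  forall U G f m o x, regular_on U G f -> U x ->
    Phi G f m o x = mpoly.meval (fun k => universal_jet_value G f m o x (v k)) q.
Proof.
have leaf (v : jet_variable d) : exists (n : nat) (v' : 'I_n -> jet_variable d)
    (q : mpoly.mpoly n R), forall U G f m o x, regular_on U G f -> U x ->
    universal_jet_value G f m o x v =
    mpoly.meval (fun k => universal_jet_value G f m o x (v' k)) q.
  exists 1%N, (fun=> v), (mpoly.mpolyX R (mpoly.mnm1 ord0)) => *.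
  by rewrite mpoly.mevalXU.
(* Renaming of variables: two polynomials are moved to disjoint blocks of variables before they are
   added or multiplied. *)
have widen n n' (q : mpoly.mpoly n R) (h : 'I_n -> 'I_n') (u : 'I_n' -> R) :
    mpoly.meval u (mpoly.comp_mpoly [tuple mpoly.mpolyX R (mpoly.mnm1 (h k)) | k < n] q)
    = mpoly.meval (u \o h) q.
  rewrite mpoly.comp_mpoly_meval; apply: mpoly.meval_eq => k.
  by rewrite tnth_mktuple mpoly.mevalXU.
elim=> {Phi}.
(* There are no variables here, so the family is indexed by an empty type and [JetInvDet] is a mere
   placeholder. *)
- move=> c; exists 0%N, (fun=> JetInvDet d), (mpoly.mpolyC 0 c) => *.
  by rewrite mpoly.mevalC.
- exact: (leaf (JetInvNorm d)).
- exact: (leaf (JetVolume d)).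
- by move=> i j a; exact: (leaf (JetMetric i j a)).
- exact: (leaf (JetInvDet d)).
- by move=> a; exact: (leaf (JetFun a)).
- move=> Phi Psi _ [n1 [v1 [q1 E1]]] _ [n2 [v2 [q2 E2]]].
  exists (n1 + n2)%N, (fun k => match fintype.split k with inl a => v1 a | inr b => v2 b end).
  exists (mpoly.comp_mpoly [tuple mpoly.mpolyX R (mpoly.mnm1 (lshift n2 k)) | k < n1] q1
   + mpoly.comp_mpoly [tuple mpoly.mpolyX R (mpoly.mnm1 (rshift n1 k)) | k < n2] q2).
  move=> U G f m o x rU Ux; rewrite mpoly.mevalD !widen.
  rewrite (E1 _ _ _ _ _ _ rU Ux) (E2 _ _ _ _ _ _ rU Ux); congr (_ + _);
    apply: mpoly.meval_eq => k /=.
    by rewrite (unsplitK (inl _ k)).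
  by rewrite (unsplitK (inr _ k)).
- move=> Phi Psi _ [n1 [v1 [q1 E1]]] _ [n2 [v2 [q2 E2]]].
  exists (n1 + n2)%N, (fun k => match fintype.split k with inl a => v1 a | inr b => v2 b end).
  exists (mpoly.comp_mpoly [tuple mpoly.mpolyX R (mpoly.mnm1 (lshift n2 k)) | k < n1] q1
   * mpoly.comp_mpoly [tuple mpoly.mpolyX R (mpoly.mnm1 (rshift n1 k)) | k < n2] q2).
  move=> U G f m o x rU Ux; rewrite mpoly.mevalM !widen.
  rewrite (E1 _ _ _ _ _ _ rU Ux) (E2 _ _ _ _ _ _ rU Ux); congr (_ * _);
    apply: mpoly.meval_eq => k /=.
    by rewrite (unsplitK (inl _ k)).
  by rewrite (unsplitK (inr _ k)).
- move=> Phi Psi PQ _ [n [v [q E]]]; exists n, v, q => U G f m o x rU Ux.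
  by rewrite (PQ _ _ _ _ _ _ rU Ux) (E _ _ _ _ _ _ rU Ux).
Qed.

End Universal.

(** * Riemannian geometry in a chart *)

Section MatrixCalculus.
Context {R : realType} {d : nat}.
Local Notation E := 'rV[R]_d.
Implicit Types (U : set E) (f : E -> R) (x : E) (k : 'I_d).

Definition smooth_mx p q U (A : E -> 'M[R]_(p, q)) :=
  forall i j, smooth_on U (fun y => A y i j).

Definition mx_partial p q k (A : E -> 'M[R]_(p, q)) x : 'M[R]_(p, q) :=
  \matrix_(i, j) partial k (fun y => A y i j) x.

Definition dcol f x : 'cV[R]_d := \col_i partial i f x.

Section Open.
Variables (U : set E).
Hypothesis oU : open U.

Lemma mx_partial_ext p q k (A B : E -> 'M[R]_(p, q)) x : U x ->
  (forall y, U y -> A y = B y) -> mx_partial k A x = mx_partial k B x.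
Proof.
move=> Ux AB; apply/matrixP => i j; rewrite !mxE.
by apply: (partial_ext k oU Ux) => y Uy; rewrite AB.
Qed.

Lemma smooth_mx_ext p q (A B : E -> 'M[R]_(p, q)) :
  (forall y, U y -> A y = B y) -> smooth_mx U A -> smooth_mx U B.
Proof.
move=> AB sA i j; apply: (smooth_on_ext oU _ (sA i j)) => y Uy.
by rewrite AB.
Qed.

Lemma smooth_mxD p q (A B : E -> 'M[R]_(p, q)) :
  smooth_mx U A -> smooth_mx U B -> smooth_mx U (fun y => A y + B y).
Proof.
move=> sA sB i j; apply: (smooth_on_ext oU _ (smoothD oU (sA i j) (sB i j))).
by move=> y _; rewrite mxE.
Qed.

Lemma smooth_mxM p q r (A : E -> 'M[R]_(p, q)) (B : E -> 'M[R]_(q, r)) :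
  smooth_mx U A -> smooth_mx U B -> smooth_mx U (fun y => A y *m B y).
Proof.
move=> sA sB i j; apply: (smooth_on_ext oU (f := fun y => \sum_k A y i k * B y k j)).
  by move=> y _; rewrite mxE.
by apply: (smooth_sum oU) => k _; exact: (smoothM oU (sA i k) (sB k j)).
Qed.

Lemma smooth_mxZ p q f (A : E -> 'M[R]_(p, q)) :
  smooth_on U f -> smooth_mx U A -> smooth_mx U (fun y => f y *: A y).
Proof.
move=> sf sA i j; apply: (smooth_on_ext oU _ (smoothM oU sf (sA i j))).
by move=> y _; rewrite mxE.
Qed.

Lemma smooth_mx_tr p q (A : E -> 'M[R]_(p, q)) :
  smooth_mx U A -> smooth_mx U (fun y => (A y)^T).
Proof.
move=> sA i j; apply: (smooth_on_ext oU _ (sA j i)) => y _; by rewrite mxE.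
Qed.

Lemma smooth_mx_sum p q (I : Type) (r : seq I) (A : I -> E -> 'M[R]_(p, q)) :
  (forall l, smooth_mx U (A l)) -> smooth_mx U (fun y => \sum_(l <- r) A l y).
Proof.
move=> sA i j; apply: (smooth_on_ext oU (f := fun y => \sum_(l <- r) A l y i j)).
  by move=> y _; rewrite summxE.
by apply: (smooth_sum oU) => l _; exact: sA.
Qed.

Lemma smooth_mx_cst p q (A : 'M[R]_(p, q)) : smooth_mx U (fun=> A).
Proof. by move=> i j; exact: smooth_cst. Qed.

Lemma smooth_mx_partial p q k (A : E -> 'M[R]_(p, q)) :
  smooth_mx U A -> smooth_mx U (mx_partial k A).
Proof.
move=> sA i j; apply: (smooth_on_ext oU _ (smooth_on_partial k (sA i j))).
by move=> y _; rewrite mxE.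
Qed.

Lemma smooth_dcol f : smooth_on U f -> smooth_mx U (dcol f).
Proof.
move=> sf i j; apply: (smooth_on_ext oU _ (smooth_on_partial i sf)).
by move=> y _; rewrite mxE.
Qed.

Lemma mx_partialD p q k (A B : E -> 'M[R]_(p, q)) x : U x ->
  smooth_mx U A -> smooth_mx U B ->
  mx_partial k (fun y => A y + B y) x = mx_partial k A x + mx_partial k B x.
Proof.
move=> Ux sA sB; apply/matrixP => i j; rewrite !mxE.
rewrite -(partialD k Ux (sA i j) (sB i j)).
by apply: (partial_ext k oU Ux) => y _; rewrite mxE.
Qed.

Lemma mx_partial_sum p q k (I : Type) (r : seq I) (A : I -> E -> 'M[R]_(p, q)) x :
  U x -> (forall l, smooth_mx U (A l)) ->
  mx_partial k (fun y => \sum_(l <- r) A l y) x = \sum_(l <- r) mx_partial k (A l) x.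
Proof.
move=> Ux sA; apply/matrixP => i j; rewrite summxE mxE.
rewrite [RHS](eq_bigr (fun l => partial k (fun y => A l y i j) x)); last first.
  by move=> l _; rewrite mxE.
rewrite -(partial_sum oU _ k Ux) => [|l _]; last exact: sA.
by apply: (partial_ext k oU Ux) => y _; rewrite summxE.
Qed.

Lemma mx_partialM p q r k (A : E -> 'M[R]_(p, q)) (B : E -> 'M[R]_(q, r)) x :
  U x -> smooth_mx U A -> smooth_mx U B ->
  mx_partial k (fun y => A y *m B y) x =
  mx_partial k A x *m B x + A x *m mx_partial k B x.
Proof.
move=> Ux sA sB; apply/matrixP => i j; rewrite !mxE.
rewrite (_ : partial k _ x = partial k (fun y => \sum_l A y i l * B y l j) x).
  rewrite (partial_sum oU _ k Ux) => [|l _]; last exact: (smoothM oU (sA i l) (sB l j)).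
  rewrite -big_split; apply: eq_bigr => l _ /=.
  by rewrite (partialM k Ux (sA i l) (sB l j)) !mxE addrC.
by apply: (partial_ext k oU Ux) => y _; rewrite mxE.
Qed.

Lemma mx_partialZ p q k f (A : E -> 'M[R]_(p, q)) x :
  U x -> smooth_on U f -> smooth_mx U A ->
  mx_partial k (fun y => f y *: A y) x =
  partial k f x *: A x + f x *: mx_partial k A x.
Proof.
move=> Ux sf sA; apply/matrixP => i j; rewrite !mxE.
rewrite (_ : partial k _ x = partial k (fun y => f y * A y i j) x).
  by rewrite (partialM k Ux sf (sA i j)) addrC.
by apply: (partial_ext k oU Ux) => y _; rewrite mxE.
Qed.

Lemma mx_partial_tr p q k (A : E -> 'M[R]_(p, q)) x : U x ->
  mx_partial k (fun y => (A y)^T) x = (mx_partial k A x)^T.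
Proof.
move=> Ux; apply/matrixP => i j; rewrite !mxE.
by apply: (partial_ext k oU Ux) => y _; rewrite mxE.
Qed.

Lemma mx_partial_cst p q k (A : 'M[R]_(p, q)) x : mx_partial k (fun=> A) x = 0.
Proof. by apply/matrixP => i j; rewrite !mxE partial_cst. Qed.

Lemma mx_partial_dcol f x k l : U x -> smooth_on U f ->
  (mx_partial k (dcol f) x) l 0 = (mx_partial l (dcol f) x) k 0.
Proof.
move=> Ux sf; rewrite [LHS]mxE [RHS]mxE.
transitivity (partial k (partial l f) x).
  by apply: (partial_ext k oU Ux) => y _; rewrite mxE.
rewrite (partial_comm k l oU Ux sf).
by apply: (partial_ext l oU Ux) => y _; rewrite mxE.
Qed.

End Open.
End MatrixCalculus.

(** * The Levi-Civita connection and its curvature as matrices *)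

Section LeviCivita.
Context {R : realType} {d : nat}.
Local Notation E := 'rV[R]_d.
Implicit Types (U : set E) (f : E -> R) (x : E) (i j k l : 'I_d).

Definition metric_on U (G : E -> 'M[R]_d) : Prop :=
  [/\ open U, smooth_mx U G, forall x, U x -> (G x)^T = G x &
      forall x, U x -> forall v : E, v != 0 -> 0 < (v *m G x *m v^T) 0 0].

(** The upper index of the Christoffel symbol is the column. With covectors written as columns, the
    covariant derivative of [w] is then [mx_partial k w - connection_mx G k *m w]. *)
Definition connection_mx (G : E -> 'M[R]_d) k x : 'M[R]_d :=
  \matrix_(i, j) christoffel G j k i x.

(** Minus the commutator of the covariant derivatives in directions [k] and [l] acting on
    covectors. *)
Definition curvature_mx (G : E -> 'M[R]_d) k l x : 'M[R]_d :=
  mx_partial k (connection_mx G l) x - mx_partial l (connection_mx G k) x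
  - connection_mx G k x *m connection_mx G l x
  + connection_mx G l x *m connection_mx G k x.

Definition hessian (G : E -> 'M[R]_d) f x : 'M[R]_d :=
  \matrix_(k, i) (mx_partial k (dcol f) x - connection_mx G k x *m dcol f x) i 0.

Definition inner (G : E -> 'M[R]_d) (f g : E -> R) x : R :=
  \sum_a \sum_b invmx (G x) a b * partial a f x * partial b g x.

Lemma innerE G f g x :
  inner G f g x = ((dcol f x)^T *m invmx (G x) *m dcol g x) 0 0.
Proof.
rewrite -mulmxA mxE; apply: eq_bigr => a _; rewrite !mxE mulr_sumr.
by apply: eq_bigr => b _; rewrite !mxE mulrA (mulrC (partial a f x)).
Qed.

Lemma mx_partial_dcolE f x k i :
  (mx_partial k (dcol f) x) i 0 = partial k (partial i f) x.
Proof. by rewrite [LHS]mxE; congr (partial k _ x); apply/funext => y; rewrite mxE. Qed.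

Lemma hessianE G f x k i : hessian G f x k i =
  partial k (partial i f) x - \sum_l christoffel G l k i x * partial l f x.
Proof.
rewrite [LHS]mxE [LHS]mxE mx_partial_dcolE; congr (_ + _).
rewrite mxE; congr (- _); rewrite mxE; apply: eq_bigr => l _.
by rewrite !mxE.
Qed.

Section Metric.
Variables (U : set E) (G : E -> 'M[R]_d).
Hypothesis GU : metric_on U G.

Lemma metric_open : open U. Proof. by case: GU. Qed.

Lemma metric_on_smooth : smooth_mx U G. Proof. by case: GU. Qed.

Lemma metric_on_sym x : U x -> (G x)^T = G x. Proof. by case: GU => _ _ + _; exact. Qed.

Lemma metric_det x : U x -> \det (G x) != 0.
Proof.
move=> Ux; have [_ _ _ pos] := GU; apply/det0P => -[v v0 vG].
by have := pos x Ux v v0; rewrite vG mul0mx mxE ltxx.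
Qed.

Lemma metric_unit x : U x -> G x \in unitmx.
Proof. by move=> Ux; rewrite unitmxE unitfE metric_det. Qed.

Lemma invmx_sym x : U x -> (invmx (G x))^T = invmx (G x).
Proof. by move=> Ux; rewrite trmx_inv metric_on_sym. Qed.

Lemma metric_regular f : smooth_on U f -> regular_on U G f.
Proof.
move=> sf; split; last exact: sf.
- exact: metric_open.
- exact: metric_on_smooth.
- exact: metric_det.
Qed.

Let regular0 : regular_on U G (fun=> 0).
Proof. by apply: metric_regular; exact: smooth_cst. Qed.

Lemma smooth_invmx : smooth_mx U (fun y => invmx (G y)).
Proof.
by move=> i j; exact: (universal_smooth 0 0 (universal_invmx i j) regular0).
Qed.

Lemma smooth_christoffel k i j : smooth_on U (christoffel G k i j).
Proof. exact: (universal_smooth 0 0 (universal_christoffel k i j) regular0). Qed.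

Lemma smooth_connection k : smooth_mx U (connection_mx G k).
Proof.
move=> i j; apply: (smooth_on_ext metric_open _ (smooth_christoffel j k i)).
by move=> y _; rewrite mxE.
Qed.

Lemma smooth_laplacian f : smooth_on U f -> smooth_on U (laplacian G f).
Proof.
move=> sf; have /= := universal_laplacian (universal_fun0 (R := R) (d := d)).
by move=> uL; exact: (universal_smooth 0 0 uL (metric_regular sf)).
Qed.

Lemma smooth_inner f g : smooth_on U f -> smooth_on U g -> smooth_on U (inner G f g).
Proof.
move=> sf sg; have oU := metric_open.
apply: (smooth_sum oU) => a _; apply: (smooth_sum oU) => b _.
apply: (smoothM oU); last exact: smooth_on_partial.
by apply: (smoothM oU); [exact: smooth_invmx|exact: smooth_on_partial].
Qed.

Lemma smooth_schouten_trace : smooth_on U (schouten_trace G).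
Proof.
exact: (universal_smooth 0 0 (universal_schouten_trace (R := R) (d := d)) regular0).
Qed.

Lemma partial_metric_sym k x i j : U x ->
  partial k (fun y => G y i j) x = partial k (fun y => G y j i) x.
Proof.
move=> Ux; apply: (partial_ext k metric_open Ux) => y Uy.
by rewrite -{1}(metric_on_sym Uy) mxE.
Qed.

(* Christoffel symbols of the first kind *)
Let first_kind k x : 'M[R]_d := \matrix_(i, j) (2^-1 *
  (partial k (fun y => G y j i) x + partial i (fun y => G y k j) x
   - partial j (fun y => G y k i) x)).

Let connectionE k x : U x -> connection_mx G k x = first_kind k x *m invmx (G x).
Proof.
move=> Ux; apply/matrixP => i j; rewrite !mxE /christoffel mulr_sumr.
apply: eq_bigr => l _; rewrite mxE -{1}(invmx_sym Ux) mxE.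
by rewrite mulrA [in RHS]mulrC mulrA [in RHS](mulrC _ 2^-1).
Qed.

Lemma connection_sym k i j x : U x ->
  connection_mx G k x i j = connection_mx G i x k j.
Proof.
move=> Ux; rewrite !mxE /christoffel; congr (_ * _); apply: eq_bigr => l _.
rewrite (partial_metric_sym l k i Ux) (partial_metric_sym i k l Ux).
rewrite (partial_metric_sym k l i Ux).
by congr (_ * _); ring.
Qed.

Lemma christoffel_sym k i j x : U x -> christoffel G k i j x = christoffel G k j i x.
Proof. by move=> Ux; have := connection_sym i j k Ux; rewrite !mxE. Qed.

Lemma connection_metric k x : U x ->
  mx_partial k G x = connection_mx G k x *m G x + G x *m (connection_mx G k x)^T.
Proof.
move=> Ux; rewrite -{2}(metric_on_sym Ux) -trmx_mul connectionE// mulmxKV ?metric_unit//.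
apply/matrixP => i j; rewrite !mxE (partial_metric_sym k j i Ux).
rewrite (partial_metric_sym i k j Ux) (partial_metric_sym j k i Ux).
rewrite (partial_metric_sym j i k Ux) (partial_metric_sym i j k Ux).
by field.
Qed.

(** Koszul's argument: with the index lowered, compatibility writes each derivative of [G] as a sum
    of two entries of [b], and symmetry lets the Christoffel combination isolate one of them. Both
    transformation laws of the connection are obtained by checking these two conditions on a
    candidate. *)
Lemma connection_unique (B : 'I_d -> 'M[R]_d) x : U x ->
  (forall k i j, B k i j = B i k j) ->
  (forall k, mx_partial k G x = B k *m G x + G x *m (B k)^T) ->
  forall k, B k = connection_mx G k x.
Proof.
move=> Ux symB metB k; rewrite connectionE//.
apply: (canRL (mulmxK (metric_unit Ux))); apply/matrixP => i j.
pose b p q r := (B p *m G x) q r.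
have bsym p q r : b p q r = b q p r.
  by rewrite /b !mxE; apply: eq_bigr => l _; rewrite symB.
have dG p q r : partial p (fun y => G y q r) x = b p q r + b p r q.
  have /matrixP/(_ q r) := metB p; rewrite -{2}(metric_on_sym Ux) -trmx_mul.
  by rewrite 2![in X in X -> _]mxE => ->; rewrite /b [_^T q r]mxE.
rewrite [RHS]mxE !dG -/(b k i j) (bsym j k i) (bsym k i j) (bsym k j i) (bsym j i k).
by field.
Qed.

Lemma laplacianE f x : U x ->
  laplacian G f x = \tr (invmx (G x) *m hessian G f x).
Proof.
move=> Ux; rewrite -{1}(invmx_sym Ux) /laplacian /mxtrace exchange_big /=.
apply: eq_bigr => b _; rewrite mxE; apply: eq_bigr => a _.
by rewrite mxE hessianE.
Qed.

Lemma scalar_curvatureE x : U x -> scalar_curvature G x =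
  \sum_k \sum_l (invmx (G x) *m curvature_mx G k l x) l k.
Proof.
move=> Ux; rewrite /scalar_curvature exchange_big /= [RHS]exchange_big /=.
apply: eq_bigr => j _.
under [RHS]eq_bigr do rewrite mxE.
rewrite [RHS]exchange_big /=; apply: eq_bigr => i _.
rewrite -{1}(invmx_sym Ux) mxE -mulr_sumr; congr (_ * _).
apply: eq_bigr => k _; rewrite mxE (mxE _ _ i k) (mxE _ _ i k).
rewrite -[in RHS]addrA; congr (_ + _).
  rewrite mxE [in RHS]mxE (mxE _ _ i k); congr (_ - _).
    by apply: (partial_ext k metric_open Ux) => y Uy; rewrite mxE christoffel_sym.
  by apply: (partial_ext j metric_open Ux) => y Uy; rewrite mxE christoffel_sym.
rewrite [RHS]addrC mxE (mxE _ _ i k) (mxE _ _ i k) -sumrB; apply: eq_bigr => l _.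
rewrite !mxE (christoffel_sym l j i Ux) (christoffel_sym l k i Ux).
by congr (_ - _); exact: mulrC.
Qed.

End Metric.
End LeviCivita.

(** * Naturality under diffeomorphisms *)

Section PullbackAlgebra.
Context {R : comRingType} {d : nat}.
Implicit Types (J : 'M[R]_d) (A : 'I_d -> 'M[R]_d) (i j k l m n : 'I_d).

Definition pullback_form J A k : 'M[R]_d := \sum_l J k l *: A l.

Lemma pullback_form_sym J A : (forall l m n, A l m n = A m l n) ->
  forall k i n, (J *m pullback_form J A k) i n = (J *m pullback_form J A i) k n.
Proof.
have entry k i n : (J *m pullback_form J A k) i n =
    \sum_m \sum_l J i m * (J k l * A l m n).
  rewrite mxE; apply: eq_bigr => m _; rewrite /pullback_form summxE mulr_sumr.
  by apply: eq_bigr => l _; rewrite mxE.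
move=> symA k i n; rewrite !entry exchange_big /=; apply: eq_bigr => l _.
by apply: eq_bigr => m _; rewrite symA mulrCA.
Qed.

(** Curvature of a matrix-valued one-form commutes with pull-back: the second derivatives [dJ] of
    the map are symmetric and cancel, leaving an expression bilinear in [J]. *)
Lemma pullback_curvature J (dJ : 'I_d -> 'M[R]_d) A (dA : 'I_d -> 'I_d -> 'M[R]_d) k l :
  (forall m, dJ k l m = dJ l k m) ->
  (\sum_m (dJ k l m *: A m + J l m *: \sum_n J k n *: dA n m))
  - (\sum_m (dJ l k m *: A m + J k m *: \sum_n J l n *: dA n m))
  - pullback_form J A k *m pullback_form J A l
  + pullback_form J A l *m pullback_form J A k =
  \sum_n \sum_m (J k n * J l m) *:
    (dA n m - dA m n - A n *m A m + A m *m A n).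
Proof.
move=> symJ; rewrite !big_split /=.
rewrite (eq_bigr (fun m => dJ l k m *: A m)); last by move=> m _; rewrite symJ.
rewrite opprD addrACA subrr add0r.
have M p q : pullback_form J A p *m pullback_form J A q =
    \sum_n \sum_m (J p n * J q m) *: (A n *m A m).
  rewrite mulmx_suml; apply: eq_bigr => n _; rewrite mulmx_sumr.
  by apply: eq_bigr => m _; rewrite -scalemxAl -scalemxAr scalerA.
have X p q : \sum_m J q m *: \sum_n J p n *: dA n m =
    \sum_n \sum_m (J p n * J q m) *: dA n m.
  rewrite [RHS]exchange_big /=; apply: eq_bigr => m _; rewrite scaler_sumr.
  by apply: eq_bigr => n _; rewrite scalerA mulrC.
pose S (Y : 'I_d -> 'I_d -> 'M[R]_d) := \sum_n \sum_m (J k n * J l m) *: Y n m.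
have SD Y Z : S Y + S Z = S (fun n m => Y n m + Z n m).
  rewrite -big_split; apply: eq_bigr => n _; rewrite -big_split.
  by apply: eq_bigr => m _; rewrite scalerDr.
have SN Y : - S Y = S (fun n m => - Y n m).
  rewrite -sumrN; apply: eq_bigr => n _; rewrite -sumrN.
  by apply: eq_bigr => m _; rewrite scalerN.
have swap Y : \sum_n \sum_m (J l n * J k m) *: Y n m = S (fun n m => Y m n).
  rewrite exchange_big; apply: eq_bigr => n _; apply: eq_bigr => m _.
  by rewrite mulrC.
by rewrite !M !X (swap dA) (swap (fun n m => A n *m A m)) -!/(S _) !SN !SD.
Qed.

(** Gauge covariance. [D] and [L] are two connections intertwined by [J] through [dJ = D J - J L];
    the first two hypotheses are this relation differentiated once more, with [S] the second
    derivative of [J], common to both because it is symmetric. *)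
Lemma curvature_gauge (J Dk Dl dDl dDk dJk dJl Lk Ll dLl dLk S : 'M[R]_d) :
  dDl *m J = dJk *m Ll + J *m dLl + S - Dl *m dJk ->
  dDk *m J = dJl *m Lk + J *m dLk + S - Dk *m dJl ->
  dJk = Dk *m J - J *m Lk -> dJl = Dl *m J - J *m Ll ->
  (dDl - dDk - Dk *m Dl + Dl *m Dk) *m J =
  J *m (dLl - dLk - Lk *m Ll + Ll *m Lk).
Proof.
move=> El Ek dk dl; rewrite dk in El; rewrite dl in Ek.
rewrite !(mulmxBl, mulmxDl) {}El {}Ek !(mulmxDr, mulmxDl, mulmxN, mulNmx, mulmxA).
move: (J *m dLl) (J *m dLk) (J *m Lk *m Ll) (J *m Ll *m Lk) => a b c e.
move: (Dk *m J *m Ll) (Dl *m Dk *m J) (Dl *m J *m Lk) (Dk *m Dl *m J) => p q r s.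
by apply/matrixP => i j; rewrite !mxE; ring.
Qed.

Lemma trace_pullback (J X K : 'M[R]_d) n m : K *m J = 1%:M ->
  \sum_k \sum_l J k n * J l m * (K^T *m X *m K) l k = X m n.
Proof.
move=> KJ; transitivity ((J^T *m (K^T *m X *m K) *m J) m n); last first.
  by rewrite -mulmxA -(mulmxA (K^T *m X)) KJ mulmx1 mulmxA -trmx_mul KJ trmx1 mul1mx.
move: (K^T *m X *m K) => Y; rewrite [RHS]mxE; apply: eq_bigr => k _.
rewrite mxE mulr_suml; apply: eq_bigr => l _; rewrite mxE; ring.
Qed.

End PullbackAlgebra.

Section Naturality.
Context {R : realType} {d : nat}.
Local Notation E := 'rV[R]_d.
Implicit Types (f g : E -> R) (x y : E) (i j k l m n : 'I_d).

Definition jacobian_mx (F : E -> E) x : 'M[R]_d :=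
  \matrix_(i, j) partial i (fun y => F y 0 j) x.

Variables (W V : set E) (F : E -> E) (G H : E -> 'M[R]_d).
Hypotheses (GW : metric_on W G) (HV : metric_on V H) (sF : smooth_map_on W F)
  (FWV : forall x, W x -> V (F x)).
Local Notation J := (jacobian_mx F).
Hypothesis GJ : forall x, W x -> G x = J x *m H (F x) *m (J x)^T.

Let oW : open W := metric_open GW.
Let oV : open V := metric_open HV.

Lemma smooth_jacobian_mx : smooth_mx W J.
Proof.
move=> i j; apply: (smooth_on_ext oW _ (smooth_on_partial i (sF j))) => y _.
by rewrite mxE.
Qed.
Let sJ := smooth_jacobian_mx.

Lemma jacobian_mx_unit x : W x -> J x \in unitmx.
Proof.
move=> Wx; have := metric_det GW Wx; rewrite GJ// !det_mulmx !mulf_eq0 !negb_or.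
by rewrite unitmxE unitfE => /andP[/andP[]].
Qed.

Lemma smooth_mx_comp p q (A : E -> 'M[R]_(p, q)) : smooth_mx V A ->
  smooth_mx W (fun y => A (F y)).
Proof. by move=> sA i j; exact: (smooth_comp oW oV sF FWV (sA i j)). Qed.

Lemma mx_partial_comp p q k (A : E -> 'M[R]_(p, q)) x : W x -> smooth_mx V A ->
  mx_partial k (fun y => A (F y)) x = \sum_l J x k l *: mx_partial l A (F x).
Proof.
move=> Wx sA; apply/matrixP => i j; rewrite mxE summxE.
rewrite [LHS](partial_comp oW oV sF FWV k Wx (sA i j)).
by apply: eq_bigr => l _; rewrite !mxE.
Qed.

Lemma dcol_comp g x : W x -> smooth_on V g -> dcol (g \o F) x = J x *m dcol g (F x).
Proof.
move=> Wx sg; apply/colP => i; rewrite !mxE (partial_comp oW oV sF FWV i Wx sg).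
by apply: eq_bigr => l _; rewrite !mxE.
Qed.

Lemma invmx_pullback x : W x -> (J x)^T *m invmx (G x) *m J x = invmx (H (F x)).
Proof.
move=> Wx; have Ju := jacobian_mx_unit Wx; have Hu := metric_unit HV (FWV Wx).
have Gu := metric_unit GW Wx.
rewrite -[RHS]mulmx1; apply: (canRL (mulKmx Hu)).
have -> : H (F x) = invmx (J x) *m G x *m invmx (J x)^T.
  by rewrite GJ// !mulmxA mulVmx// mul1mx mulmxK// unitmx_tr.
by rewrite !mulmxA mulmxKV ?unitmx_tr// mulmxK// mulVmx.
Qed.

Lemma inner_comp f g x : W x -> smooth_on V f -> smooth_on V g ->
  inner G (f \o F) (g \o F) x = inner H f g (F x).
Proof.
move=> Wx sf sg; rewrite !innerE !dcol_comp// trmx_mul !mulmxA.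
by rewrite -invmx_pullback// !mulmxA.
Qed.

Lemma jacobian_second_sym x k i n : W x ->
  mx_partial k J x i n = mx_partial i J x k n.
Proof.
move=> Wx; rewrite [LHS]mxE [RHS]mxE.
transitivity (partial k (partial i (fun y => F y 0 n)) x).
  by apply: (partial_ext k oW Wx) => y _; rewrite mxE.
rewrite (partial_comm k i oW Wx (sF n)).
by apply: (partial_ext i oW Wx) => y _; rewrite mxE.
Qed.

(** The candidate [B k], equal to [(J L_k + dJ_k) J^-1] with [L] the pulled-back connection, is
    symmetric because second derivatives of [F] commute, and compatible with [G] by differentiating
    [GJ]. Uniqueness identifies it. *)
Lemma connection_comp k x : W x -> connection_mx G k x *m J x =
  J x *m pullback_form (J x) (fun l => connection_mx H l (F x)) k
  + mx_partial k J x.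
Proof.
move=> Wx; have Ju := jacobian_mx_unit Wx; have Vx := FWV Wx.
pose L k : 'M[R]_d := pullback_form (J x) (fun l => connection_mx H l (F x)) k.
pose BJ k : 'M[R]_d := J x *m L k + mx_partial k J x.
pose B k : 'M[R]_d := BJ k *m invmx (J x).
have BJE k' : B k' *m J x = BJ k' by rewrite mulmxKV.
suff -> : connection_mx G k x = B k by rewrite BJE.
apply/esym; apply: (connection_unique GW Wx) => {k} [k i j|k].
  rewrite /B [LHS]mxE [RHS]mxE; apply: eq_bigr => n _; congr (_ * _).
  rewrite /BJ [LHS]mxE [RHS]mxE.
  congr (_ + _); last exact: (jacobian_second_sym k i n Wx).
  by apply: pullback_form_sym => l m p; exact: (connection_sym HV l m p Vx).
have sHF := smooth_mx_comp (metric_on_smooth HV).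
have -> : mx_partial k G x = mx_partial k (fun y => J y *m H (F y) *m (J y)^T) x.
  by apply: (mx_partial_ext oW) => // y Wy; exact: GJ.
have BG : B k *m G x = BJ k *m H (F x) *m (J x)^T.
  by rewrite GJ// !mulmxA BJE.
rewrite -{2}(metric_on_sym GW Wx) -trmx_mul BG.
rewrite (mx_partialM oW k Wx (smooth_mxM oW sJ sHF) (smooth_mx_tr oW sJ)).
rewrite (mx_partialM oW k Wx sJ sHF) (mx_partial_tr oW k _ Wx).
rewrite (mx_partial_comp k Wx (metric_on_smooth HV)).
have -> : \sum_l J x k l *: mx_partial l H (F x) = L k *m H (F x) + H (F x) *m (L k)^T.
  rewrite /L /pullback_form linear_sum /= mulmx_suml mulmx_sumr -big_split /=.
  apply: eq_bigr => l _; rewrite (connection_metric HV l Vx) scalerDr.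
  by rewrite -scalemxAl linearZ /= -scalemxAr.
rewrite 2!trmx_mul trmxK (metric_on_sym HV Vx) /BJ [(J x *m L k + _)^T]raddfD /= (trmx_mul (J x)).
rewrite !(mulmxDl, mulmxDr) !mulmxA -!addrA.
exact: addrCA.
Qed.

Lemma hessian_comp f x : W x -> smooth_on V f ->
  hessian G (f \o F) x = J x *m hessian H f (F x) *m (J x)^T.
Proof.
move=> Wx sf; apply/matrixP => k i; rewrite mxE.
have sdf := smooth_mx_comp (smooth_dcol oV sf).
have -> : mx_partial k (dcol (f \o F)) x
    - connection_mx G k x *m dcol (f \o F) x =
    J x *m \sum_l J x k l *: (mx_partial l (dcol f) (F x)
      - connection_mx H l (F x) *m dcol f (F x)).
  have -> : mx_partial k (dcol (f \o F)) x = mx_partial k (fun y => J y *m dcol f (F y)) x.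
    by apply: (mx_partial_ext oW) => // y Wy; exact: dcol_comp.
  rewrite (mx_partialM oW k Wx sJ sdf) (mx_partial_comp k Wx (smooth_dcol oV sf)).
  rewrite dcol_comp// mulmxA connection_comp// mulmxDl opprD addrA addrAC.
  rewrite (addrC (mx_partial k J x *m _)) addrK.
  rewrite -mulmxA -mulmxBr /pullback_form mulmx_suml -sumrB.
  by congr (_ *m _); apply: eq_bigr => l _; rewrite scalerBr scalemxAl.
rewrite [LHS]mxE [RHS]mxE; apply: eq_bigr => p _; rewrite mulrC.
congr (_ * _); last by rewrite [RHS]mxE.
rewrite summxE [RHS]mxE; apply: eq_bigr => l _.
by rewrite [LHS]mxE; congr (_ * _); rewrite [RHS]mxE.
Qed.

Lemma laplacian_comp f x : W x -> smooth_on V f ->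
  laplacian G (f \o F) x = laplacian H f (F x).
Proof.
move=> Wx sf; rewrite (laplacianE GW _ Wx) (laplacianE HV _ (FWV Wx)).
by rewrite hessian_comp// -invmx_pullback// mulmxA mxtrace_mulC !mulmxA.
Qed.

(** Differentiating [connection_comp] supplies the hypotheses of [curvature_gauge]; the curvature of
    the pulled-back connection is then evaluated by [pullback_curvature]. *)
Lemma curvature_comp k l x : W x -> curvature_mx G k l x *m J x =
  J x *m \sum_n \sum_m (J x k n * J x l m) *: curvature_mx H n m (F x).
Proof.
move=> Wx; have Vx := FWV Wx.
pose A m y : 'M[R]_d := connection_mx H m (F y).
pose L k y : 'M[R]_d := pullback_form (J y) (A ^~ y) k.
have sA m : smooth_mx W (A m) := smooth_mx_comp (smooth_connection HV m).
have sD p : smooth_mx W (connection_mx G p) := smooth_connection GW p.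
have sL p : smooth_mx W (L p).
  by apply: (smooth_mx_sum oW) => m; apply: (smooth_mxZ oW (sJ p m) (sA m)).
have sdJ p : smooth_mx W (mx_partial p J) := smooth_mx_partial oW p sJ.
have DJ p y : W y -> connection_mx G p y *m J y = J y *m L p y + mx_partial p J y.
  exact: connection_comp.
have dDJ p q : mx_partial q (connection_mx G p) x *m J x =
    mx_partial q J x *m L p x + J x *m mx_partial q (L p) x
    + mx_partial q (mx_partial p J) x - connection_mx G p x *m mx_partial q J x.
  apply: (canRL (addrK _)); rewrite -(mx_partialM oW q Wx (sD p) sJ).
  rewrite (mx_partial_ext oW q Wx (DJ p)).
  rewrite (mx_partialD oW q Wx (smooth_mxM oW sJ (sL p)) (sdJ p)).
  by rewrite (mx_partialM oW q Wx sJ (sL p)).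
have dJE p : mx_partial p J x = connection_mx G p x *m J x - J x *m L p x.
  by rewrite DJ// addrAC subrr add0r.
have ddJ : mx_partial k (mx_partial l J) x = mx_partial l (mx_partial k J) x.
  apply/matrixP => i j; rewrite [LHS]mxE [RHS]mxE.
  have E p : (fun y => mx_partial p J y i j) = partial p (fun y => J y i j).
    by apply/funext => y; rewrite [LHS]mxE.
  apply: etrans (congr1 (fun h => partial k h x) (E l)) _.
  apply: etrans (esym (congr1 (fun h => partial l h x) (E k))).
  exact: (partial_comm k l oW Wx (sJ i j)).
have dL p q : mx_partial q (L p) x = \sum_m (mx_partial q J x p m *: A m x
    + J x p m *: \sum_n J x q n *: mx_partial n (connection_mx H m) (F x)).
  rewrite (mx_partial_sum oW q _ Wx) => [|m]; last exact: (smooth_mxZ oW (sJ p m) (sA m)).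
  apply: eq_bigr => m _; rewrite (mx_partialZ oW q Wx (sJ p m) (sA m)).
  rewrite (mx_partial_comp q Wx (smooth_connection HV m)).
  by congr (_ *: _ + _); rewrite [RHS]mxE.
have key : curvature_mx G k l x *m J x = J x *m (mx_partial k (L l) x
    - mx_partial l (L k) x - L k x *m L l x + L l x *m L k x).
  apply: (curvature_gauge (S := mx_partial k (mx_partial l J) x)
    (dJk := mx_partial k J x) (dJl := mx_partial l J x)) (dJE k) (dJE l).
    exact: dDJ.
  by rewrite ddJ; exact: dDJ.
rewrite key; congr (_ *m _); rewrite (dL l k) (dL k l).
apply: (@pullback_curvature _ d (J x) (fun p => mx_partial p J x) (A ^~ x)
  (fun n m => mx_partial n (connection_mx H m) (F x)) k l) => m.
exact: (jacobian_second_sym k l m Wx).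
Qed.

Lemma scalar_curvature_comp x : W x ->
  scalar_curvature G x = scalar_curvature H (F x).
Proof.
move=> Wx; have Vx := FWV Wx; have Ju := jacobian_mx_unit Wx.
rewrite (scalar_curvatureE GW Wx) (scalar_curvatureE HV Vx).
pose K := invmx (J x); pose X n m : 'M[R]_d := invmx (H (F x)) *m curvature_mx H n m (F x).
have KJ : K *m J x = 1%:M by rewrite mulVmx.
have E k l : invmx (G x) *m curvature_mx G k l x =
    \sum_n \sum_m (J x k n * J x l m) *: (K^T *m X n m *m K).
  have -> : curvature_mx G k l x = J x *m (\sum_n \sum_m (J x k n * J x l m) *:
      curvature_mx H n m (F x)) *m K.
    by rewrite -curvature_comp// mulmxK.
  have -> : invmx (G x) = K^T *m invmx (H (F x)) *m K.
    rewrite -invmx_pullback// /K trmx_inv !mulmxA mulVmx ?unitmx_tr// mul1mx.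
    by rewrite mulmxK.
  rewrite !mulmxA mulmxKV// mulmx_sumr mulmx_suml; apply: eq_bigr => n _.
  rewrite mulmx_sumr mulmx_suml; apply: eq_bigr => m _.
  by rewrite -scalemxAr -scalemxAl /X !mulmxA.
transitivity (\sum_k \sum_l \sum_n \sum_m
    J x k n * J x l m * (K^T *m X n m *m K) l k).
  apply: eq_bigr => k _; apply: eq_bigr => l _; rewrite E summxE.
  apply: eq_bigr => n _; rewrite summxE; apply: eq_bigr => m _.
  by rewrite [LHS]mxE.
transitivity (\sum_n \sum_m \sum_k \sum_l
    J x k n * J x l m * (K^T *m X n m *m K) l k); last first.
  by apply: eq_bigr => n _; apply: eq_bigr => m _; exact: trace_pullback.
under eq_bigr do rewrite exchange_big /=.
rewrite exchange_big /=; apply: eq_bigr => n _.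
under eq_bigr do rewrite exchange_big /=.
by rewrite exchange_big.
Qed.

Lemma schouten_trace_comp x : W x -> schouten_trace G x = schouten_trace H (F x).
Proof. by move=> Wx; rewrite /schouten_trace scalar_curvature_comp. Qed.

End Naturality.

(** * Conformal rescaling *)

Section ConformalAlgebra.
Context {R : comRingType} {d : nat}.
Local Notation e_ k := (delta_mx k 0 : 'cV[R]_d).
Implicit Types (G K A : 'M[R]_d) (v h : 'cV[R]_d) (u : 'rV[R]_d) (i j k l : 'I_d).

(* The difference of the Levi-Civita connections of [Omega ^+ 2 *: G] and [G],
   where [v] is the differential of [ln Omega] and [u] its gradient *)
Definition conformal_difference G v u k : 'M[R]_d :=
  (v k 0)%:M + v *m (e_ k)^T - G *m e_ k *m u.

Definition curvature_trace K (M : 'I_d -> 'I_d -> 'M[R]_d) : R :=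
  \sum_k \sum_l (K *m M k l) l k.

Lemma curvature_traceD K M N :
  curvature_trace K (fun k l => M k l + N k l) = curvature_trace K M + curvature_trace K N.
Proof.
rewrite -big_split; apply: eq_bigr => k _; rewrite -big_split; apply: eq_bigr => l _.
by rewrite /= mulmxDr [LHS]mxE.
Qed.

Lemma curvature_traceN K M : curvature_trace K (fun k l => - M k l) = - curvature_trace K M.
Proof.
rewrite -sumrN; apply: eq_bigr => k _; rewrite -sumrN; apply: eq_bigr => l _.
by rewrite mulmxN [LHS]mxE.
Qed.

Lemma outer_entry (v : 'cV[R]_d) (u : 'rV[R]_d) i j : (v *m u) i j = v i 0 * u 0 j.
Proof. by rewrite mxE big_ord1. Qed.

Lemma delta_col_entry k l : (e_ k) l 0 = (l == k)%:R.
Proof. by rewrite mxE eqxx andbT. Qed.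

Lemma delta_row_entry k l : (e_ k)^T 0 l = (l == k)%:R.
Proof. by rewrite mxE delta_col_entry. Qed.

Lemma sum_delta (f : 'I_d -> R) k : \sum_l (k == l)%:R * f l = f k.
Proof.
rewrite (bigD1 k) //= eqxx mul1r big1 ?addr0// => l lk.
by rewrite eq_sym (negbTE lk) mul0r.
Qed.

Lemma sum_delta_sym (f : 'I_d -> R) k : \sum_l (l == k)%:R * f l = f k.
Proof. by rewrite -[RHS](sum_delta f k); apply: eq_bigr => l _; rewrite eq_sym. Qed.

Section Contractions.
Variables (G K : 'M[R]_d) (h : 'I_d -> 'cV[R]_d) (c : 'I_d -> R) (v : 'cV[R]_d)
  (u : 'rV[R]_d).
Hypotheses (KG : K *m G = 1%:M) (Ksym : K^T = K).

Let trace_h := \sum_k (K *m h k) k 0.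

Lemma row_mul_sym (w : 'cV[R]_d) k : (w^T *m K) 0 k = (K *m w) k 0.
Proof. by rewrite -{1}Ksym -trmx_mul mxE. Qed.

(** The change of curvature under rescaling is built from four kinds of outer products. This lemma
    and the next three contract them: two give the trace of [h], the other two give [d] times it. *)
Lemma curvature_trace_diag : curvature_trace K (fun k l => h k *m (e_ l)^T) = trace_h.
Proof.
apply: eq_bigr => k _; rewrite -[RHS](sum_delta (fun l => (K *m h k) l 0)).
by apply: eq_bigr => l _; rewrite mulmxA outer_entry delta_row_entry mulrC.
Qed.

Lemma curvature_trace_full : curvature_trace K (fun k l => h l *m (e_ k)^T) = d%:R * trace_h.
Proof.
rewrite /curvature_trace exchange_big mulr_sumr; apply: eq_bigr => l _ /=.
rewrite (eq_bigr (fun=> (K *m h l) l 0)); last first.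
  by move=> k _; rewrite mulmxA outer_entry delta_row_entry eqxx mulr1.
by rewrite sumr_const card_ord mulr_natl.
Qed.

Lemma curvature_trace_full_dual :
  curvature_trace K (fun k l => G *m e_ l *m ((h k)^T *m K)) = d%:R * trace_h.
Proof.
rewrite /curvature_trace mulr_sumr; apply: eq_bigr => k _ /=.
rewrite (eq_bigr (fun=> (K *m h k) k 0)); last first.
  move=> l _; rewrite !mulmxA KG mul1mx -mulmxA outer_entry delta_col_entry eqxx.
  by rewrite mul1r row_mul_sym.
by rewrite sumr_const card_ord mulr_natl.
Qed.

Lemma curvature_trace_diag_dual :
  curvature_trace K (fun k l => G *m e_ k *m ((h l)^T *m K)) = trace_h.
Proof.
apply: eq_bigr => k _; rewrite -[RHS](sum_delta_sym (fun l => (K *m h l) k 0)).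
apply: eq_bigr => l _; rewrite !mulmxA KG mul1mx -mulmxA outer_entry delta_col_entry.
by rewrite row_mul_sym.
Qed.

End Contractions.

Lemma conformal_difference_sym G v u k i j : G^T = G ->
  conformal_difference G v u k i j = conformal_difference G v u i k j.
Proof.
move=> Gsym; have Ge p q : (G *m e_ p) q 0 = G q p.
  by rewrite -colE mxE.
rewrite /conformal_difference.
rewrite [LHS]mxE [RHS]mxE; congr (_ + _); last first.
  rewrite [LHS]mxE [RHS]mxE; congr (- _); rewrite !outer_entry !Ge.
  by rewrite -{1}Gsym mxE.
rewrite [LHS]mxE [RHS]mxE [RHS]addrC; congr (_ + _).
  by rewrite outer_entry delta_row_entry mxE eq_sym mulr_natr.
by rewrite outer_entry delta_row_entry mxE eq_sym mulr_natr.
Qed.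

(** Together with the symmetry above, this is what [connection_unique] asks of the rescaled metric:
    the right-hand side accounts for the derivative of [Omega ^+ 2], which is [2 v_k Omega ^+ 2]. *)
Lemma conformal_difference_metric G v u k : G^T = G -> u *m G = v^T ->
  conformal_difference G v u k *m G + G *m (conformal_difference G v u k)^T =
  (v k 0 *+ 2) *: G.
Proof.
move=> Gsym uG.
have E : conformal_difference G v u k *m G =
    v k 0 *: G + v *m (e_ k)^T *m G - G *m e_ k *m v^T.
  by rewrite /conformal_difference mulmxBl mulmxDl mul_scalar_mx -(mulmxA (G *m e_ k)) uG.
have -> : G *m (conformal_difference G v u k)^T =
    (conformal_difference G v u k *m G)^T by rewrite trmx_mul Gsym.
rewrite E linearB linearD /= !trmx_mul !trmxK linearZ /= Gsym !mulmxA.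
move: (v *m _ *m G) (G *m _ *m v^T) => X Y.
by apply/matrixP => i j; rewrite !mxE; ring.
Qed.

(** The covariant exterior derivative of the difference form. Since [G] is parallel, only the
    covariant derivative [h] of [v] survives, and its symmetric scalar part cancels. *)
Lemma conformal_difference_derivative G K v u (A : 'I_d -> 'M[R]_d)
    (dv h : 'I_d -> 'cV[R]_d) (du : 'I_d -> 'rV[R]_d) (dC : 'I_d -> 'I_d -> 'M[R]_d) :
  (forall k, h k = dv k - A k *m v) ->
  (forall k l, dv k l 0 = dv l k 0) ->
  (forall k l j, A k l j = A l k j) ->
  (forall k, du k = (h k)^T *m K - u *m A k) ->
  (forall k l, dC k l = (dv k l 0)%:M + dv k *m (e_ l)^T
     - ((A k *m G + G *m (A k)^T) *m e_ l *m u + G *m e_ l *m du k)) ->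
  forall k l,
  let C := conformal_difference G v u in
  dC k l - A k *m C l + C l *m A k - (dC l k - A l *m C k + C k *m A l) =
  h k *m (e_ l)^T - h l *m (e_ k)^T - G *m e_ l *m ((h k)^T *m K)
  + G *m e_ k *m ((h l)^T *m K).
Proof.
move=> hE dvs Asym duE dCE k l C.
have half p q : dC p q - A p *m C q + C q *m A p =
    (dv p q 0)%:M + h p *m (e_ q)^T - G *m ((A p)^T *m e_ q) *m u
    - G *m e_ q *m ((h p)^T *m K) + v *m ((e_ q)^T *m A p).
  rewrite dCE duE hE /C /conformal_difference.
  rewrite !(mulmxDl, mulmxDr, mulmxN, mulNmx, mulmxA) mul_scalar_mx mul_mx_scalar.
  move: ((dv p q 0)%:M) => s.
  move: (dv p *m _) (A p *m v *m _) => a1 a2.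
  move: (v *m _ *m _) (A p *m G *m e_ q *m u) => a3 a4.
  move: (G *m _ *m _ *m u) (v q 0 *: A p) => a5 a6.
  apply/matrixP => i j; rewrite !mxE; ring.
have Ae p q : (A p)^T *m e_ q = (A q)^T *m e_ p.
  by apply/colP => j; rewrite -!colE !mxE Asym.
have eA p q : (e_ q)^T *m A p = (e_ p)^T *m A q.
  by rewrite -[LHS]trmxK trmx_mul trmxK Ae trmx_mul trmxK.
rewrite !half dvs Ae eA.
move: ((dv l k 0)%:M) (h k *m _) (h l *m (e_ k)^T) => a b c.
move: (G *m _ *m u) (v *m _) (G *m _ *m (_ *m K)) (G *m e_ k *m _) => p q r s.
by apply/matrixP => i j; rewrite !mxE; ring.
Qed.

Lemma outer_mul (a b : 'cV[R]_d) (p q : 'rV[R]_d) :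
  a *m p *m (b *m q) = (p *m b) 0 0 *: (a *m q).
Proof.
rewrite !mulmxA -(mulmxA a) [X in a *m X *m q](mx11_scalar (p *m b)).
by rewrite mul_mx_scalar -scalemxAl.
Qed.

(** The part of the curvature change that is quadratic in [v]. It repeats the four shapes of the
    linear part with opposite sign and [v_k v] in place of [h k], and adds a term in [|v|^2]. *)
Lemma conformal_difference_commutator G K v k l :
  G^T = G -> K *m G = 1%:M -> K^T = K ->
  let u := v^T *m K in
  let C := conformal_difference G v u in
  let h p := v p 0 *: v in
  C l *m C k - C k *m C l =
  h l *m (e_ k)^T - h k *m (e_ l)^T - G *m e_ k *m ((h l)^T *m K)
  + G *m e_ l *m ((h k)^T *m K)
  + (u *m v) 0 0 *: (G *m e_ k *m (e_ l)^T - G *m e_ l *m (e_ k)^T).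
Proof.
move=> Gsym KG Ksym u C h.
have ev p (w : 'cV[R]_d) : ((e_ p)^T *m w) 0 0 = w p 0.
  by rewrite trmx_delta -rowE mxE.
have eGe p q : ((e_ p)^T *m (G *m e_ q)) 0 0 = ((e_ q)^T *m (G *m e_ p)) 0 0.
  by rewrite !ev -!colE !mxE -{1}Gsym mxE.
have uGe p : (u *m (G *m e_ p)) 0 0 = v p 0.
  by rewrite mulmxA /u -(mulmxA _ K) KG mulmx1 -colE !mxE.
have prod p q : C p *m C q = (v p 0 * v q 0)%:M + v p 0 *: (v *m (e_ q)^T)
    + v q 0 *: (v *m (e_ p)^T) + v p 0 *: (v *m (e_ q)^T)
    - v p 0 *: (G *m e_ q *m u) - ((e_ p)^T *m (G *m e_ q)) 0 0 *: (v *m u)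
    - (u *m v) 0 0 *: (G *m e_ p *m (e_ q)^T).
  rewrite /C /conformal_difference !(mulmxBl, mulmxBr, mulmxDl, mulmxDr).
  rewrite !outer_mul !mul_scalar_mx !mul_mx_scalar ev uGe scale_scalar_mx.
  move: (v *m (e_ q)^T) (v *m (e_ p)^T) (G *m e_ p *m u) (G *m e_ q *m u) => X Y Z T.
  move: (v *m u) (G *m e_ p *m (e_ q)^T) ((e_ p)^T *m _) (u *m v) => S V a n.
  by apply/matrixP => i j; rewrite !mxE; ring.
rewrite !prod (eGe l k) /h !linearZ /= -!scalemxAl -!scalemxAr -/u.
move: (v *m (e_ l)^T) (v *m (e_ k)^T) (G *m e_ l *m u) (G *m e_ k *m u) => X Y Z T.
move: (v *m u) (G *m e_ k *m (e_ l)^T) (G *m e_ l *m (e_ k)^T) => S V V'.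
move: ((e_ k)^T *m _) (u *m v) => a n.
by apply/matrixP => i j; rewrite !mxE; ring.
Qed.

Lemma curvature_trace_conformal G K (h h' : 'I_d -> 'cV[R]_d) (n : R) :
  K *m G = 1%:M -> K^T = K ->
  curvature_trace K (fun k l => h k *m (e_ l)^T - h l *m (e_ k)^T
    - G *m e_ l *m ((h k)^T *m K) + G *m e_ k *m ((h l)^T *m K)
    + (h' l *m (e_ k)^T - h' k *m (e_ l)^T - G *m e_ k *m ((h' l)^T *m K)
       + G *m e_ l *m ((h' k)^T *m K)
       + n *: (G *m e_ k *m (e_ l)^T - G *m e_ l *m (e_ k)^T))) =
  (2 - 2 * d%:R) * (\sum_k (K *m h k) k 0 - \sum_k (K *m h' k) k 0)
  - n * (d%:R * (d%:R - 1)).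
Proof.
move=> KG Ksym; rewrite !curvature_traceD !curvature_traceN.
rewrite !curvature_trace_diag !curvature_trace_full !curvature_trace_full_dual//.
rewrite !curvature_trace_diag_dual//.
have -> : curvature_trace K (fun k l => n *: (G *m e_ k *m (e_ l)^T - G *m e_ l *m (e_ k)^T))
    = n * (d%:R - d%:R * d%:R).
  have E k : \sum_l (K *m (n *: (G *m e_ k *m (e_ l)^T - G *m e_ l *m (e_ k)^T))) l k
      = n * (1 - d%:R).
    transitivity (\sum_l (n * ((l == k)%:R * 1) - n)).
      apply: eq_bigr => l _; rewrite -scalemxAr mulmxBr !mulmxA KG !mul1mx.
      transitivity (n * ((e_ k *m (e_ l)^T) l k - (e_ l *m (e_ k)^T) l k)).
        by move: (e_ k *m _) (e_ l *m _) => X Y; rewrite !mxE.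
      rewrite !outer_entry !delta_col_entry !delta_row_entry !eqxx (eq_sym k l).
      by case: (l == k) => /=; ring.
    rewrite sumrB -mulr_sumr (sum_delta_sym (fun=> 1)) sumr_const card_ord.
    by rewrite -mulr_natr; ring.
  rewrite /curvature_trace (eq_bigr _ (fun k _ => E k)) sumr_const card_ord -mulr_natr.
  by ring.
by ring.
Qed.

Lemma curvature_add (a1 a2 d1 d2 Ak Al Ck Cl : 'M[R]_d) :
  a1 + d1 - (a2 + d2) - (Ak + Ck) *m (Al + Cl) + (Al + Cl) *m (Ak + Ck) =
  (a1 - a2 - Ak *m Al + Al *m Ak)
  + (d1 - Ak *m Cl + Cl *m Ak - (d2 - Al *m Ck + Ck *m Al)
     + (Cl *m Ck - Ck *m Cl)).
Proof.
rewrite !mulmxDl !mulmxDr.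
move: (Ak *m Al) (Ak *m Cl) (Ck *m Al) (Ck *m Cl) => p1 p2 p3 p4.
move: (Al *m Ak) (Al *m Ck) (Cl *m Ak) (Cl *m Ck) => q1 q2 q3 q4.
by apply/matrixP => i j; rewrite !mxE; ring.
Qed.

Lemma row_col_sym (K : 'M[R]_d) (v w : 'cV[R]_d) : K^T = K ->
  (v^T *m K *m w) 0 0 = (w^T *m K *m v) 0 0.
Proof.
move=> Ksym; transitivity (((v^T *m K *m w)^T) 0 0); first by rewrite [RHS]mxE.
by rewrite !trmx_mul trmxK Ksym mulmxA.
Qed.

Lemma sum_row_col (v w : 'cV[R]_d) : \sum_k v k 0 * w k 0 = (v^T *m w) 0 0.
Proof. by rewrite [RHS]mxE; apply: eq_bigr => k _; rewrite [v^T 0 k]mxE. Qed.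

(** The scalar and the first outer product each contribute the inner product once, the last term
    once for every [k]; this is where the factor [d - 2] in the rescaled Laplacian comes from. *)
Lemma trace_conformal_difference (G K : 'M[R]_d) (v w : 'cV[R]_d) :
  K *m G = 1%:M -> K^T = K ->
  \sum_k (K *m (conformal_difference G v (v^T *m K) k *m w)) k 0 =
  (2 - d%:R) * (v^T *m K *m w) 0 0.
Proof.
move=> KG Ksym; set p := (_ *m w) 0 0.
transitivity (\sum_k (v k 0 * (K *m w) k 0 + w k 0 * (K *m v) k 0 - p)).
  apply: eq_bigr => k _; rewrite /conformal_difference mulmxBl mulmxDl mul_scalar_mx.
  have m11 (a : 'cV[R]_d) (s : 'M[R]_1) : a *m s = s 0 0 *: a.
    by rewrite {1}(mx11_scalar s) mul_mx_scalar.
  rewrite -(mulmxA v) -(mulmxA (G *m e_ k)) !m11 -/p trmx_delta -rowE.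
  rewrite [row k w 0 0]mxE mulmxBr mulmxDr -!scalemxAr mulmxA KG mul1mx.
  move: (K *m w) (K *m v) => a b.
  by rewrite !mxE !eqxx mulr1.
rewrite sumrB big_split /= !sum_row_col !mulmxA -/p (row_col_sym w v Ksym) -/p.
by rewrite sumr_const card_ord -mulr_natl; ring.
Qed.

End ConformalAlgebra.

Lemma grad_sqnormE (R : realType) (d : nat) (G : 'rV[R]_d -> 'M[R]_d) f x :
  grad_sqnorm G f x = inner G f f x.
Proof. by []. Qed.

(** * Product rules for the inner product of gradients and the Laplacian *)

Section LaplacianRules.
Context {R : realType} {d : nat}.
Local Notation E := 'rV[R]_d.
Local Notation e_ k := (delta_mx k 0 : 'cV[R]_d).
Variables (U : set E) (G : E -> 'M[R]_d).
Hypothesis GU : metric_on U G.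
Implicit Types (f g : E -> R) (x y : E) (i j k l : 'I_d).
Let oU : open U := metric_open GU.

Lemma smooth_mxN p q (A : E -> 'M[R]_(p, q)) :
  smooth_mx U A -> smooth_mx U (fun y => - A y).
Proof.
move=> sA i j; apply: (smooth_on_ext oU _ (smoothN oU (sA i j))) => y _.
by rewrite mxE.
Qed.

Lemma mx_partialN p q k (A : E -> 'M[R]_(p, q)) x : U x -> smooth_mx U A ->
  mx_partial k (fun y => - A y) x = - mx_partial k A x.
Proof.
move=> Ux sA; apply/matrixP => i j; rewrite [LHS]mxE [RHS]mxE [X in - X]mxE.
rewrite -(partialN k Ux (sA i j)).
by apply: (partial_ext k oU Ux) => y _; rewrite mxE.
Qed.

Lemma smooth_scalar_mx f : smooth_on U f -> smooth_mx U (fun y => (f y)%:M : 'M[R]_d).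
Proof.
move=> sf i j; apply: (smooth_on_ext oU (f := fun y => f y * (i == j)%:R)).
  by move=> y _; rewrite mxE mulr_natr.
exact: (smoothM oU sf (smooth_cst _)).
Qed.

Lemma mx_partial_scalar k f x : U x -> smooth_on U f ->
  mx_partial k (fun y => (f y)%:M : 'M[R]_d) x = (partial k f x)%:M.
Proof.
move=> Ux sf; apply/matrixP => i j; rewrite [LHS]mxE [RHS]mxE.
rewrite (_ : partial k _ x = partial k (fun y => (i == j)%:R * f y) x).
  by rewrite (partialMl k _ Ux sf) mulr_natl.
by apply: (partial_ext k oU Ux) => y _; rewrite mxE mulr_natl.
Qed.

Lemma invmx_entry_sym i j x : U x -> invmx (G x) i j = invmx (G x) j i.
Proof. by move=> Ux; rewrite -{1}(invmx_sym GU Ux) mxE. Qed.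

Lemma inner_sym f g x : U x -> inner G f g x = inner G g f x.
Proof.
move=> Ux; rewrite /inner exchange_big; apply: eq_bigr => a _; apply: eq_bigr => b _.
by rewrite (invmx_entry_sym a b Ux) mulrAC.
Qed.

Lemma laplacian_trace f x : U x -> laplacian G f x =
  \sum_k (invmx (G x) *m (mx_partial k (dcol f) x
                          - connection_mx G k x *m dcol f x)) k 0.
Proof.
move=> Ux; rewrite (laplacianE GU f Ux) mxtrace_mulC; apply: eq_bigr => k _.
rewrite [LHS]mxE [RHS]mxE; apply: eq_bigr => i _.
rewrite (invmx_entry_sym k i Ux) mulrC; congr (_ * _).
by rewrite [LHS]mxE.
Qed.

Lemma inner_ext f f' g g' x : U x -> (forall y, U y -> f y = f' y) ->
  (forall y, U y -> g y = g' y) -> inner G f g x = inner G f' g' x.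
Proof.
move=> Ux ff' gg'; apply: eq_bigr => a _; apply: eq_bigr => b _.
by rewrite (partial_ext a oU Ux ff') (partial_ext b oU Ux gg').
Qed.

Lemma innerDr f g h x : U x -> smooth_on U g -> smooth_on U h ->
  inner G f (fun y => g y + h y) x = inner G f g x + inner G f h x.
Proof.
move=> Ux sg sh; rewrite -big_split; apply: eq_bigr => a _.
rewrite -big_split; apply: eq_bigr => b _ /=.
by rewrite (partialD b Ux sg sh) mulrDr.
Qed.

Lemma innerMr f g h x : U x -> smooth_on U g -> smooth_on U h ->
  inner G f (fun y => g y * h y) x = g x * inner G f h x + h x * inner G f g x.
Proof.
move=> Ux sg sh; rewrite !mulr_sumr -big_split; apply: eq_bigr => a _.
rewrite !mulr_sumr -big_split; apply: eq_bigr => b _ /=.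
rewrite (partialM b Ux sg sh).
move: (invmx (G x) a b) (partial a f x) (g x) (h x) => c p m n.
move: (partial b g x) (partial b h x) => q r; ring.
Qed.

Lemma inner_cstr f c x : inner G f (fun=> c) x = 0.
Proof.
rewrite /inner big1// => a _; rewrite big1// => b _.
by rewrite partial_cst mulr0.
Qed.

Lemma innerDl f g h x : U x -> smooth_on U f -> smooth_on U g ->
  inner G (fun y => f y + g y) h x = inner G f h x + inner G g h x.
Proof.
move=> Ux sf sg; rewrite (inner_sym _ h Ux) (innerDr h Ux sf sg).
by rewrite (inner_sym h f Ux) (inner_sym h g Ux).
Qed.

Lemma innerMl f g h x : U x -> smooth_on U f -> smooth_on U g ->
  inner G (fun y => f y * g y) h x = f x * inner G g h x + g x * inner G f h x.
Proof.
move=> Ux sf sg; rewrite (inner_sym _ h Ux) (innerMr h Ux sf sg).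
by rewrite (inner_sym h f Ux) (inner_sym h g Ux).
Qed.

Lemma laplacian_ext f g x : U x -> (forall y, U y -> f y = g y) ->
  laplacian G f x = laplacian G g x.
Proof.
move=> Ux fg; apply: eq_bigr => a _; apply: eq_bigr => b _.
rewrite (partials_ext [:: a; b] oU fg Ux).
rewrite (eq_bigr (fun k => christoffel G k a b x * partial k g x)) // => k _.
by rewrite (partial_ext k oU Ux fg).
Qed.

Lemma laplacianD f g x : U x -> smooth_on U f -> smooth_on U g ->
  laplacian G (fun y => f y + g y) x = laplacian G f x + laplacian G g x.
Proof.
move=> Ux sf sg; rewrite -big_split; apply: eq_bigr => a _.
rewrite -big_split; apply: eq_bigr => b _ /=.
have -> : partial a (partial b (fun y => f y + g y)) x =
    partial a (partial b f) x + partial a (partial b g) x.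
  rewrite -(partialD a Ux (smooth_on_partial b sf) (smooth_on_partial b sg)).
  by apply: (partial_ext a oU Ux) => y Uy; rewrite (partialD b Uy sf sg).
rewrite -mulrDr; congr (_ * _).
rewrite (eq_bigr (fun k => christoffel G k a b x * partial k f x +
  christoffel G k a b x * partial k g x)).
  by rewrite big_split /= opprD addrACA.
by move=> k _; rewrite (partialD k Ux sf sg) mulrDr.
Qed.

Lemma laplacianM f g x : U x -> smooth_on U f -> smooth_on U g ->
  laplacian G (fun y => f y * g y) x =
  f x * laplacian G g x + g x * laplacian G f x + 2 * inner G f g x.
Proof.
move=> Ux sf sg; rewrite mulr_natl mulr2n {1}(inner_sym f g Ux).
rewrite !mulr_sumr -!big_split; apply: eq_bigr => a _.
rewrite !mulr_sumr -!big_split; apply: eq_bigr => b _ /=.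
have -> : partial a (partial b (fun y => f y * g y)) x =
    f x * partial a (partial b g) x + partial a f x * partial b g x
    + (partial b f x * partial a g x + partial a (partial b f) x * g x).
  have [sbf sbg] := (smooth_on_partial b sf, smooth_on_partial b sg).
  rewrite -(partialM a Ux sf sbg) -(partialM a Ux sbf sg).
  rewrite -(partialD a Ux (smoothM oU sf sbg) (smoothM oU sbf sg)).
  by apply: (partial_ext a oU Ux) => y Uy; rewrite (partialM b Uy sf sg).
rewrite (eq_bigr (fun k => f x * (christoffel G k a b x * partial k g x) +
  g x * (christoffel G k a b x * partial k f x))); last first.
  move=> k _; rewrite (partialM k Ux sf sg).
  move: (christoffel G k a b x) (f x) (g x) (partial k f x) (partial k g x).
  by move=> c m n p q; ring.
rewrite big_split /= -!mulr_sumr.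
move: (\sum_k _) (\sum_k _) (invmx (G x) a b) => s t c.
move: (partial a (partial b f) x) (partial a (partial b g) x) (f x) (g x) => p q m n.
move: (partial a f x) (partial b f x) (partial a g x) (partial b g x) => e e' i i'.
ring.
Qed.

End LaplacianRules.

(** * Curvature, Laplacian and [I_squared] under rescaling *)

Section ConformalChange.
Context {R : realType} {d : nat}.
Local Notation E := 'rV[R]_d.
Local Notation e_ k := (delta_mx k 0 : 'cV[R]_d).
Variables (U : set E) (G H : E -> 'M[R]_d) (Om : E -> R).
Hypotheses (GU : metric_on U G) (sOm : smooth_on U Om)
  (Om0 : forall x, U x -> 0 < Om x) (HG : forall x, U x -> H x = Om x ^+ 2 *: G x).
Implicit Types (f g : E -> R) (x y : E) (i j k l : 'I_d).
Let oU : open U := metric_open GU.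
Let Om_neq0 x : U x -> Om x != 0. Proof. by move=> /Om0; exact: lt0r_neq0. Qed.

Lemma metric_on_rescaling : metric_on U H.
Proof.
split.
- exact: oU.
- apply: (smooth_mx_ext oU (A := fun y => Om y ^+ 2 *: G y)).
    by move=> y Uy; rewrite HG.
  exact: (smooth_mxZ oU (smoothX oU 2 sOm) (metric_on_smooth GU)).
- by move=> x Ux; rewrite HG// linearZ /= (metric_on_sym GU).
- move=> x Ux v v0; rewrite HG// -scalemxAr -scalemxAl mxE.
  by have [_ _ _ pos] := GU; rewrite mulr_gt0// ?pos// exprn_gt0// Om0.
Qed.
Let HU := metric_on_rescaling.

Lemma invmx_rescaling x : U x -> invmx (H x) = (Om x ^+ 2)^-1 *: invmx (G x).
Proof.
move=> Ux; rewrite HG// invmxZ//.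
by rewrite unitmxZ ?unitfE ?expf_neq0 ?Om_neq0// (metric_unit GU).
Qed.

Lemma inner_rescaling f g x : U x -> inner H f g x = (Om x ^+ 2)^-1 * inner G f g x.
Proof. by move=> Ux; rewrite !innerE invmx_rescaling// -scalemxAr -scalemxAl mxE. Qed.

Let v y : 'cV[R]_d := (Om y)^-1 *: dcol Om y.
Let u y : 'rV[R]_d := (v y)^T *m invmx (G y).

Let sOmV : smooth_on U (fun y => (Om y)^-1) := smoothV oU Om_neq0 sOm.
Let sv : smooth_mx U v := smooth_mxZ oU sOmV (smooth_dcol oU sOm).
Let su : smooth_mx U u := smooth_mxM oU (smooth_mx_tr oU sv) (smooth_invmx GU).
Let sA k : smooth_mx U (connection_mx G k) := smooth_connection GU k.

(** The covariant derivative of [v], that is, the Hessian of [ln Omega] written without the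
    logarithm. *)
Let h k x : 'cV[R]_d := mx_partial k v x - connection_mx G k x *m v x.

Let uG x : U x -> u x *m G x = (v x)^T.
Proof. by move=> Ux; rewrite /u mulmxKV// (metric_unit GU). Qed.

Let dv k x : U x -> mx_partial k v x =
  - ((Om x)^-1 ^+ 2 * partial k Om x) *: dcol Om x + (Om x)^-1 *: mx_partial k (dcol Om) x.
Proof.
move=> Ux; rewrite (mx_partialZ oU k Ux sOmV (smooth_dcol oU sOm)).
by rewrite (partialV k Ux (Om_neq0 Ux) sOm) mulNr.
Qed.

Let dv_sym k l x : U x -> mx_partial k v x l 0 = mx_partial l v x k 0.
Proof.
move=> Ux; rewrite (dv k Ux) (dv l Ux).
have E p q : (- ((Om x)^-1 ^+ 2 * partial p Om x) *: dcol Om x +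
    (Om x)^-1 *: mx_partial p (dcol Om) x) q 0 =
    - ((Om x)^-1 ^+ 2 * partial p Om x * partial q Om x)
    + (Om x)^-1 * mx_partial p (dcol Om) x q 0.
  move: (mx_partial p (dcol Om) x) => D.
  by rewrite !mxE mulNr.
apply: etrans (E k l) _; apply: etrans (esym (E l k)).
have aux (r p q a s t : R) : s = t -> - (r * p * q) + a * s = - (r * q * p) + a * t.
  by move=> ->; rewrite mulrAC.
exact: (aux _ _ _ _ _ _ (mx_partial_dcol oU k l Ux sOm)).
Qed.

Lemma connection_rescaling k x : U x -> connection_mx H k x =
  connection_mx G k x + conformal_difference (G x) (v x) (u x) k.
Proof.
move=> Ux; apply/esym; move: k; apply: (connection_unique HU Ux) => [k i j|k].
  rewrite [LHS]mxE [RHS]mxE (connection_sym GU k i j Ux).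
  by rewrite (conformal_difference_sym _ _ _ _ _ (metric_on_sym GU Ux)).
rewrite (mx_partial_ext oU k Ux HG).
rewrite (mx_partialZ oU k Ux (smoothX oU 2 sOm) (metric_on_smooth GU)).
rewrite HG// -!scalemxAr -!scalemxAl -!scalerDr [(connection_mx G k x + _)^T]raddfD /= mulmxDl mulmxDr addrACA.
rewrite -(connection_metric GU k Ux).
rewrite conformal_difference_metric ?(metric_on_sym GU Ux) ?uG//.
rewrite scalerDr addrC scalerA; congr (_ + _ *: _).
rewrite (_ : partial k _ x = partial k (fun y => Om y * Om y) x) //.
by rewrite (partialM k Ux sOm sOm) /v !mxE; field; exact: Om_neq0.
Qed.

Let du k x : U x ->
  mx_partial k u x = (h k x)^T *m invmx (G x) - u x *m connection_mx G k x.
Proof.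
move=> Ux; have Gu := metric_unit GU Ux.
have E : mx_partial k u x *m G x + u x *m mx_partial k G x = (mx_partial k v x)^T.
  rewrite -(mx_partialM oU k Ux su (metric_on_smooth GU)) -(mx_partial_tr oU k v Ux).
  exact: (mx_partial_ext oU k Ux uG).
have {E} : mx_partial k u x *m G x =
    (mx_partial k v x)^T - u x *m mx_partial k G x by rewrite -E addrK.
move/(canRL (mulmxK Gu)) => ->; rewrite (connection_metric GU k Ux).
rewrite mulmxDr !mulmxA uG// -trmx_mul opprD addrA addrAC mulmxBl mulmxK//.
by rewrite /h [(_ - _)^T]raddfB.
Qed.

Let dC k l x : U x ->
  mx_partial k (fun y => conformal_difference (G y) (v y) (u y) l) x =
  (mx_partial k v x l 0)%:M + mx_partial k v x *m (e_ l)^T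
  - ((connection_mx G k x *m G x + G x *m (connection_mx G k x)^T) *m e_ l *m u x
     + G x *m e_ l *m mx_partial k u x).
Proof.
move=> Ux; have sG := metric_on_smooth GU.
have se : smooth_mx U (fun=> (e_ l)^T) := smooth_mx_cst (e_ l)^T.
have sGe : smooth_mx U (fun y => G y *m e_ l) := smooth_mxM oU sG (smooth_mx_cst (e_ l)).
have s1 := smooth_scalar_mx GU (sv l 0).
have s2 := smooth_mxM oU sv se; have s3 := smooth_mxM oU sGe su.
rewrite (mx_partialD oU k Ux (smooth_mxD oU s1 s2) (smooth_mxN GU s3)).
rewrite (mx_partialD oU k Ux s1 s2) (mx_partialN GU k Ux s3).
rewrite (mx_partial_scalar GU k Ux (sv l 0)) (mx_partialM oU k Ux sv se).
rewrite (mx_partialM oU k Ux sGe su) (mx_partialM oU k Ux sG (smooth_mx_cst (e_ l))).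
rewrite !mx_partial_cst !mulmx0 !addr0 -(connection_metric GU k Ux).
by rewrite [mx_partial k v x l 0]mxE.
Qed.

Lemma curvature_rescaling k l x : U x -> curvature_mx H k l x =
  curvature_mx G k l x +
  (h k x *m (e_ l)^T - h l x *m (e_ k)^T - G x *m e_ l *m ((h k x)^T *m invmx (G x))
   + G x *m e_ k *m ((h l x)^T *m invmx (G x))
   + (v x l 0 *: v x *m (e_ k)^T - v x k 0 *: v x *m (e_ l)^T
      - G x *m e_ k *m ((v x l 0 *: v x)^T *m invmx (G x))
      + G x *m e_ l *m ((v x k 0 *: v x)^T *m invmx (G x))
      + (u x *m v x) 0 0 *: (G x *m e_ k *m (e_ l)^T - G x *m e_ l *m (e_ k)^T))).
Proof.
move=> Ux; pose C k := conformal_difference (G x) (v x) (u x) k.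
pose D k l := mx_partial k (fun y => conformal_difference (G y) (v y) (u y) l) x.
have sC l' : smooth_mx U (fun y => conformal_difference (G y) (v y) (u y) l').
  have sGe := smooth_mxM oU (metric_on_smooth GU) (smooth_mx_cst (e_ l')).
  apply: (smooth_mxD oU _ (smooth_mxN GU (smooth_mxM oU sGe su))).
  apply: (smooth_mxD oU (smooth_scalar_mx GU (sv l' 0))).
  exact: (smooth_mxM oU sv (smooth_mx_cst (e_ l')^T)).
have dconn p q : mx_partial p (connection_mx H q) x =
    mx_partial p (connection_mx G q) x + D p q.
  rewrite -(mx_partialD oU p Ux (sA q) (sC q)).
  by apply: (mx_partial_ext oU p Ux) => y Uy; exact: connection_rescaling.
have Gsym := metric_on_sym GU Ux.
have Ksym := invmx_sym GU Ux.
have KG : invmx (G x) *m G x = 1%:M by rewrite mulVmx// (metric_unit GU).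
have <- := conformal_difference_commutator (v x) k l Gsym KG Ksym.
have <- := conformal_difference_derivative (u := u x) (A := fun k => connection_mx G k x)
  (G := G x) (K := invmx (G x)) (dv := fun k => mx_partial k v x) (h := fun k => h k x)
  (du := fun k => mx_partial k u x) (dC := D)
  (fun k => erefl) (fun k l => dv_sym k l Ux)
  (fun k l j => connection_sym GU k l j Ux) (fun k => du k Ux) (fun k l => dC k l Ux) k l.
rewrite /curvature_mx !dconn !connection_rescaling//= -/(C k) -/(C l).
exact: curvature_add.
Qed.

(** The Laplacian of [ln Omega]. *)
Let tau x := \sum_k (invmx (G x) *m h k x) k 0.

Lemma scalar_curvature_rescaling x : U x -> scalar_curvature H x =
  (Om x ^+ 2)^-1 * (scalar_curvature G x
    + (2 - 2 * d%:R) * (tau x - (Om x ^+ 2)^-1 * inner G Om Om x)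
    - (Om x ^+ 2)^-1 * inner G Om Om x * (d%:R * (d%:R - 1))).
Proof.
move=> Ux; rewrite (scalar_curvatureE HU Ux) (scalar_curvatureE GU Ux).
have Ksym := invmx_sym GU Ux.
have KG : invmx (G x) *m G x = 1%:M by rewrite mulVmx// (metric_unit GU).
pose n := (u x *m v x) 0 0.
have nE : n = (Om x ^+ 2)^-1 * inner G Om Om x.
  rewrite /n /u /v innerE [(_ *: _)^T]linearZ /= -!scalemxAl -scalemxAr scalerA.
  by rewrite [LHS]mxE -invfM -expr2.
have nE' : \sum_k (invmx (G x) *m (v x k 0 *: v x)) k 0 = n.
  rewrite /n /u -mulmxA [RHS]mxE; apply: eq_bigr => k _.
  rewrite -scalemxAr; move: (invmx (G x) *m v x) (v x) => a b.
  by rewrite !mxE.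
transitivity ((Om x ^+ 2)^-1 * curvature_trace (invmx (G x)) (fun k l => curvature_mx H k l x)).
  rewrite mulr_sumr; apply: eq_bigr => k _; rewrite mulr_sumr; apply: eq_bigr => l _.
  by rewrite (invmx_rescaling Ux) -scalemxAl [LHS]mxE.
congr (_ * _); rewrite -nE -addrA.
have := curvature_trace_conformal (fun k => h k x) (fun k => v x k 0 *: v x) n KG Ksym.
rewrite nE' => <-; rewrite -curvature_traceD.
apply: eq_bigr => k _; apply: eq_bigr => l _; congr ((_ *m _) l k).
exact: curvature_rescaling.
Qed.

Lemma laplacian_rescaling f x : U x -> smooth_on U f -> laplacian H f x =
  (Om x ^+ 2)^-1 * (laplacian G f x + (d%:R - 2) * ((Om x)^-1 * inner G Om f x)).
Proof.
move=> Ux sf; rewrite (laplacian_trace HU f Ux) (laplacian_trace GU f Ux).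
have Ksym := invmx_sym GU Ux.
have KG : invmx (G x) *m G x = 1%:M by rewrite mulVmx// (metric_unit GU).
have -> : (Om x)^-1 * inner G Om f x = (u x *m dcol f x) 0 0.
  by rewrite /u /v innerE [(_ *: _)^T]linearZ /= -!scalemxAl [RHS]mxE.
have := trace_conformal_difference (v x) (dcol f x) KG Ksym; rewrite -/(u x) => E.
rewrite -(opprB 2 d%:R) mulNr -E -sumrB mulr_sumr; apply: eq_bigr => k _.
rewrite (invmx_rescaling Ux) (connection_rescaling k Ux) -scalemxAl [LHS]mxE.
congr (_ * _); rewrite mulmxDl opprD addrA mulmxBr.
move: (invmx (G x) *m _) (invmx (G x) *m (_ *m _)) => a b.
by rewrite !mxE.
Qed.

(** The product rule for [dcol Om = Om *: v]. It trades the Laplacian of [Omega], which appears in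
    that of [Omega * f], for the [tau] of the rescaled curvature. *)
Lemma laplacian_conformal_factor x : U x -> laplacian G Om x =
  Om x * (tau x + (Om x ^+ 2)^-1 * inner G Om Om x).
Proof.
move=> Ux; rewrite (laplacian_trace GU Om Ux).
have dOm y : U y -> dcol Om y = Om y *: v y.
  by move=> Uy; rewrite scalerA mulfV ?scale1r// Om_neq0.
have nE : inner G Om Om x = Om x ^+ 2 * ((v x)^T *m invmx (G x) *m v x) 0 0.
  rewrite innerE dOm// [(_ *: _)^T]linearZ /= -!scalemxAl -scalemxAr scalerA -expr2.
  by rewrite [LHS]mxE.
rewrite nE mulrA mulVf ?expf_neq0 ?Om_neq0// mul1r mulrDr.
transitivity (\sum_k (Om x * (invmx (G x) *m h k x) k 0
    + Om x * (v x k 0 * (invmx (G x) *m v x) k 0))); last first.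
  by rewrite big_split /= -!mulr_sumr sum_row_col mulmxA.
apply: eq_bigr => k _.
rewrite (mx_partial_ext oU k Ux dOm) (mx_partialZ oU k Ux sOm sv) dOm//.
rewrite -scalemxAr -addrA -scalerBr -/(h k x).
have -> : partial k Om x = Om x * v x k 0.
  by rewrite /v !mxE mulrA mulfV ?mul1r// Om_neq0.
rewrite mulmxDr -!scalemxAr addrC -scalerA.
move: (invmx (G x) *m _) (invmx (G x) *m _) (v x) => a b c.
by rewrite !mxE.
Qed.

Lemma schouten_trace_rescaling x : U x -> d%:R != 1 :> R -> schouten_trace H x =
  (Om x ^+ 2)^-1 * (schouten_trace G x - tau x
    - (d%:R - 2) / 2 * ((Om x ^+ 2)^-1 * inner G Om Om x)).
Proof.
move=> Ux d1; rewrite /schouten_trace scalar_curvature_rescaling//.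
have d2 : d%:R - 1 != 0 :> R by rewrite subr_eq0.
have := Om_neq0 Ux; move: (scalar_curvature G x) (tau x) (inner G Om Om x) (Om x).
by move=> S t n m m0; field; rewrite d2 m0.
Qed.

(** The coefficient [2 / d] and the trace of the Schouten tensor are what make every derivative of
    [Omega] cancel once [f] is rescaled with weight one. *)
Lemma I_squared_rescaling f x : U x -> d%:R != 1 :> R -> d%:R != 0 :> R ->
  smooth_on U f -> I_squared H (fun y => Om y * f y) x = I_squared G f x.
Proof.
move=> Ux d1 d0 sf; have sOf := smoothM oU sOm sf.
rewrite /I_squared (grad_sqnormE H) (grad_sqnormE G).
rewrite (laplacian_rescaling Ux sOf) (inner_rescaling _ _ Ux).
rewrite (schouten_trace_rescaling Ux d1) (laplacianM GU Ux sOm sf).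
rewrite (laplacian_conformal_factor Ux).
rewrite !(innerMl GU _ Ux sOm sf) !(innerMr G _ Ux sOm sf) (inner_sym GU f Om Ux).
have := Om_neq0 Ux; move: (Om x) (tau x) (laplacian G f x) (schouten_trace G x).
move: (inner G Om Om x) (inner G Om f x) (inner G f f x) (f x) => a b c m w t D S w0.
by field; rewrite w0 d0.
Qed.

End ConformalChange.

(** * Functions vanishing to finite order along a hypersurface *)

Section Vanishing.
Context {R : realType} {d : nat}.
Local Notation E := 'rV[R]_d.
Variables (U : set E) (Z : set E).
Hypothesis oU : open U.
Implicit Types (f g phi psi a : E -> R) (x y : E) (i j : 'I_d) (k l m n : nat).

(** All derivatives of order less than [n] are zero on [Z]. [Z] is the zero set of a defining
    function when unit fields are compared along a hypersurface, and a single point when jets are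
    compared. *)
Fixpoint vanish n phi : Prop :=
  smooth_on U phi /\
  if n is m.+1 then (forall x, U x -> Z x -> phi x = 0) /\
                    forall i, vanish m (partial i phi)
  else True.

Lemma vanish_smooth n phi : vanish n phi -> smooth_on U phi.
Proof. by case: n => [|n] []. Qed.

Lemma vanish0 phi : smooth_on U phi -> vanish 0 phi.
Proof. by move=> s; split. Qed.

Lemma vanishS n phi : smooth_on U phi -> (forall x, U x -> Z x -> phi x = 0) ->
  (forall i, vanish n (partial i phi)) -> vanish n.+1 phi.
Proof. by move=> s z p; split; first exact: s; split; [exact: z|exact: p]. Qed.

Lemma vanish_eq0 n phi x : vanish n.+1 phi -> U x -> Z x -> phi x = 0.
Proof. by move=> [_ [z _]]; exact: z. Qed.

Lemma vanish_partial n phi i : vanish n.+1 phi -> vanish n (partial i phi).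
Proof. by move=> [_ [_ p]]; exact: p. Qed.

Lemma vanish1 phi : smooth_on U phi -> (forall x, U x -> Z x -> phi x = 0) ->
  vanish 1 phi.
Proof.
by move=> s z; apply: (vanishS s z) => i; exact: (vanish0 (smooth_on_partial i s)).
Qed.

Lemma vanish_ext n phi psi : (forall y, U y -> phi y = psi y) ->
  vanish n phi -> vanish n psi.
Proof.
elim: n phi psi => [|n IH] phi psi e.
  by move=> [s _]; apply: vanish0; exact: smooth_on_ext oU e s.
move=> [s [z p]]; apply: vanishS; first exact: smooth_on_ext oU e s.
  by move=> x Ux Zx; rewrite -e// z.
move=> i; apply: IH (p i) => y Uy; exact: partial_ext oU Uy e.
Qed.

Lemma vanish_le m n phi : (m <= n)%N -> vanish n phi -> vanish m phi.
Proof.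
elim: n m phi => [|n IH] [|m] phi mn v; first exact: v.
- by rewrite ltn0 in mn.
- exact: vanish0 (vanish_smooth v).
have [s [z p]] := v; apply: (vanishS s z) => i.
exact: IH mn (p i).
Qed.

Lemma vanishD n phi psi : vanish n phi -> vanish n psi ->
  vanish n (fun x => phi x + psi x).
Proof.
elim: n phi psi => [|n IH] phi psi.
  by move=> [s _] [s' _]; exact: vanish0 (smoothD oU s s').
move=> [s [z p]] [s' [z' p']]; apply: vanishS; first exact: smoothD.
  by move=> x Ux Zx; rewrite z// z'// addr0.
move=> i; apply: vanish_ext (IH _ _ (p i) (p' i)) => y Uy.
by rewrite (partialD i Uy s s').
Qed.

Lemma vanishN n phi : vanish n phi -> vanish n (fun x => - phi x).
Proof.
elim: n phi => [|n IH] phi.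
  by move=> [s _]; exact: vanish0 (smoothN oU s).
move=> [s [z p]]; apply: vanishS; first exact: smoothN.
  by move=> x Ux Zx; rewrite z// oppr0.
move=> i; apply: vanish_ext (IH _ (p i)) => y Uy.
by rewrite (partialN i Uy s).
Qed.

Lemma vanishB n phi psi : vanish n phi -> vanish n psi ->
  vanish n (fun x => phi x - psi x).
Proof. by move=> v w; exact: vanishD v (vanishN w). Qed.

Lemma vanishMl n a phi : smooth_on U a -> vanish n phi ->
  vanish n (fun x => a x * phi x).
Proof.
elim: n a phi => [|n IH] a phi sa.
  by move=> [s _]; exact: vanish0 (smoothM oU sa s).
move=> v; have [s [z p]] := v; apply: vanishS; first exact: smoothM.
  by move=> x Ux Zx; rewrite z// mulr0.
move=> i; have v' := vanish_le (leqnSn n) v.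
apply: vanish_ext (vanishD (IH _ _ sa (p i)) (IH _ _ (smooth_on_partial i sa) v')).
by move=> y Uy; rewrite (partialM i Uy sa s).
Qed.

(** In each term of the Leibniz rule one factor loses one order, hence the induction on the sum of
    the orders. *)
Lemma vanishM m n phi psi : vanish m phi -> vanish n psi ->
  vanish (m + n) (fun x => phi x * psi x).
Proof.
have [N] := ubnP (m + n)%N; elim: N m n phi psi => // N IH [|m] [|n] phi psi.
- by rewrite addn0 => _ [s _] w; exact: vanishMl s w.
- by move=> _ [s _] w; exact: vanishMl s w.
- rewrite addn0 => _ v [s _]; apply: vanish_ext (vanishMl s v) => y _.
  exact: mulrC.
rewrite addSn addnS ltnS => mnN v w.
have [s [z p]] := v; have [s' [z' p']] := w.
apply: vanishS; first exact: smoothM.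
  by move=> x Ux Zx; rewrite z// mul0r.
move=> i; have v1 : vanish (m + n).+1 (fun x => phi x * partial i psi x).
  by rewrite -addSn; apply: IH v (p' i); rewrite addSn.
have v2 : vanish (m + n).+1 (fun x => partial i phi x * psi x).
  by rewrite -addnS; apply: IH (p i) w; rewrite addnS.
by apply: vanish_ext (vanishD v1 v2) => y Uy; rewrite (partialM i Uy s s').
Qed.

Lemma vanishZ n (c : R) phi : vanish n phi -> vanish n (fun x => c * phi x).
Proof. exact: vanishMl (smooth_cst c). Qed.

Lemma vanish_zero n : vanish n (fun=> 0).
Proof.
elim: n => [|n IH]; first exact: (vanish0 (smooth_cst 0)).
apply: vanishS; [exact: smooth_cst|by []|] => i.
by apply: vanish_ext IH => y _; rewrite partial_cst.
Qed.

Lemma vanish_sum n (I : Type) (r : seq I) (F : I -> E -> R) :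
  (forall b, vanish n (F b)) -> vanish n (fun x => \sum_(b <- r) F b x).
Proof.
move=> vF; elim: r => [|b r IH].
  by apply: vanish_ext (vanish_zero n) => y _; rewrite big_nil.
by apply: vanish_ext (vanishD (vF b) IH) => y _; rewrite big_cons.
Qed.

Section Metric.
Variables (G : E -> 'M[R]_d).
Hypothesis GU : metric_on U G.
(* Lagrange multipliers along [Z] *)
Hypothesis proportional : forall phi psi x i j, vanish 1 phi -> vanish 1 psi ->
  U x -> Z x -> partial i phi x * partial j psi x = partial j phi x * partial i psi x.

Let sK (a b : 'I_d) : smooth_on U (fun y => invmx (G y) a b) := smooth_invmx GU a b.

Lemma vanish_inner n f phi : smooth_on U f -> vanish n.+1 phi -> vanish n (inner G f phi).
Proof.
move=> sf v; apply: vanish_sum => a; apply: vanish_sum => b.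
apply: vanishMl (vanish_partial b v).
exact: (smoothM oU (sK a b) (smooth_on_partial a sf)).
Qed.

Lemma vanish_inner2 m n phi psi : vanish m.+1 phi -> vanish n.+1 psi ->
  vanish (m + n) (inner G phi psi).
Proof.
move=> v w; apply: vanish_sum => a; apply: vanish_sum => b.
by apply: vanishM (vanish_partial b w); apply: vanishMl (vanish_partial a v); exact: sK.
Qed.

Lemma vanish_laplacian n phi : vanish n.+2 phi -> vanish n (laplacian G phi).
Proof.
move=> v; apply: vanish_sum => a; apply: vanish_sum => b.
apply: vanishMl (sK a b) _; apply: vanishB.
  exact: vanish_partial a (vanish_partial b v).
apply: vanish_sum => k; apply: vanishMl; first exact: (smooth_christoffel GU).
exact: vanish_le (leqnSn n) (vanish_partial k v).
Qed.

(** * Normal and tangential derivatives for a normalised defining function *)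

Section Normalised.
Variable f : E -> R.
Hypotheses (vf : vanish 1 f) (nf : vanish 1 (fun x => inner G f f x - 1)).
Let sf : smooth_on U f := vanish_smooth vf.
Local Notation X := (inner G f).

(** Components of the gradient vector field of [f]; through [XE], [X] acts as a first-order operator
    with smooth coefficients. *)
Let coef (b : 'I_d) y : R := \sum_a invmx (G y) a b * partial a f y.

Let scoef b : smooth_on U (coef b).
Proof.
apply: (smooth_sum oU) => a _; exact: (smoothM oU (sK a b) (smooth_on_partial a sf)).
Qed.

Let XE phi y : X phi y = \sum_b coef b y * partial b phi y.
Proof.
rewrite /inner exchange_big; apply: eq_bigr => b _; rewrite mulr_suml.
by apply: eq_bigr.
Qed.

(** The second derivatives of [phi] cancel, so the commutator is of first order and costs one order
    of vanishing, not two. *)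
Let vanish_commutator n phi c : vanish n.+1 phi ->
  vanish n (fun x => partial c (X phi) x - X (partial c phi) x).
Proof.
move=> v; have sphi := vanish_smooth v.
have : vanish n (fun x => \sum_b partial c (coef b) x * partial b phi x).
  apply: vanish_sum => b; apply: vanishMl (vanish_partial b v).
  exact: (smooth_on_partial c (scoef b)).
apply: vanish_ext => y Uy; rewrite (XE (partial c phi)).
have -> : partial c (X phi) y = partial c (fun y => \sum_b coef b y * partial b phi y) y.
  by apply: (partial_ext c oU Uy) => z _; exact: XE.
rewrite (partial_sum oU _ c Uy) => [|b _]; last first.
  exact: (smoothM oU (scoef b) (smooth_on_partial b sphi)).
rewrite -sumrB; apply: eq_bigr => b _.
rewrite (partialM c Uy (scoef b) (smooth_on_partial b sphi)).
by rewrite (partial_comm c b oU Uy sphi) addrAC subrr add0r.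
Qed.

(** On [Z] the differential of [phi] is proportional to that of [f]; pairing with the gradient of
    [f], of length one there, identifies the factor as [X phi]. *)
Let partial_on_zero phi i x : vanish 1 phi -> U x -> Z x ->
  partial i phi x = partial i f x * X phi x.
Proof.
move=> v Ux Zx; have f1 : X f x = 1.
  by apply/eqP; rewrite -subr_eq0; apply/eqP/(vanish_eq0 nf Ux Zx).
rewrite -[LHS]mulr1 -f1 !mulr_sumr; apply: eq_bigr => a _.
rewrite !mulr_sumr; apply: eq_bigr => b _.
have := proportional i b v vf Ux Zx.
move: (invmx (G x) a b) (partial i phi x) (partial a f x) => c p q.
move: (partial b f x) (partial i f x) (partial b phi x) => r s t e.
by rewrite mulrCA (mulrCA s) e; ring.
Qed.

(** Removing the normal component of a derivative restores the lost order. On [Z] this is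
    [partial_on_zero]; a derivative of the expression is the same expression for [partial c phi] up
    to a commutator and a multiple of [X phi], all of the required order. *)
Lemma vanish_tangential n phi i : vanish n phi ->
  vanish n (fun x => partial i phi x - partial i f x * X phi x).
Proof.
have smooth_op psi : smooth_on U psi ->
    smooth_on U (fun x => partial i psi x - partial i f x * X psi x).
  move=> spsi; apply: (smoothB oU (smooth_on_partial i spsi)).
  exact: (smoothM oU (smooth_on_partial i sf) (smooth_inner GU sf spsi)).
elim: n phi => [|n IH] phi v; first exact: (vanish0 (smooth_op _ (vanish_smooth v))).
have sphi := vanish_smooth v; have sX := smooth_inner GU sf sphi.
apply: vanishS; first exact: smooth_op.
  move=> x Ux Zx; rewrite (partial_on_zero i (vanish_le (ltn0Sn n) v) Ux Zx).
  exact: subrr.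
move=> c; have vc := vanish_partial c v.
have v1 := IH _ vc.
have v2 : vanish n (fun x => partial c (partial i f) x * X phi x).
  apply: vanishMl (vanish_inner sf v).
  exact: (smooth_on_partial _ (smooth_on_partial _ sf)).
have v3 : vanish n (fun x => partial i f x *
    (partial c (X phi) x - X (partial c phi) x)).
  exact: vanishMl (smooth_on_partial i sf) (vanish_commutator c v).
apply: vanish_ext (vanishB (vanishB v1 v2) v3) => y Uy.
rewrite (partialB oU c Uy (smooth_on_partial i sphi)); last first.
  exact: (smoothM oU (smooth_on_partial i sf) sX).
rewrite (partialM c Uy (smooth_on_partial i sf) sX) (partial_comm c i oU Uy sphi).
move: (partial i (partial c phi) y) (partial i f y) (X (partial c phi) y) => p q r.
move: (partial c (partial i f) y) (X phi y) (partial c (X phi) y) => t e m.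
by ring.
Qed.

(* Euler's homogeneity relation transversally to [Z] *)
Lemma vanish_euler n phi : vanish n phi ->
  vanish n.+1 (fun x => f x * X phi x - n%:R * phi x).
Proof.
have smooth_op psi c : smooth_on U psi ->
    smooth_on U (fun x => f x * X psi x - c * psi x).
  move=> spsi; apply: (smoothB oU); last exact: (smoothM oU (smooth_cst c) spsi).
  exact: (smoothM oU sf (smooth_inner GU sf spsi)).
elim: n phi => [|n IH] phi v.
  have sphi := vanish_smooth v; apply: vanish1; first exact: smooth_op.
  by move=> x Ux Zx; rewrite (vanish_eq0 vf Ux Zx) !mul0r subrr.
have sphi := vanish_smooth v; have sX := smooth_inner GU sf sphi.
apply: vanishS; first exact: smooth_op.
  by move=> x Ux Zx; rewrite (vanish_eq0 vf Ux Zx) (vanish_eq0 v Ux Zx) mul0r mulr0 subrr.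
move=> c; have vc := vanish_partial c v.
have v1 := IH _ vc; have v2 := vanish_tangential c v.
have v3 : vanish n.+1 (fun x => f x * (partial c (X phi) x - X (partial c phi) x)).
  exact: vanishM vf (vanish_commutator c v).
apply: vanish_ext (vanishD (vanishB v1 v2) v3) => y Uy.
have sfX := smoothM oU sf sX; have snp := smoothM oU (smooth_cst n.+1%:R) sphi.
rewrite (partialB oU c Uy sfX snp) (partialM c Uy sf sX) (partialMl c _ Uy sphi).
rewrite -natr1.
move: (n%:R : R) (partial c phi y) (partial c f y) (X (partial c phi) y) => N p q r.
move: (f y) (X phi y) (partial c (X phi) y) => t e m.
by ring.
Qed.

(** The tangential parts [T b] vanish to order [n.+1], so their derivatives do to order [n]. What is
    left of the second-order part is the second normal derivative; Christoffel terms contain only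
    first derivatives. *)
Lemma vanish_laplacian_normal n phi : vanish n.+1 phi ->
  vanish n (fun x => laplacian G phi x - X (X phi) x).
Proof.
move=> v; have sphi := vanish_smooth v; have sX := smooth_inner GU sf sphi.
pose T b y := partial b phi y - partial b f y * X phi y.
have vT (a b : 'I_d) : vanish n (partial a (T b)).
  exact: (vanish_partial a (vanish_tangential b v)).
have v1 : vanish n (fun x => \sum_a \sum_b invmx (G x) a b *
    (partial a (T b) x + partial a (partial b f) x * X phi x)).
  apply: vanish_sum => a; apply: vanish_sum => b; apply: vanishMl; first exact: sK.
  apply: vanishD; first exact: vT.
  apply: vanishMl (vanish_inner sf v).
  exact: (smooth_on_partial _ (smooth_on_partial _ sf)).
have v2 : vanish n (fun x => \sum_a \sum_b invmx (G x) a b *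
    \sum_k christoffel G k a b x * partial k phi x).
  apply: vanish_sum => a; apply: vanish_sum => b; apply: vanishMl; first exact: sK.
  apply: vanish_sum => k; apply: vanishMl (vanish_partial k v).
  exact: (smooth_christoffel GU).
apply: vanish_ext (vanishB v1 v2) => y Uy.
rewrite (inner_sym GU f (X phi) Uy).
set Xphi := X phi in sX T vT v1 *.
rewrite -!sumrB; apply: eq_bigr => a _; rewrite -!sumrB; apply: eq_bigr => b _.
have -> : partial a (T b) y = partial a (partial b phi) y
    - (partial b f y * partial a Xphi y + partial a (partial b f) y * Xphi y).
  have sb := smooth_on_partial b sf.
  by rewrite (partialB oU a Uy (smooth_on_partial b sphi) (smoothM oU sb sX))
     (partialM a Uy sb sX).
rewrite [partials _ _ _]/=.
move: (\sum_k _) (invmx (G y) a b) (partial a (partial b phi) y) => s c p.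
move: (partial b f y) (partial a Xphi y) (partial a (partial b f) y) (Xphi y) => q r t e.
by ring.
Qed.

(** Euler's relation applied to [X phi], which vanishes to order [n], after the Laplacian has been
    replaced by [X (X phi)]. *)
Lemma vanish_f_laplacian n phi : vanish n.+1 phi ->
  vanish n.+1 (fun x => f x * laplacian G phi x - n%:R * X phi x).
Proof.
move=> v; have vX := vanish_inner sf v.
have v1 : vanish n.+1 (fun x => f x * (laplacian G phi x - X (X phi) x)).
  exact: vanishM vf (vanish_laplacian_normal v).
apply: vanish_ext (vanishD v1 (vanish_euler vX)) => y Uy.
move: (n%:R : R) (f y) (laplacian G phi y) (X (X phi) y) (X phi y) => a b c e g.
by ring.
Qed.

(** Only [2 X phi] and [- 2 / d * f * laplacian G phi] fall short of order [n.+2], and the latter is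
    reduced by [vanish_f_laplacian]. The quadratic term has order [2 n + 2], the remaining ones
    carry a factor [phi]. *)
Lemma I_squared_linearization n phi : vanish n.+2 phi ->
  vanish n.+2 (fun x => I_squared G (fun y => f y + phi y) x - I_squared G f x
    - (2 - 2 / d%:R * n.+1%:R) * X phi x).
Proof.
move=> v; have sphi := vanish_smooth v.
have sL g : smooth_on U g -> smooth_on U (laplacian G g).
  exact: (smooth_laplacian GU).
have sJ := smooth_schouten_trace GU.
have v1 := vanish_f_laplacian v.
have v2 : vanish n.+2 (inner G phi phi).
  by apply: vanish_le (vanish_inner2 v v); rewrite addSn addnS !ltnS leq_addr.
have v3 : vanish n.+2 (fun x => laplacian G f x * phi x) := vanishMl (sL f sf) v.
have v4 : vanish n.+2 (fun x => laplacian G phi x * phi x) := vanishMl (sL phi sphi) v.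
have v5 : vanish n.+2 (fun x => (schouten_trace G x * (2 * f x + phi x)) * phi x).
  apply: vanishMl v; apply: (smoothM oU sJ); apply: (smoothD oU _ sphi).
  exact: (smoothM oU (smooth_cst 2) sf).
have v6 := vanishZ (- (2 / d%:R)) (vanishD (vanishD v1 v3) (vanishD v4 v5)).
apply: vanish_ext (vanishD v2 v6) => y Uy; have sfp := smoothD oU sf sphi.
rewrite /I_squared !grad_sqnormE (innerDl GU _ Uy sf sphi).
rewrite !(innerDr G _ Uy sf sphi) (laplacianD GU Uy sf sphi) (inner_sym GU phi f Uy).
move: (inner G phi phi y) (X phi y) (X f y) (f y) (phi y) => a b c e g.
move: (laplacian G phi y) (laplacian G f y) (schouten_trace G y) (2 / d%:R) => p q r t.
by ring.
Qed.

End Normalised.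

Lemma smooth_I_squared f : smooth_on U f -> smooth_on U (I_squared G f).
Proof.
move=> sf; apply: (smoothB oU (smooth_inner GU sf sf)).
apply: (smoothM oU (smoothM oU (smooth_cst _) sf)).
apply: (smoothD oU (smooth_laplacian GU sf)).
exact: (smoothM oU (smooth_schouten_trace GU) sf).
Qed.

Lemma vanish_inner_normalised f : vanish 1 f ->
  vanish 1 (fun x => I_squared G f x - 1) -> vanish 1 (fun x => inner G f f x - 1).
Proof.
move=> vf v; have sf := vanish_smooth vf.
have s : smooth_on U (fun x => laplacian G f x + schouten_trace G x * f x).
  apply: (smoothD oU (smooth_laplacian GU sf)).
  exact: (smoothM oU (smooth_schouten_trace GU) sf).
apply: vanish_ext (vanishD v (vanishZ (2 / d%:R) (vanishMl s vf))) => y _.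
rewrite /I_squared grad_sqnormE.
move: (inner G f f y) (laplacian G f y) (schouten_trace G y * f y) (f y) => a b c e.
by ring.
Qed.

(** The correction is a multiple of [f * (I_squared G f - 1)]; its factor [f] raises the order by
    one without dividing by anything, so the step stays polynomial in jets. *)
Definition improve c f : E -> R := fun y => f y * (1 - c * (I_squared G f y - 1)).

(** With [e] the error, Euler's relation and [|df| = 1] on [Z] give [X (f e) = (n.+1 + 1) e] modulo
    higher order. The correction thus changes [I_squared] by [- c (2 - 2 / d * n.+1) n.+2 e], and
    [cE] makes this [- e]. *)
Lemma improve_step n c f : vanish 1 f -> vanish n.+1 (fun x => I_squared G f x - 1) ->
  c * ((2 - 2 / d%:R * n.+1%:R) * n.+2%:R) = 1 ->
  vanish n.+2 (fun x => improve c f x - f x) /\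
  vanish n.+2 (fun x => I_squared G (improve c f) x - 1).
Proof.
move=> vf v cE; have sf := vanish_smooth vf.
have nf := vanish_inner_normalised vf (vanish_le (ltn0Sn n) v).
pose e y := I_squared G f y - 1; pose h y := - c * (f y * e y).
change (vanish n.+1 e) in v; have se : smooth_on U e := vanish_smooth v.
have sfe := smoothM oU sf se.
have vh : vanish n.+2 h := vanishZ (- c) (vanishM vf v).
have fh : improve c f = (fun y => f y + h y).
  by apply/funext => y; rewrite /improve /h /e; ring.
split; first by apply: vanish_ext vh => y _; rewrite fh addrAC subrr add0r.
have v1 := I_squared_linearization vf nf vh.
have v2 := vanish_euler vf nf v.
have v3 : vanish n.+2 (fun x => (inner G f f x - 1) * e x) := vanishM nf v.
rewrite fh.
have v4 := vanishZ (- c * (2 - 2 / d%:R * n.+1%:R)) (vanishD v2 v3).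
apply: vanish_ext (vanishD v1 v4) => y Uy.
have Xh : inner G f h y = - c * (f y * inner G f e y + e y * inner G f f y).
  rewrite /h (innerMr G f Uy (smooth_cst (- c)) sfe) inner_cstr mulr0 addr0.
  by rewrite (innerMr G f Uy sf se).
rewrite Xh -/e.
have -> : I_squared G f y = e y + 1 by rewrite /e subrK.
move: cE; rewrite -(natr1 n.+1).
move: (I_squared G (fun y => f y + h y) y) (inner G f e y) (f y) (e y) (inner G f f y) => a b p q r.
move: (2 - 2 / d%:R * n.+1%:R : R) => t; move: (n.+1%:R : R) => N cE.
transitivity (a - 1 - q + c * (t * (N + 1)) * q); first by ring.
by rewrite cE; ring.
Qed.

(** Equal zeros and differentials give the difference [h] order two. If [h] has order [n.+2], the
    linearisation forces [X h] to that order, as its coefficient is nonzero for [n.+1 < d], and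
    Euler's relation then expresses [n.+2 * h] by [f * X h] up to order [n.+3]. The last useful
    value [n = d.-1] yields order [d.+1]. *)
Lemma normalised_unique f f' : vanish 1 f -> vanish 1 f' -> (0 < d)%N ->
  vanish d (fun x => I_squared G f x - 1) ->
  vanish d (fun x => I_squared G f' x - 1) ->
  (forall x i, U x -> Z x -> partial i f' x = partial i f x) ->
  vanish d.+1 (fun x => f' x - f x).
Proof.
move=> vf vf' d0 v v' df; have sf := vanish_smooth vf; have sf' := vanish_smooth vf'.
have nf := vanish_inner_normalised vf (vanish_le d0 v).
pose h x := f' x - f x.
have fh : (fun y => f y + h y) = f' by apply/funext => y; rewrite /h addrC subrK.
suff H n : (n.+1 <= d)%N -> vanish n.+2 h.
  by apply: vanish_le (H d.-1 _); rewrite (prednK d0).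
elim: n => [_|n IH nd].
  have v1 := vanishB vf' vf.
  apply: (vanishS (vanish_smooth v1)) => [x|i]; first exact: vanish_eq0 v1.
  apply: (vanish1 (smooth_on_partial i (vanish_smooth v1))) => x Ux Zx.
  by rewrite (partialB oU i Ux sf' sf) df// subrr.
have vh := IH (ltnW nd); have sh := vanish_smooth vh.
have vI : vanish n.+2 (fun x => I_squared G f' x - I_squared G f x).
  apply: vanish_ext (vanish_le nd (vanishB v' v)) => y _.
  by rewrite opprB addrA subrK.
have := I_squared_linearization vf nf vh; rewrite fh => vL.
set t : R := 2 - 2 / d%:R * n.+1%:R in vL.
have t0 : t != 0.
  have dR : d%:R != 0 :> R by rewrite pnatr_eq0 -lt0n.
  have -> : t = 2 * (d%:R - n.+1%:R) / d%:R by rewrite /t; field.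
  rewrite mulf_neq0 ?invr_eq0// mulf_neq0 ?pnatr_eq0//.
  by rewrite subr_eq0 eqr_nat gtn_eqF.
have vX : vanish n.+2 (inner G f h).
  apply: vanish_ext (vanishZ t^-1 (vanishB vI vL)) => y _.
  by move: (I_squared G f' y) (I_squared G f y) (inner G f h y) => a b c; field.
have n0 : n.+2%:R != 0 :> R by rewrite pnatr_eq0.
apply: vanish_ext (vanishZ n.+2%:R^-1 (vanishB (vanishM vf vX) (vanish_euler vf nf vh))).
move=> y _; move: (f y) (inner G f h y) (h y) n0 => a b c.
by move: (n.+2%:R : R) => N N0; field.
Qed.

End Metric.
End Vanishing.

(** * Differentials of functions vanishing on a level set *)

Section LevelSet.
Context {R : realType} {d : nat}.
Local Notation E := 'rV[R]_d.
Local Notation e_ i := (delta_mx 0 i : E).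
Implicit Types (U : set E) (f s phi psi : E -> R) (x y v n w : E) (i j k : 'I_d).

Definition differential f x w : R := \sum_i w 0 i * partial i f x.

Lemma differential_lin f x (a b : R) v w :
  differential f x (a *: v + b *: w) = a * differential f x v + b * differential f x w.
Proof.
rewrite !mulr_sumr -big_split; apply: eq_bigr => i _ /=.
by rewrite !mxE mulrDl !mulrA.
Qed.

Lemma differential_delta f x i : differential f x (e_ i) = partial i f x.
Proof.
rewrite /differential (bigD1 i) //= mxE !eqxx mul1r big1 ?addr0// => j /negbTE ji.
by rewrite mxE ji andbF mul0r.
Qed.

Lemma first_order_approx U f x (eps : R) : open U -> U x -> smooth_on U f -> 0 < eps ->
  exists2 r : R, 0 < r & forall w, `|w| + `|w| < r ->
    U (x + w) /\ `|f (x + w) - f x - differential f x w| <= eps * `|w|.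
Proof.
move=> oU Ux sf e0; have e1 : 0 < eps / d.+1%:R by rewrite divr_gt0.
have Cf2 i : C1_on U (partial i f) := smooth_onC1 (smooth_on_partial i sf).
have [r r0 rU] := ball_nbhs_ex oU Ux (continuous_partials_near e1 Ux Cf2).
have Cr : C1_on (ball x r) f by move=> y /rU[Uy _]; exact: smooth_onC1 sf y Uy.
exists r => // w wr; split.
  apply: (rU _ _).1; rewrite -ball_normE /= opprD addrA subrr add0r normrN.
  by apply: le_lt_trans wr; rewrite lerDl.
apply: le_trans (partial_linear_approx Cr (fun y i by_ => (rU y by_).2 i) wr) _.
rewrite ler_wpM2r// mulrC -mulrA ler_piMr ?(ltW e0)//.
by rewrite mulrC ler_pdivrMr// mul1r ler_nat.
Qed.

(** A substitute for the implicit function theorem. Near [x + t v] the intermediate value theorem in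
    the transversal direction [n] finds a zero of [s] at distance of order [c t]. There [phi]
    vanishes as well, so [differential phi x v] is bounded by a multiple of the arbitrary [c]. *)
Lemma level_set_tangent U s phi x v n : open U -> smooth_on U s -> smooth_on U phi ->
  U x -> s x = 0 -> (forall y, U y -> s y = 0 -> phi y = 0) ->
  differential s x v = 0 -> differential s x n = 1 -> differential phi x v = 0.
Proof.
move=> oU ss sphi Ux sx0 phi0 sv sn.
suff H (c : R) : 0 < c -> c <= 1 ->
    `|differential phi x v| <= c * (1 + `|differential phi x n|).
  apply/eqP; rewrite -normr_le0; apply/ler_addgt0Pl => e e0; rewrite addr0.
  set M := 1 + `|differential phi x n|; have M0 : 0 < M by rewrite ltr_wpDr.
  pose c := Num.min 1 (e / M).
  have c0 : 0 < c by rewrite lt_min ltr01 divr_gt0.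
  have c1 : c <= 1 by rewrite ge_min lexx.
  apply: le_trans (H c c0 c1) _; rewrite -ler_pdivlMr//.
  by rewrite ge_min lexx orbT.
move=> c0 c1.
have [N [N0 vN]] : exists N : R, 0 < N /\ `|v| + `|n| <= N.
  by exists (`|v| + `|n| + 1); split; [rewrite ltr_wpDl// addr_ge0|rewrite lerDl].
(* Displacements have norm at most [t * N], so the linear approximations of [s] and [phi] err by at
   most [c * t / 2], which is too little to spoil the signs of [s] at [u = c t] and [u = - c t]. *)
have eps0 : 0 < c / (2 * N) by rewrite divr_gt0// mulr_gt0.
have [r1 r10 A1] := first_order_approx oU Ux ss eps0.
have [r2 r20 A2] := first_order_approx oU Ux sphi eps0.
have [r [r0 rr1 rr2]] : exists r : R, [/\ 0 < r, r <= r1 & r <= r2].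
  by exists (Num.min r1 r2); split; [rewrite lt_min r10|rewrite ge_min lexx|
     rewrite ge_min lexx orbT].
have [t [t0 tN]] : exists t : R, 0 < t /\ t * N + t * N < r.
  exists (r / (4 * N)); split; first by rewrite divr_gt0// mulr_gt0.
  have -> : r / (4 * N) * N + r / (4 * N) * N = r / 2 by field; rewrite gt_eqF.
  by rewrite ltr_pdivrMr// ltr_pMr// ltr1n.
pose w (u : R) : E := t *: v + u *: n.
have wN (u : R) : `|u| <= c * t -> `|w u| <= t * N.
  move=> uct; apply: le_trans (ler_normD _ _) _; rewrite !normrZ (gtr0_norm t0).
  apply: le_trans (_ : t * (`|v| + `|n|) <= _); last by rewrite ler_pM2l.
  rewrite mulrDr lerD2l; apply: ler_wpM2r => //; apply: le_trans uct _.
  by rewrite -[leRHS]mul1r ler_wpM2r// ltW.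
have near_w (u : R) : `|u| <= c * t -> `|w u| + `|w u| < r.
  by move=> /wN wu; apply: le_lt_trans tN; exact: lerD.
have epsN : c / (2 * N) * (t * N) = c * t / 2.
  by move: N0 => {}N0; field; rewrite gt_eqF.
have B1 (u : R) : `|u| <= c * t -> U (x + w u) /\ `|s (x + w u) - u| <= c * t / 2.
  move=> ut; have [Uw] := A1 (w u) (lt_le_trans (near_w u ut) rr1).
  rewrite sx0 subr0 {2}/w differential_lin sv sn mulr0 add0r mulr1 => h.
  split=> //; apply: le_trans h _; rewrite -epsN.
  exact: ler_wpM2l (ltW eps0) _ _ (wN u ut).
have ct0 : 0 < c * t by rewrite mulr_gt0.
pose g (u : R) : R := s (x + t *: v + u *: n).
have gE u : g u = s (x + w u) by rewrite /g /w addrA.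
have gcont : {within `[- (c * t), c * t], continuous g}.
  apply: continuous_in_subspaceT => u; rewrite inE /= in_itv /= -ler_norml => uct.
  have [Uu _] := B1 u uct.
  have ds : derivable s (x + t *: v + u *: n) n.
    by apply: diff_derivable; rewrite -addrA; exact: smooth_differentiable oU Uu ss.
  have [dg _] := is_derive_line ds.
  by apply: differentiable_continuous; exact/derivable1_diffP.
have lect : - (c * t) <= c * t by rewrite -subr_ge0 opprK addr_ge0// ltW.
have ctn : `|c * t| <= c * t by rewrite gtr0_norm.
have gpos : 0 < g (c * t).
  have [_] := B1 _ ctn; rewrite -gE ler_distl => /andP[h _].
  by apply: lt_le_trans h; lra.
have gneg : g (- (c * t)) < 0.
  rewrite -normrN in ctn; have [_] := B1 _ ctn; rewrite -gE ler_distl => /andP[_ h].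
  by apply: le_lt_trans h _; lra.
have [|u uct gu] := @IVT _ g _ _ 0 lect gcont.
  by rewrite ge_min le_max (ltW gneg) (ltW gpos) orbT.
move: uct; rewrite in_itv /= -ler_norml => uct.
have [Uw] := A2 (w u) (lt_le_trans (near_w u uct) rr2).
rewrite (phi0 _ Uw) -?gE// (phi0 x Ux sx0) subrr sub0r normrN {1}/w differential_lin.
move=> h; have {}h : `|t * differential phi x v + u * differential phi x n| <= c * t / 2.
  by apply: le_trans h _; rewrite -epsN; exact: ler_wpM2l (ltW eps0) _ _ (wN u uct).
rewrite -(ler_pM2l t0) -{1}(gtr0_norm t0) -normrM.
have -> : t * differential phi x v =
    t * differential phi x v + u * differential phi x n - u * differential phi x n.
  by rewrite addrK.
apply: le_trans (ler_normB _ _) _.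
rewrite [leRHS](_ : _ = c * t + c * t * `|differential phi x n|); last by ring.
apply: lerD; first by apply: le_trans h _; lra.
by rewrite normrM; apply: ler_wpM2r.
Qed.

Lemma level_set_partial U s phi x i k : open U -> smooth_on U s ->
  partial k s x != 0 -> smooth_on U phi -> U x -> s x = 0 ->
  (forall y, U y -> s y = 0 -> phi y = 0) ->
  partial i phi x = partial k phi x / partial k s x * partial i s x.
Proof.
move=> oU ss k0 sphi Ux sx0 phi0.
(* A vector annihilated by [ds], and a transversal one normalised to [ds n = 1]. The summand with
   coefficient zero only gives [n] the shape that [differential_lin] rewrites. *)
have := level_set_tangent (v := partial k s x *: e_ i + (- partial i s x) *: e_ k)
  (n := (partial k s x)^-1 *: e_ k + 0 *: e_ k) oU ss sphi Ux sx0 phi0.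
rewrite !differential_lin !differential_delta mulNr mulrC subrr mulVf// mul0r addr0.
move=> /(_ erefl erefl) /eqP; rewrite mulNr subr_eq0 => /eqP E.
by apply: (mulfI k0); rewrite E; field.
Qed.

(** Provides the Lagrange multiplier hypothesis [proportional]: both differentials are multiples of
    [ds]. *)
Lemma level_set_proportional U s phi psi x i j k : open U -> smooth_on U s ->
  partial k s x != 0 -> smooth_on U phi -> smooth_on U psi -> U x -> s x = 0 ->
  (forall y, U y -> s y = 0 -> phi y = 0) -> (forall y, U y -> s y = 0 -> psi y = 0) ->
  partial i phi x * partial j psi x = partial j phi x * partial i psi x.
Proof.
move=> oU ss k0 sphi spsi Ux sx0 phi0 psi0.
have Ep l := level_set_partial l oU ss k0 sphi Ux sx0 phi0.
have Eq l := level_set_partial l oU ss k0 spsi Ux sx0 psi0.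
rewrite (Ep i) (Eq j) [in RHS](Ep j) [in RHS](Eq i).
move: (partial k phi x / _) (partial k psi x / _) (partial i s x) (partial j s x).
by move=> a b p q; ring.
Qed.

End LevelSet.

(** * The polynomial approximation of the unit defining function *)

Section UnitField.
Context {R : realType} {d : nat}.
Local Notation E := 'rV[R]_d.
Implicit Types (U Z : set E) (G : E -> 'M[R]_d) (f s phi psi : E -> R) (x y : E)
  (i j : 'I_d) (a : seq 'I_d) (m : R) (n k : nat).

(** The constant demanded by [improve_step]. [unit_field] uses it only for [n.+1 < d], where the
    first factor, [2 (d - n.+1) / d], is nonzero. *)
Definition improve_coef n : R := ((2 - 2 / d%:R * n.+1%:R) * n.+2%:R)^-1.

Fixpoint unit_approx G f n : E -> R :=
  if n is n'.+1 then improve G (improve_coef n') (unit_approx G f n') else f.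

(* Newton's iteration for the inverse square root of |df|^2 *)
Fixpoint inverse_norm_approx G f m k : E -> R :=
  if k is k'.+1 then
    fun y => inverse_norm_approx G f m k' y
             * (3 - inner G f f y * inverse_norm_approx G f m k' y ^+ 2) / 2
  else fun=> m.

(* [3 * d] steps: each of the [d.-1] improvements costs two derivatives *)
Definition unit_field G f m : E -> R :=
  unit_approx G (fun y => f y * inverse_norm_approx G f m (3 * d) y) d.-1.

Lemma universal_improve c (Phi : field_functional) : universal Phi ->
  universal (fun G f m o => improve G c (Phi G f m o)).
Proof.
move=> uP; apply: (universal_mul uP); apply: universal_sub; first exact: universal_cst.
apply: universal_mul; first exact: universal_cst.
apply: universal_sub; last exact: universal_cst.
apply: universal_sub; first exact: universal_grad_inner.
apply: universal_mul; first exact: (universal_mul (universal_cst _) uP).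
apply: universal_add; first exact: universal_laplacian.
exact: (universal_mul universal_schouten_trace uP).
Qed.

(** The numbers of Newton steps and of improvements depend on [d] alone, so the jets involved have
    bounded order; [m] enters as a constant. *)
Lemma universal_unit_field : universal (fun G f m _ => unit_field G f m).
Proof.
have uN k : universal (fun G f m (_ : R) => inverse_norm_approx G f m k).
  elim: k => [|k IH]; first exact: universal_par.
  apply: universal_mul; last exact: universal_cst.
  apply: (universal_mul IH); apply: universal_sub; first exact: universal_cst.
  apply: universal_mul; last exact: universal_exp.
  exact: (universal_grad_inner universal_fun0 universal_fun0).
have u0 := universal_mul (universal_fun0 (R := R) (d := d)) (uN (3 * d)%N).
rewrite /unit_field; elim: d.-1 => [|n IH]; first exact: u0.
exact: universal_improve.
Qed.

Lemma smooth_unit_field U G f m : metric_on U G -> smooth_on U f ->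
  smooth_on U (unit_field G f m).
Proof.
move=> GU sf.
exact: (universal_smooth m 0 universal_unit_field (metric_regular GU sf)).
Qed.

Lemma I_squared_ext U G f g x : metric_on U G -> U x ->
  (forall y, U y -> f y = g y) -> I_squared G f x = I_squared G g x.
Proof.
move=> GU Ux fg; rewrite /I_squared !grad_sqnormE.
by rewrite (inner_ext GU Ux fg fg) (laplacian_ext GU Ux fg) fg.
Qed.

Lemma smooth_improve U G c f : metric_on U G -> smooth_on U f ->
  smooth_on U (improve G c f).
Proof.
move=> GU sf; have oU := metric_open GU.
have sI : smooth_on U (I_squared G f) := smooth_I_squared oU GU sf.
apply: (smoothM oU sf); apply: (smoothB oU (smooth_cst 1)).
exact: (smoothM oU (smooth_cst c) (smoothB oU sI (smooth_cst 1))).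
Qed.

Lemma smooth_unit_approx U G f n : metric_on U G -> smooth_on U f ->
  smooth_on U (unit_approx G f n).
Proof.
by move=> GU sf; elim: n => [|n IH]; [exact: sf|exact: (smooth_improve _ GU IH)].
Qed.

Section Natural.
Variables (W V : set E) (F : E -> E) (G H : E -> 'M[R]_d).
Hypotheses (GW : metric_on W G) (HV : metric_on V H) (sF : smooth_map_on W F)
  (FWV : forall x, W x -> V (F x))
  (GJ : forall x, W x -> G x = jacobian_mx F x *m H (F x) *m (jacobian_mx F x)^T).

Lemma I_squared_comp f x : W x -> smooth_on V f ->
  I_squared G (f \o F) x = I_squared H f (F x).
Proof.
move=> Wx sf; rewrite /I_squared !grad_sqnormE.
rewrite (inner_comp GW HV sF FWV GJ Wx sf sf) (laplacian_comp GW HV sF FWV GJ Wx sf).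
by rewrite (schouten_trace_comp GW HV sF FWV GJ Wx).
Qed.

Lemma improve_comp c g f x : W x -> smooth_on V f -> (forall y, W y -> g y = f (F y)) ->
  improve G c g x = improve H c f (F x).
Proof.
move=> Wx sf gf; rewrite /improve gf// (I_squared_ext (g := f \o F) GW Wx gf).
by rewrite I_squared_comp.
Qed.

Lemma unit_field_comp g f m x : W x -> smooth_on V f ->
  (forall y, W y -> g y = f (F y)) -> unit_field G g m x = unit_field H f m (F x).
Proof.
move=> Wx sf gf; have rV := metric_regular HV sf.
have oV := metric_open HV.
have gg y : W y -> inner G g g y = inner H f f (F y).
  move=> Wy; rewrite (inner_ext (f' := f \o F) (g' := f \o F) GW Wy gf gf).
  exact: (inner_comp GW HV sF FWV GJ Wy sf sf).
have EN k y : W y ->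
    inverse_norm_approx G g m k y = inverse_norm_approx H f m k (F y).
  by move=> Wy; elim: k => //= k ->; rewrite gg.
have sN k : smooth_on V (inverse_norm_approx H f m k).
  elim: k => [|k IH]; first exact: smooth_cst.
  apply: (smoothM oV _ (smooth_cst 2^-1)); apply: (smoothM oV IH).
  apply: (smoothB oV (smooth_cst 3)).
  exact: (smoothM oV (smooth_inner HV sf sf) (smoothX oV 2 IH)).
rewrite /unit_field; elim: d.-1 x Wx => [|n IH] x Wx; first by rewrite /= gf ?EN.
apply: (improve_comp _ Wx) => [|y Wy]; last exact: IH.
exact: (smooth_unit_approx _ HV (smoothM oV sf (sN _))).
Qed.

End Natural.

Section JetComparison.
Variables (U : set E) (Z : set E) (G : E -> 'M[R]_d).
Hypothesis GU : metric_on U G.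
Let oU : open U := metric_open GU.

Lemma vanish_partials n f g a x : smooth_on U f -> smooth_on U g ->
  vanish U Z n (fun y => f y - g y) -> (size a < n)%N -> U x -> Z x ->
  partials a f x = partials a g x.
Proof.
elim/last_ind: a n f g => [|a i IH] n f g sf sg v an Ux Zx.
  case: n v an => // n v _; apply/eqP; rewrite -subr_eq0; apply/eqP.
  exact: vanish_eq0 v Ux Zx.
case: n v an => // n v; rewrite size_rcons ltnS => an.
rewrite /partials !foldr_rcons.
apply: (IH n _ _ (smooth_on_partial i sf) (smooth_on_partial i sg) _ an Ux Zx).
apply: (vanish_ext oU _ (vanish_partial i v)) => y Uy.
by rewrite (partialB oU i Uy sf sg).
Qed.

Lemma vanish_I_squared n f g : smooth_on U f -> smooth_on U g ->
  vanish U Z n.+2 (fun y => f y - g y) ->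
  vanish U Z n (fun y => I_squared G f y - I_squared G g y).
Proof.
move=> sf sg v; set h := (fun y => f y - g y) in v; have sh := vanish_smooth v.
have sL g' : smooth_on U g' -> smooth_on U (laplacian G g') by exact: (smooth_laplacian GU).
have sJ := smooth_schouten_trace GU.
have v0 : vanish U Z n h := vanish_le (leqW (leqnSn n)) v.
have v1 := vanish_inner oU GU sf (vanish_le (leqnSn n.+1) v).
have v2 := vanish_inner oU GU sg (vanish_le (leqnSn n.+1) v).
have v3 := vanishMl oU sf (vanish_laplacian oU GU v).
have v4 := vanishMl oU (sL g sg) v0.
have v5 := vanishMl oU (smoothM oU sJ (smoothD oU sf sg)) v0.
have v6 := vanishZ oU (- (2 / d%:R)) (vanishD oU (vanishD oU v3 v4) v5).
apply: (vanish_ext oU _ (vanishD oU (vanishD oU v1 v2) v6)) => y Uy.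
have fE z : U z -> f z = g z + h z by move=> _; rewrite /h addrC subrK.
have If : I_squared G f y = inner G g g y + inner G g h y + (inner G f h y)
   - 2 / d%:R * f y * (laplacian G g y + laplacian G h y + schouten_trace G y * f y).
  rewrite /I_squared grad_sqnormE (laplacian_ext GU Uy fE) (laplacianD GU Uy sg sh).
  congr (_ - _); rewrite (inner_ext GU Uy (fun _ _ => erefl) fE).
  rewrite (innerDr G f Uy sg sh) (inner_sym GU f g Uy).
  by rewrite (inner_ext GU Uy (fun _ _ => erefl) fE) (innerDr G g Uy sg sh).
rewrite If /I_squared grad_sqnormE.
have -> : h y = f y - g y by [].
move: (laplacian G g y) (laplacian G h y) (schouten_trace G y) => t u b.
move: (inner G g g y) (inner G g h y) (inner G f h y) (f y) (g y) (2 / d%:R) => p q r c e k.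
by ring.
Qed.

Lemma vanish_unit_approx n k f g : smooth_on U f -> smooth_on U g ->
  vanish U Z (n + 2 * k) (fun y => f y - g y) ->
  [/\ smooth_on U (unit_approx G f k), smooth_on U (unit_approx G g k) &
      vanish U Z n (fun y => unit_approx G f k y - unit_approx G g k y)].
Proof.
move=> sf sg; elim: k n => [|k IH] n v.
  by rewrite muln0 addn0 in v; split; [exact: sf|exact: sg|exact: v].
rewrite mulnS addnA in v.
have [|sf' sg' v'] := IH (n + 2)%N; first exact: v.
rewrite addn2 in v'.
have sI g' : smooth_on U g' -> smooth_on U (I_squared G g').
  exact: (smooth_I_squared oU GU).
split; [exact: (smooth_unit_approx k.+1 GU sf)|exact: (smooth_unit_approx k.+1 GU sg)|].
rewrite /=.
have v0 := vanish_le (leqW (leqnSn n)) v'.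
have vI := vanish_I_squared sf' sg' v'.
set c := improve_coef k; set f1 := unit_approx G f k in sf' v' v0 vI *.
set g1 := unit_approx G g k in sg' v' v0 vI *.
have sc : smooth_on U (fun y => 1 - c * (I_squared G f1 y - 1)).
  apply: (smoothB oU (smooth_cst 1)).
  exact: (smoothM oU (smooth_cst _) (smoothB oU (sI _ sf') (smooth_cst 1))).
have v1 := vanishD oU (vanishMl oU sc v0)
  (vanishMl oU (smoothM oU (smooth_cst (- c)) sg') vI).
apply: (vanish_ext oU _ v1) => y _; rewrite /improve.
move: (I_squared G f1 y) (I_squared G g1 y) (f1 y) (g1 y) => p q r t.
by ring.
Qed.

End JetComparison.
Lemma inner_pos U G f x : metric_on U G -> U x -> dcol f x != 0 -> 0 < inner G f f x.
Proof.
move=> GU Ux f0; have Gu := metric_unit GU Ux; have [_ _ _ pos] := GU.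
have w0 : (dcol f x)^T *m invmx (G x) != 0.
  apply: contra_neq f0 => w0; apply: trmx_inj; rewrite linear0.
  by rewrite -(mulmxKV Gu (dcol f x)^T) w0 mul0mx.
have := pos x Ux _ w0; rewrite trmx_mul trmxK (invmx_sym GU Ux).
by rewrite mulmxKV// innerE mulmxA.
Qed.

Section LocalUnitField.
Variables (U : set E) (G : E -> 'M[R]_d) (s : E -> R).
Hypotheses (GU : metric_on U G) (ss : smooth_on U s) (d0 : (0 < d)%N)
  (ds0 : forall x, U x -> dcol s x != 0).
Let oU : open U := metric_open GU.
Let Z : set E := [set x | s x = 0].
Let y0 x : U x -> 0 < inner G s s x. Proof. by move=> Ux; exact: (inner_pos GU Ux (ds0 Ux)). Qed.

Definition inverse_norm (H : E -> 'M[R]_d) (f : E -> R) x : R :=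
  (Num.sqrt (inner H f f x))^-1.
Local Notation rho := (inverse_norm G s).

Lemma inverse_norm_gt0 x : U x -> 0 < rho x.
Proof. by move=> Ux; rewrite invr_gt0 sqrtr_gt0 y0. Qed.

Lemma inverse_norm_sq x : U x -> inner G s s x * rho x ^+ 2 = 1.
Proof.
move=> Ux; rewrite /inverse_norm exprVn sqr_sqrtr ?mulfV ?gt_eqF ?y0//.
exact: ltW (y0 Ux).
Qed.

Lemma smooth_inverse_norm : smooth_on U rho.
Proof.
apply: (smoothV oU) => [x Ux|]; first by rewrite gt_eqF// sqrtr_gt0 y0.
exact: (smooth_sqrt oU (smooth_inner GU ss ss) y0).
Qed.

(** The iteration started from [s / |ds|] itself, meaningful only where [ds] is nonzero. It links
    [unit_field], with which it agrees to high order at one point, to genuine unit defining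
    functions, with which it agrees along the zero set. *)
Definition local_unit_field (H : E -> 'M[R]_d) (f : E -> R) : E -> R :=
  unit_approx H (fun y => f y * inverse_norm H f y) d.-1.

(** The initial constant is right at [x], giving order one. Newton's error is the square of the
    previous one times a smooth factor; of this only a gain of one order per step is used. *)
Lemma inverse_norm_approx_jet x k : U x ->
  vanish U [set x] k.+1 (fun y => inverse_norm_approx G s (rho x) k y - rho y).
Proof.
move=> Ux; have sr := smooth_inverse_norm; have sy := smooth_inner GU ss ss.
elim: k => [|k IH].
  apply: vanish1; first exact: (smoothB oU (smooth_cst _) sr).
  by move=> z _ ->; rewrite /= subrr.
set D := (fun y => _ - _) in IH; have sD := vanish_smooth IH.
have v2 : vanish U [set x] k.+2 (fun y => D y * D y).
  by apply: vanish_le (vanishM oU IH IH); rewrite addSn addnS !ltnS leq_addr.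
have sc : smooth_on U (fun y => - (3 / 2) * (inner G s s y * rho y)
    - 2^-1 * (inner G s s y * D y)).
  apply: (smoothB oU); apply: (smoothM oU (smooth_cst _)).
    exact: (smoothM oU sy sr).
  exact: (smoothM oU sy sD).
apply: (vanish_ext oU _ (vanishMl oU sc v2)) => y Uy.
have rE := inverse_norm_sq Uy.
have -> : inverse_norm_approx G s (rho x) k.+1 y =
    (D y + rho y) * (3 - inner G s s y * (D y + rho y) ^+ 2) / 2.
  by rewrite /D subrK.
move: (D y) (rho y) (inner G s s y) rE => e r c rE.
transitivity ((- (3 / 2) * (c * r) - 2^-1 * (c * e)) * (e * e)
  + ((e + r) * (3 - c * r ^+ 2) / 2 - r - c * r ^+ 2 * e)); last by field.
by rewrite rE; field.
Qed.

Lemma smooth_local_unit_field : smooth_on U (local_unit_field G s).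
Proof. exact: (smooth_unit_approx _ GU (smoothM oU ss smooth_inverse_norm)). Qed.

Lemma unit_field_local_jet x : U x ->
  vanish U [set x] d.+1 (fun y => unit_field G s (rho x) y - local_unit_field G s y).
Proof.
move=> Ux; have sr := smooth_inverse_norm.
have v : vanish U [set x] (d.+1 + 2 * d.-1)
    (fun y => s y * inverse_norm_approx G s (rho x) (3 * d) y - s y * rho y).
  apply: (vanish_ext oU _ (vanishMl oU ss
    (vanish_le _ (inverse_norm_approx_jet (3 * d) Ux)))).
    by move=> y _; rewrite mulrBr.
  (* The [3 * d] Newton steps yield order [3 * d + 1], while [d.+1 + 2 * d.-1 = 3 * d - 1] is
     required. *)
  by move: d0; case: (d) => // n _; rewrite /= !mulnS; lia.
have sa : smooth_on U (fun y => s y * inverse_norm_approx G s (rho x) (3 * d) y).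
  have := smoothD oU (vanish_smooth v) (smoothM oU ss sr).
  by apply: (smooth_on_ext oU) => y _; rewrite subrK.
by have [_ _] := vanish_unit_approx GU sa (smoothM oU ss sr) v.
Qed.

Let proportional phi psi x i j : vanish U Z 1 phi -> vanish U Z 1 psi -> U x -> Z x ->
  partial i phi x * partial j psi x = partial j phi x * partial i psi x.
Proof.
move=> v w Ux Zx; have /cV0Pn[k k0] := ds0 Ux; rewrite mxE in k0.
by apply: (level_set_proportional i j oU ss k0 (vanish_smooth v) (vanish_smooth w) Ux Zx)
  => y Uy sy; [exact: vanish_eq0 v Uy sy|exact: vanish_eq0 w Uy sy].
Qed.

Lemma local_unit_fieldP :
  [/\ vanish U Z 1 (local_unit_field G s),
      vanish U Z d (fun x => I_squared G (local_unit_field G s) x - 1) &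
      forall x i, U x -> Z x ->
        partial i (local_unit_field G s) x = rho x * partial i s x].
Proof.
have sr := smooth_inverse_norm; pose f y := s y * rho y.
have sf : smooth_on U f := smoothM oU ss sr.
have vf : vanish U Z 1 f by apply: (vanish1 sf) => x Ux Zx; rewrite /f Zx mul0r.
have df x i : U x -> Z x -> partial i f x = rho x * partial i s x.
  by move=> Ux Zx; rewrite (partialM i Ux ss sr) Zx mul0r add0r mulrC.
have vI : vanish U Z 1 (fun x => I_squared G f x - 1).
  apply: vanish1.
    exact: (smoothB oU (smooth_I_squared oU GU sf) (smooth_cst 1)).
  move=> x Ux Zx; rewrite /I_squared grad_sqnormE (vanish_eq0 vf Ux Zx) mulr0 mul0r subr0.
  apply/eqP; rewrite subr_eq0; apply/eqP; rewrite -(inverse_norm_sq Ux).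
  rewrite /inner mulr_suml; apply: eq_bigr => a _; rewrite mulr_suml.
  apply: eq_bigr => b _; rewrite (df x a Ux Zx) (df x b Ux Zx).
  move: (invmx (G x) a b) (partial a s x) (partial b s x) (rho x) => c p q r.
  by ring.
(* After [n] improvements the error has order [n.+1]. The last clause records that corrections start
   at order two, so the differential on [Z] remains that of [s / |ds|]. *)
suff H n : (n < d)%N -> [/\ vanish U Z 1 (unit_approx G f n),
    vanish U Z n.+1 (fun x => I_squared G (unit_approx G f n) x - 1) &
    vanish U Z 2 (fun x => unit_approx G f n x - f x)].
  have [|v1 v2 v3] := H d.-1; first by rewrite prednK.
  split; [exact: v1|by apply: vanish_le v2; rewrite prednK|] => x i Ux Zx.
  rewrite -(df x i Ux Zx).
  exact: (vanish_partials GU (a := [:: i]) (vanish_smooth v1) sf v3 isT Ux Zx).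
elim: n => [_|n IH nd].
  split; [exact: vf|exact: vI|].
  by apply: (vanish_ext oU _ (vanish_zero Z oU 2)) => y _; rewrite subrr.
have [v1 v2 v3] := IH (ltnW nd).
have [|w1 w2] := improve_step oU GU proportional (c := improve_coef n) v1 v2.
  rewrite /improve_coef mulVf// mulf_neq0 ?pnatr_eq0//.
  have dR : d%:R != 0 :> R by rewrite pnatr_eq0 -lt0n.
  have -> : 2 - 2 / d%:R * n.+1%:R = 2 * (d%:R - n.+1%:R) / d%:R :> R by field.
  rewrite mulf_neq0 ?invr_eq0// mulf_neq0 ?pnatr_eq0//.
  by rewrite subr_eq0 eqr_nat gtn_eqF.
have w1' : vanish U Z 2 (fun x => improve G (improve_coef n) (unit_approx G f n) x
    - unit_approx G f n x) by apply: vanish_le w1.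
split.
- have := vanishD oU (vanish_le (leqnSn 1) w1') v1.
  by apply: (vanish_ext oU) => y _; rewrite subrK.
- exact: w2.
- have := vanishD oU w1' v3; apply: (vanish_ext oU) => y _.
  by rewrite addrA subrK.
Qed.

Lemma local_unit_field_unique f : vanish U Z 1 f ->
  vanish U Z d (fun x => I_squared G f x - 1) ->
  (forall x, U x -> Z x -> exists2 l : R, 0 < l & dcol f x = l *: dcol s x) ->
  vanish U Z d.+1 (fun x => f x - local_unit_field G s x).
Proof.
move=> vf vI df; have [v1 v2 v3] := local_unit_fieldP.
apply: (normalised_unique oU GU proportional v1 vf d0 v2 vI) => x i Ux Zx.
have [l l0 dfx] := df x Ux Zx.
have dfi (k : 'I_d) : partial k f x = l * partial k s x.
  by have /colP/(_ k) := dfx; rewrite !mxE.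
rewrite v3// dfi; congr (_ * _).
(* [|df| = 1] on [Z] determines [l] up to sign, and its positivity then gives [l = 1 / |ds|]. *)
have n1 : l ^+ 2 * inner G s s x = 1.
  have nf := vanish_inner_normalised oU GU vf (vanish_le d0 vI).
  transitivity (inner G f f x).
    rewrite /inner mulr_sumr; apply: eq_bigr => a _; rewrite mulr_sumr.
    apply: eq_bigr => b _; rewrite !dfi.
    move: (invmx (G x) a b) (partial a s x) (partial b s x) => c p q.
    by ring.
  by apply/eqP; rewrite -subr_eq0; apply/eqP; exact: vanish_eq0 nf Ux Zx.
have r0 := inverse_norm_gt0 Ux.
apply/eqP; rewrite -(eqrXn2 (ltn0Sn 1)) ?ltW//; apply/eqP.
apply: (mulIf (lt0r_neq0 (y0 Ux))).
by rewrite n1 mulrC inverse_norm_sq.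
Qed.

End LocalUnitField.
End UnitField.

(** * Dependence of the jet on the defining function and on the metric *)

Section JetsOfUnitFields.
Context {R : realType} {d : nat}.
Local Notation E := 'rV[R]_d.
Implicit Types (U Z : set E) (G H : E -> 'M[R]_d) (f s phi psi : E -> R) (x y : E)
  (i j : 'I_d) (a : seq 'I_d) (m : R) (n k : nat).

Lemma open_nonzero U f : open U -> smooth_on U f -> open [set x | U x /\ f x != 0].
Proof.
move=> oU sf; rewrite openE => x [Ux fx0].
have [cf _] := smooth_onC1 sf Ux.
have n1 : \forall y \near x, U y by exact: open_nbhs_nbhs.
have n2 : \forall y \near x, f y != 0 by exact: (cvgr_neq0 _ cf fx0).
by apply: filterS2 n1 n2 => y Uy fy; split.
Qed.

Lemma metric_onS U V G : open V -> V `<=` U -> metric_on U G -> metric_on V G.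
Proof.
move=> oV VU [oU sG symG pos]; split.
- exact: oV.
- by move=> i j; exact: smooth_onS VU (sG i j).
- by move=> x /VU; exact: symG.
- by move=> x /VU; exact: pos.
Qed.

Lemma vanish_sub U Z Z' n phi : (forall x, U x -> Z x -> Z' x) ->
  vanish U Z' n phi -> vanish U Z n phi.
Proof.
move=> ZZ'; elim: n phi => [|n IH] phi; first by [].
move=> [s [z p]]; apply: (vanishS s) => [x Ux Zx|i]; first exact: z Ux (ZZ' x Ux Zx).
exact: IH (p i).
Qed.

Lemma vanishX U Z n f : open U -> vanish U Z 1 f -> vanish U Z n (fun x => f x ^+ n).
Proof.
move=> oU vf; elim: n => [|n IH]; first exact: (vanish0 Z (smooth_cst 1)).
by apply: (vanish_ext oU _ (vanishM oU vf IH)) => y _; rewrite exprS.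
Qed.

(** A defining function may have critical points away from its zeros; the comparisons take place on
    this smaller open set, which contains every zero of [s] at which [ds] is nonzero. *)
Lemma open_regular U G s : metric_on U G -> smooth_on U s ->
  let V := [set x | U x /\ inner G s s x != 0] in
  [/\ open V, V `<=` U & forall x, V x -> dcol s x != 0].
Proof.
move=> GU ss V; have oU := metric_open GU; split.
- exact: (open_nonzero oU (smooth_inner GU ss ss)).
- by move=> x [].
- move=> x [Ux]; apply: contra_neq => s0.
  by rewrite innerE s0 mulmx0 mxE.
Qed.

Lemma unit_field_jet U G s f x : metric_on U G -> smooth_on U s -> (0 < d)%N ->
  (forall y, U y -> dcol s y != 0) ->
  let Z := [set y | s y = 0] in
  vanish U Z 1 f -> vanish U Z d (fun y => I_squared G f y - 1) ->
  (forall y, U y -> Z y -> exists2 l : R, 0 < l & dcol f y = l *: dcol s y) ->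
  U x -> Z x -> forall a, (size a <= d)%N ->
  partials a f x = partials a (unit_field G s (inverse_norm G s x)) x.
Proof.
move=> GU ss d0 ds0 Z vf vI df Ux Zx a ad.
have sf := vanish_smooth vf; have sS := smooth_local_unit_field GU ss ds0.
transitivity (partials a (local_unit_field G s) x).
  exact: (vanish_partials GU sf sS (local_unit_field_unique GU ss d0 ds0 vf vI df) ad Ux Zx).
have su := smooth_unit_field (inverse_norm G s x) GU ss.
apply/esym; exact: (vanish_partials GU su sS (unit_field_local_jet GU ss d0 ds0 Ux) ad Ux erefl).
Qed.

(** The local unit field of [s'] also qualifies as [f] for [s]: on the common zero set its
    differential is a positive multiple of [ds'], hence of [ds]. *)
Lemma unit_field_independent U G s s' x : metric_on U G -> smooth_on U s ->
  smooth_on U s' -> (0 < d)%N -> (forall y, U y -> s y = 0 <-> s' y = 0) ->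
  (forall y, U y -> s y = 0 -> dcol s y != 0) ->
  (forall y, U y -> s y = 0 -> exists2 l : R, 0 < l & dcol s' y = l *: dcol s y) ->
  U x -> s x = 0 -> forall a, (size a <= d)%N ->
  partials a (unit_field G s' (inverse_norm G s' x)) x =
  partials a (unit_field G s (inverse_norm G s x)) x.
Proof.
move=> GU0 ss0 ss0' d0 zz ds dl U0x sx a ad.
have [oV VU dV] := open_regular GU0 ss0; have [oV' VU' dV'] := open_regular GU0 ss0'.
set V := [set y | _] in oV VU dV; set V' := [set y | _] in oV' VU' dV'.
pose W := V `&` V'; have oW : open W := openI oV oV'.
have WU : W `<=` U by move=> y [/VU].
have GW := metric_onS oW WU GU0.
have sW := smooth_onS WU ss0; have sW' := smooth_onS WU ss0'.
have dsW y : W y -> dcol s y != 0 by move=> [/dV].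
have dsW' y : W y -> dcol s' y != 0 by move=> [_ /dV'].
have Wx : W x.
  have ds' : dcol s' x != 0.
    have [l l0 ->] := dl x U0x sx.
    by rewrite scaler_eq0 negb_or gt_eqF//= ds.
  split; split=> //; rewrite gt_eqF//; apply: (inner_pos GU0 U0x) => //.
  exact: ds.
pose f := local_unit_field G s'.
have [v1 v2 v3] := local_unit_fieldP GW sW' d0 dsW'.
have ZZ y : W y -> [set y | s y = 0] y -> [set y | s' y = 0] y.
  by move=> Wy /(zz y (WU y Wy)).
have sf := smooth_local_unit_field GW sW' dsW'.
have su := smooth_unit_field (inverse_norm G s' x) GW sW'.
transitivity (partials a f x).
  exact: (vanish_partials GW su sf (unit_field_local_jet GW sW' d0 dsW' Wx) ad Wx erefl).
apply: (unit_field_jet GW sW d0 dsW (vanish_sub ZZ v1) (vanish_sub ZZ v2) _ Wx sx ad).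
move=> y Wy Zy; have [l l0 dl'] := dl y (WU y Wy) Zy.
exists (inverse_norm G s' y * l); first by rewrite mulr_gt0// (inverse_norm_gt0 GW dsW').
apply/colP => i; rewrite [LHS]mxE (v3 y i Wy (ZZ y Wy Zy)) -scalerA -dl'.
by rewrite [RHS]mxE [in RHS]mxE.
Qed.

(** By invariance of [I_squared], [Om] times the local unit field of [G] solves the same equation
    for [H], and its differential on the zero set keeps the direction of [ds]; uniqueness for [H]
    concludes. *)
Lemma unit_field_conformal U G H Om s x : metric_on U G -> smooth_on U Om ->
  (forall y, U y -> 0 < Om y) -> (forall y, U y -> H y = Om y ^+ 2 *: G y) ->
  smooth_on U s -> (1 < d)%N ->
  (forall y, U y -> s y = 0 -> dcol s y != 0) ->
  U x -> s x = 0 -> forall a, (size a <= d)%N ->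
  partials a (fun y => Om y * unit_field G s (inverse_norm G s x) y) x =
  partials a (unit_field H s (inverse_norm H s x)) x.
Proof.
move=> GU0 sO0 Om0 HG0 ss0 d1 ds U0x sx a ad; have d0 := ltnW d1.
have [oV VU dV] := open_regular GU0 ss0; set V := [set y | _] in oV VU dV.
have GV := metric_onS oV VU GU0; have sV := smooth_onS VU ss0; have sO := smooth_onS VU sO0.
have OmV y : V y -> 0 < Om y by move=> /VU; exact: Om0.
have HGV y : V y -> H y = Om y ^+ 2 *: G y by move=> /VU; exact: HG0.
have HV := metric_on_rescaling GV sO OmV HGV.
have Vx : V x by split=> //; rewrite gt_eqF//; exact: (inner_pos GU0 U0x (ds x U0x sx)).
have [v1 v2 v3] := local_unit_fieldP GV sV d0 dV.
have sS := smooth_local_unit_field GV sV dV.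
have su := smooth_unit_field (inverse_norm G s x) GV sV.
set S := local_unit_field G s in v1 v2 v3 sS.
transitivity (partials a (fun y => Om y * S y) x).
  have v : vanish V [set x] d.+1
      (fun y => Om y * unit_field G s (inverse_norm G s x) y - Om y * S y).
    apply: (vanish_ext oV _ (vanishMl oV sO (unit_field_local_jet GV sV d0 dV Vx))).
    by move=> y _; rewrite mulrBr.
  exact: (vanish_partials GV (smoothM oV sO su) (smoothM oV sO sS) v ad Vx erefl).
apply: (unit_field_jet HV sV d0 dV (vanishMl oV sO v1) _ _ Vx sx ad).
  apply: (vanish_ext oV _ v2) => y Vy.
  rewrite (I_squared_rescaling GV sO OmV HGV Vy _ _ sS)//.
    by rewrite (eqr_nat R d 1) gtn_eqF.
  by rewrite pnatr_eq0 -lt0n.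
move=> y Vy Zy; exists (Om y * inverse_norm G s y).
  by rewrite mulr_gt0 ?OmV// (inverse_norm_gt0 GV dV).
apply/colP => i; rewrite [LHS]mxE [RHS]mxE (partialM i Vy sO sS) (v3 y i Vy Zy).
rewrite (vanish_eq0 v1 Vy Zy) mulr0 addr0 mulrA.
by congr (_ * _); rewrite mxE.
Qed.

Lemma unit_density_jet U G s f B x : metric_on U G -> smooth_on U s -> smooth_on U f ->
  smooth_on U B -> (0 < d)%N ->
  (forall y, U y -> s y = 0 -> dcol s y != 0) ->
  (forall y, U y -> s y = 0 -> f y = 0) ->
  (forall y, U y -> s y = 0 -> exists2 l : R, 0 < l & dcol f y = l *: dcol s y) ->
  (forall y, U y -> I_squared G f y = 1 + f y ^+ d * B y) ->
  U x -> s x = 0 -> forall a, (size a <= d)%N ->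
  partials a f x = partials a (unit_field G s (inverse_norm G s x)) x.
Proof.
move=> GU0 ss0 sf0 sB0 d0 ds f0 df I1 U0x sx a ad.
have [oV VU dV] := open_regular GU0 ss0; set V := [set y | _] in oV VU dV.
have GV := metric_onS oV VU GU0; have sV := smooth_onS VU ss0.
have sf := smooth_onS VU sf0; have sB := smooth_onS VU sB0.
have Vx : V x by split=> //; rewrite gt_eqF//; exact: (inner_pos GU0 U0x (ds x U0x sx)).
have vf : vanish V [set y | s y = 0] 1 f.
  by apply: (vanish1 sf) => y /VU Uy; exact: f0.
apply: (unit_field_jet GV sV d0 dV vf _ _ Vx sx ad).
  apply: (vanish_ext oV _ (vanishMl oV sB (vanishX d oV vf))) => y /VU Uy.
  by rewrite I1// addrAC subrr add0r mulrC.
by move=> y /VU Uy; exact: df.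
Qed.

End JetsOfUnitFields.

(** * Manifolds *)

Section ManifoldUnitField.
Context {R : realType} {d : nat}.
Local Notation E := 'rV[R]_d.
Implicit Types (M N : omanifold R d) (m : R) (a : seq 'I_d).

Definition local_rep M (c : chart R d M) (s : M -> R) : E -> R := fun x => s (bwd c x).

Lemma chart_open M (c : chart R d M) : atlas c -> open (dom c) /\ open (img c).
Proof. by move=> /atlas_chart[]. Qed.

Lemma chart_bwdK M (c : chart R d M) q : atlas c -> dom c q -> bwd c (fwd c q) = q.
Proof. by move=> /atlas_chart[_ + _ _]; exact. Qed.

Lemma img_fwd M (c : chart R d M) q : dom c q -> img c (fwd c q).
Proof. by move=> cq; exists q. Qed.

Lemma metric_on_img M (g : metric M) c : atlas c -> metric_on (img c) (g c).
Proof.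
move=> ac; have [_ oi] := chart_open ac; split.
- exact: oi.
- by move=> i j; exact: Defs.metric_smooth.
- by move=> x ix; exact: Defs.metric_sym.
- by move=> x ix v; exact: Defs.metric_pos.
Qed.

Lemma coords_dom_open M N (phi : M -> N) (c : chart R d M) (c' : chart R d N) :
  atlas c -> atlas c' -> continuous phi -> open (coords_dom phi c c').
Proof.
move=> ac ac' cphi; have [oc oi] := chart_open ac; have [oc' _] := chart_open ac'.
have [_ bK _ cb] := atlas_chart ac.
have oO : open (dom c `&` phi @^-1` dom c').
  by apply: openI => //; move/continuousP : cphi; exact.
have -> : coords_dom phi c c' = img c `&` bwd c @^-1` (dom c `&` phi @^-1` dom c').
  apply/seteqP; split=> [x [q [cq c'q] <-]|x [[q cq <-]]].
    by split; [exists q|rewrite /preimage /= bK].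
  by rewrite /preimage /= bK// => -[_ c'q]; exists q.
rewrite openE => x [ix bx].
have cbx : {for x, continuous (bwd c)}.
  by move: cb; rewrite continuous_open_subspace// => /(_ x); apply; rewrite inE.
apply: filterI; first exact: open_nbhs_nbhs.
by apply: cbx; exact: open_nbhs_nbhs.
Qed.

Section Transport.
Variables (M N : omanifold R d) (phi : M -> N) (g : metric M) (h : metric N)
  (c : chart R d M) (c' : chart R d N).
Hypotheses (ac : atlas c) (ac' : atlas c') (cphi : continuous phi)
  (sphi : smooth_map_on (coords_dom phi c c') (in_coords phi c c'))
  (pull : forall q, dom c q -> dom c' (phi q) ->
    g c (fwd c q) = jac phi c c' q *m h c' (fwd c' (phi q)) *m (jac phi c c' q)^T).

Let W := coords_dom phi c c'.
Let F := in_coords phi c c'.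
Let oW : open W := coords_dom_open ac ac' cphi.

Let GW : metric_on W (g c).
Proof.
apply: (metric_onS oW _ (metric_on_img g ac)) => x [q [cq _] <-].
exact: img_fwd.
Qed.

Let FWV x : W x -> img c' (F x).
Proof. by move=> [q [cq c'q] <-]; exists (phi q) => //; rewrite /F /in_coords chart_bwdK. Qed.

Let GJ x : W x -> g c x = jacobian_mx F x *m h c' (F x) *m (jacobian_mx F x)^T.
Proof.
move=> Wx; have [q [cq c'q] qx] := Wx.
have -> : jacobian_mx F x = jac phi c c' q.
  apply/matrixP => i j; rewrite mxE /jac qx.
  by rewrite (jacobianE i j oW Wx sphi).
by rewrite -qx /F /in_coords (chart_bwdK ac cq) pull.
Qed.

Let sF (s : N -> R) y : W y -> local_rep c (fun q => s (phi q)) y = local_rep c' s (F y).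
Proof.
move=> [q [cq c'q] <-]; rewrite /local_rep /F /in_coords (chart_bwdK ac cq).
by rewrite (chart_bwdK ac' c'q).
Qed.

Let W_fwd p : dom c p -> dom c' (phi p) -> W (fwd c p).
Proof. by move=> cp c'p; exists p. Qed.

Let F_fwd p : dom c p -> F (fwd c p) = fwd c' (phi p).
Proof. by move=> cp; rewrite /F /in_coords (chart_bwdK ac cp). Qed.

(** Formulated for one pair of charts and a map [phi]: the identity map gives independence of the
    chart, a diffeomorphism gives naturality. *)
Lemma unit_field_transport (s : N -> R) m p : smooth_fun s -> dom c p -> dom c' (phi p) ->
  unit_field (g c) (local_rep c (fun q => s (phi q))) m (fwd c p) =
  unit_field (h c') (local_rep c' s) m (fwd c' (phi p)).
Proof.
move=> ss cp c'p; rewrite -(F_fwd cp).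
exact: (unit_field_comp GW (metric_on_img h ac') sphi FWV GJ m (W_fwd cp c'p)
  (ss c' ac') (sF s)).
Qed.

Lemma inverse_norm_transport (s : N -> R) p : smooth_fun s -> dom c p -> dom c' (phi p) ->
  inverse_norm (g c) (local_rep c (fun q => s (phi q))) (fwd c p) =
  inverse_norm (h c') (local_rep c' s) (fwd c' (phi p)).
Proof.
move=> ss cp c'p; have Wp := W_fwd cp c'p; rewrite /inverse_norm.
rewrite (inner_ext GW Wp (sF s) (sF s)) -(F_fwd cp).
by rewrite (inner_comp GW (metric_on_img h ac') sphi FWV GJ Wp (ss c' ac') (ss c' ac')).
Qed.

End Transport.

Definition chart_at M (p : M) : chart R d M := sval (cid2 (atlas_cover p)).

Lemma chart_at_atlas M (p : M) : atlas (chart_at p).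
Proof. by rewrite /chart_at; case: cid2. Qed.

Lemma chart_at_dom M (p : M) : dom (chart_at p) p.
Proof. by rewrite /chart_at; case: cid2. Qed.

(** The chart is chosen separately at every point, which is harmless for smooth [s] by
    [mfd_unit_fieldE]; [m] stays the same number as [p] varies, as smoothness requires. *)
Definition mfd_unit_field M (g : metric M) (s : M -> R) m (p : M) : R :=
  unit_field (g (chart_at p)) (local_rep (chart_at p) s) m (fwd (chart_at p) p).

Definition mfd_inverse_norm M (g : metric M) (s : M -> R) (p : M) : R :=
  inverse_norm (g (chart_at p)) (local_rep (chart_at p) s) (fwd (chart_at p) p).

Section ChartIndependence.
Variables (M : omanifold R d) (g : metric M) (s : M -> R).
Hypothesis ss : smooth_fun s.

Let compat (c c' : chart R d M) : atlas c -> atlas c' ->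
  smooth_map_on (coords_dom id c c') (in_coords id c c').
Proof. by move=> ac ac'; have [] := atlas_compatible ac ac'. Qed.

Let cont_id : continuous (id : M -> M). Proof. by move=> x; exact: cvg_id. Qed.

Lemma mfd_unit_fieldE m c p : atlas c -> dom c p ->
  mfd_unit_field g s m p = unit_field (g c) (local_rep c s) m (fwd c p).
Proof.
move=> ac cp; have [ac' cp'] := (chart_at_atlas p, chart_at_dom p).
exact: (unit_field_transport ac' ac cont_id (compat ac' ac)
  (fun q => metric_tensorial g ac' ac) m ss cp' cp).
Qed.

Lemma mfd_inverse_normE c p : atlas c -> dom c p ->
  mfd_inverse_norm g s p = inverse_norm (g c) (local_rep c s) (fwd c p).
Proof.
move=> ac cp; have [ac' cp'] := (chart_at_atlas p, chart_at_dom p).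
exact: (inverse_norm_transport ac' ac cont_id (compat ac' ac)
  (fun q => metric_tensorial g ac' ac) ss cp' cp).
Qed.

Lemma mfd_unit_field_rep m c x : atlas c -> img c x ->
  local_rep c (mfd_unit_field g s m) x = unit_field (g c) (local_rep c s) m x.
Proof.
move=> ac [q cq <-]; rewrite /local_rep (chart_bwdK ac cq).
exact: mfd_unit_fieldE.
Qed.

Lemma smooth_mfd_unit_field m : smooth_fun (mfd_unit_field g s m).
Proof.
move=> c ac; have [_ oi] := chart_open ac.
apply: (smooth_on_ext oi _ (smooth_unit_field m (metric_on_img g ac) (ss ac))).
by move=> y iy; rewrite -mfd_unit_field_rep.
Qed.

Lemma mfd_unit_field_partials m c p a : atlas c -> dom c p ->
  partials a (local_rep c (mfd_unit_field g s m)) (fwd c p) =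
  partials a (unit_field (g c) (local_rep c s) m) (fwd c p).
Proof.
move=> ac cp; have [_ oi] := chart_open ac.
apply: (partials_ext a oi _ (img_fwd cp)) => y iy.
exact: mfd_unit_field_rep.
Qed.

End ChartIndependence.

Lemma mfd_unit_field_natural M N (phi : M -> N) (g : metric M) (h : metric N)
    (s : N -> R) m p : smooth_fun s -> smooth_mfd_map phi -> is_pullback phi h g ->
  mfd_unit_field g (fun q => s (phi q)) m p = mfd_unit_field h s m (phi p).
Proof.
move=> ss [cphi sphi] pull.
have [ac cp] := (chart_at_atlas p, chart_at_dom p).
have [ac' cp'] := (chart_at_atlas (phi p), chart_at_dom (phi p)).
exact: (unit_field_transport ac ac' cphi (sphi _ _ ac ac')
  (fun q => pull _ _ q ac ac') m ss cp cp').
Qed.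

Lemma mfd_inverse_norm_natural M N (phi : M -> N) (g : metric M) (h : metric N)
    (s : N -> R) p : smooth_fun s -> smooth_mfd_map phi -> is_pullback phi h g ->
  mfd_inverse_norm g (fun q => s (phi q)) p = mfd_inverse_norm h s (phi p).
Proof.
move=> ss [cphi sphi] pull.
have [ac cp] := (chart_at_atlas p, chart_at_dom p).
have [ac' cp'] := (chart_at_atlas (phi p), chart_at_dom (phi p)).
exact: (inverse_norm_transport ac ac' cphi (sphi _ _ ac ac')
  (fun q => pull _ _ q ac ac') ss cp cp').
Qed.

Lemma chart_gradientE M (c : chart R d M) (s : M -> R) p :
  chart_gradient c s p = (dcol (local_rep c s) (fwd c p))^T.
Proof. by apply/rowP => i; rewrite !mxE. Qed.

(** * Defining functions read in charts *)

Section Hypersurface.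
Variables (M : omanifold R d) (Sigma : set M) (s : M -> R).
Hypothesis Ds : defining_function Sigma s.

Lemma defining_smooth : smooth_fun s. Proof. by case: Ds. Qed.

Lemma defining_rep_zero c x : atlas c -> img c x -> local_rep c s x = 0 ->
  exists q, [/\ dom c q, Sigma q & x = fwd c q].
Proof.
move=> ac [q cq <-]; rewrite /local_rep (chart_bwdK ac cq) => s0.
by exists q; split=> //; have [_ -> _] := Ds.
Qed.

Lemma defining_rep0 c q : atlas c -> dom c q -> Sigma q -> local_rep c s (fwd c q) = 0.
Proof.
by move=> ac cq Sq; rewrite /local_rep (chart_bwdK ac cq); have [_ S _] := Ds; rewrite S in Sq.
Qed.

Lemma defining_dcol c x : atlas c -> img c x -> local_rep c s x = 0 ->
  dcol (local_rep c s) x != 0.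
Proof.
move=> ac ix /(defining_rep_zero ac ix)[q [cq Sq ->]].
have [_ _ /(_ c q ac cq Sq)] := Ds; rewrite chart_gradientE.
by apply: contra_neq => ->; rewrite linear0.
Qed.

End Hypersurface.

Lemma oriented_dcol M (Sigma : set M) (s s' : M -> R) c x :
  defining_function Sigma s -> compatibly_oriented Sigma s s' ->
  atlas c -> img c x -> local_rep c s x = 0 ->
  exists2 l : R, 0 < l & dcol (local_rep c s') x = l *: dcol (local_rep c s) x.
Proof.
move=> Ds os ac ix /(defining_rep_zero Ds ac ix)[q [cq Sq ->]].
have [l l0] := os c q ac cq Sq; rewrite !chart_gradientE => E.
by exists l => //; apply: trmx_inj; rewrite E linearZ.
Qed.

Lemma defining_same_zeros M (Sigma : set M) (s s' : M -> R) c x :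
  defining_function Sigma s -> defining_function Sigma s' -> atlas c -> img c x ->
  local_rep c s x = 0 -> local_rep c s' x = 0.
Proof.
move=> Ds Ds' ac ix /(defining_rep_zero Ds ac ix)[q [cq Sq ->]].
exact: (defining_rep0 Ds' ac cq Sq).
Qed.

End ManifoldUnitField.

(** * The hypersurface invariant *)

Section HypersurfaceInvariant.
Context {R : realType} {d : nat}.
Local Notation E := 'rV[R]_d.
Implicit Types (M N : omanifold R d) (P : scalar_assignment R d) (w m : R).

(** The function handed to [P] changes with the point of evaluation, through [m]. At a critical
    point of [s] the convention for inverses makes [m] zero, so the value is still defined. *)
Definition hypersurface_restriction P : scalar_assignment R d :=
  fun M g s p => P M g (mfd_unit_field g s (mfd_inverse_norm g s p)) p.

Lemma same_jet_mfd_unit_field M (g : metric M) (s f : M -> R) p : smooth_fun s ->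
  (forall c, atlas c -> dom c p -> forall a : seq 'I_d, (size a <= d)%N ->
    partials a (local_rep c f) (fwd c p) =
    partials a (unit_field (g c) (local_rep c s)
      (inverse_norm (g c) (local_rep c s) (fwd c p))) (fwd c p)) ->
  same_jet d f (mfd_unit_field g s (mfd_inverse_norm g s p)) p.
Proof.
move=> ss fE c ac cp a ad; rewrite (mfd_inverse_normE g ss ac cp).
have := mfd_unit_field_partials g ss (inverse_norm (g c) (local_rep c s) (fwd c p)) a ac cp.
by rewrite /local_rep => ->; exact: fE.
Qed.

(** The number [m] is itself natural. Once it is fixed, naturality of [P] is applied to a single
    smooth function on [N], whose pull-back is the unit field of the pulled-back data. *)
Lemma hypersurface_restriction_natural P :
  natural_on (@smooth_fun R d) P -> natural_on (@is_defining R d) (hypersurface_restriction P).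
Proof.
move=> natP M N phi g h s diff po pull [Sigma Ds] p.
have ss := defining_smooth Ds; have [_ [_ _ sphi _]] := diff.
rewrite /hypersurface_restriction (mfd_inverse_norm_natural p ss sphi pull).
set m := mfd_inverse_norm h s (phi p).
rewrite -(natP _ _ _ _ _ _ diff po pull (smooth_mfd_unit_field h ss m)).
by congr (P M g _ p); apply/funext => q; exact: mfd_unit_field_natural.
Qed.

Lemma hypersurface_restriction_independent P M (g : metric M) (Sigma : set M) (s s' : M -> R) p :
  (0 < d)%N -> depends_on_jet d P ->
  defining_function Sigma s -> defining_function Sigma s' ->
  compatibly_oriented Sigma s s' -> Sigma p ->
  hypersurface_restriction P g s p = hypersurface_restriction P g s' p.
Proof.
move=> d0 hjet Ds Ds' os Sp; apply/esym.
have [ss ss'] := (defining_smooth Ds, defining_smooth Ds').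
apply: hjet; [exact: smooth_mfd_unit_field|exact: smooth_mfd_unit_field|].
apply: same_jet_mfd_unit_field => // c ac cp a ad.
rewrite (mfd_unit_field_partials g ss' _ a ac cp) (mfd_inverse_normE g ss' ac cp).
apply: (unit_field_independent (metric_on_img g ac) (ss c ac) (ss' c ac) d0 _ _ _
  (img_fwd cp) (defining_rep0 Ds ac cp Sp) ad) => y iy.
- split; first exact: defining_same_zeros Ds Ds' ac iy.
  exact: defining_same_zeros Ds' Ds ac iy.
- exact: (defining_dcol Ds ac iy).
- exact: (oriented_dcol Ds os ac iy).
Qed.

Definition unit_field_jet_value (v : jet_variable d) : @field_functional R d :=
  fun G f m o x => universal_jet_value G (unit_field G f m) m o x v.

Lemma universal_unit_field_jet_value v : universal (unit_field_jet_value v).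
Proof.
case: v => [i j a||a||].
- exact: universal_metric.
- exact: universal_invdet.
- exact: (universal_partials a universal_unit_field).
- exact: universal_par.
- exact: universal_vol.
Qed.

(** The jets of the unit field are universal with parameter [m], and at the point of evaluation [m]
    is the variable [JetInvNorm] of [s]. *)
Lemma hypersurface_restriction_polynomial P (n : nat) (v : 'I_n -> jet_variable d)
    (q : mpoly.mpoly n R) :
  (forall i, v i <> JetInvNorm d) ->
  (forall M (g : metric M) (s : M -> R) (c : chart R d M) p,
    smooth_fun s -> atlas c -> dom c p -> P M g s p = jet_polynomial_value v q g s c p) ->
  exists (n' : nat) (v' : 'I_n' -> jet_variable d) (q' : mpoly.mpoly n' R),
    forall M (g : metric M) (s : M -> R) (c : chart R d M) p,
      smooth_fun s -> atlas c -> dom c p ->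
      hypersurface_restriction P g s p = jet_polynomial_value v' q' g s c p.
Proof.
move=> vN formula.
have [n' [v' [q' E']]] :=
  universal_mpoly (universal_meval q (fun k => universal_unit_field_jet_value (v k))).
exists n', v', q' => M g s c p ss ac cp; rewrite /hypersurface_restriction.
rewrite (formula _ _ _ c p (smooth_mfd_unit_field g ss _) ac cp).
set m := mfd_inverse_norm g s p; pose o := volume_component g c p.
have := E' _ _ _ m o (fwd c p) (metric_regular (metric_on_img g ac) (ss c ac)) (img_fwd cp).
have lhs k : jet_value g (mfd_unit_field g s m) c p (v k) =
    unit_field_jet_value (v k) (g c) (local_rep c s) m o (fwd c p).
  (* A variable [JetInvNorm] in the polynomial of [P] would mean the inverse norm for the unit
     field, whereas [unit_field_jet_value] reads it as [m]; [vN] excludes this case. *)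
  have := vN k; rewrite /unit_field_jet_value; case: (v k) => //= a _.
  exact: mfd_unit_field_partials.
have rhs k : jet_value g s c p (v' k) =
    universal_jet_value (g c) (local_rep c s) m o (fwd c p) (v' k).
  by case: (v' k) => //=; rewrite /m (mfd_inverse_normE g ss ac cp).
rewrite /jet_polynomial_value (mpoly.meval_eq _ lhs) => ->.
by apply: mpoly.meval_eq => k; rewrite rhs.
Qed.

(** Covariance of [P] turns the right-hand side into the value of [P] at [h] and [Omega * S]. At [p]
    this product has the [d]-jet of the unit field of [h], which is all that [P] sees. *)
Lemma hypersurface_restriction_conformal P w M (g h : metric M) (Omega : M -> R)
    (Sigma : set M) (s : M -> R) p :
  (1 < d)%N -> depends_on_jet d P -> coupled_conformal_covariant 1 w P ->
  smooth_positive Omega -> is_rescaling Omega g h -> defining_function Sigma s ->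
  Sigma p ->
  hypersurface_restriction P h s p = Omega p `^ w * hypersurface_restriction P g s p.
Proof.
move=> d1 hjet [_ cov] [sO O0] resc Ds Sp; have ss := defining_smooth Ds.
set S := mfd_unit_field g s (mfd_inverse_norm g s p).
have sS : smooth_fun S by exact: smooth_mfd_unit_field.
have sOS : smooth_fun (fun q => Omega q * S q).
  move=> c ac; have [_ oi] := chart_open ac.
  exact: (smoothM oi (sO c ac) (sS c ac)).
have OS1 : (fun q => Omega q `^ 1 * S q) = (fun q => Omega q * S q).
  by apply/funext => q; rewrite powRr1// ltW.
have := cov _ _ _ _ S (conj sO O0) resc sS p; rewrite OS1 => <-.
apply/esym; apply: hjet => //; first exact: smooth_mfd_unit_field.
apply: same_jet_mfd_unit_field => // c ac cp a ad; have [_ oi] := chart_open ac.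
rewrite -(unit_field_conformal (metric_on_img g ac) (sO c ac) _ _ (ss c ac) d1 _
  (img_fwd cp) (defining_rep0 Ds ac cp Sp) ad).
- apply: (partials_ext a oi _ (img_fwd cp)) => y iy.
  rewrite -(mfd_inverse_normE g ss ac cp).
  by rewrite -(mfd_unit_field_rep g ss _ ac iy).
- by move=> y _; exact: O0.
- by move=> _ [q cq <-]; rewrite resc// chart_bwdK.
- by move=> y; exact: (defining_dcol Ds ac).
Qed.

Lemma hypersurface_restriction_density P M (g : metric M) (Sigma : set M) (f s B : M -> R) p :
  (0 < d)%N -> depends_on_jet d P ->
  defining_function Sigma f -> smooth_fun B ->
  (forall c q, atlas c -> dom c q ->
    I_squared (g c) (local_rep c f) (fwd c q) = 1 + f q ^+ d * B q) ->
  defining_function Sigma s -> compatibly_oriented Sigma f s -> Sigma p ->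
  P M g f p = hypersurface_restriction P g s p.
Proof.
move=> d0 hjet Df sB I1 Ds os Sp; have [sf ss] := (defining_smooth Df, defining_smooth Ds).
apply: hjet => //; first exact: smooth_mfd_unit_field.
apply: same_jet_mfd_unit_field => // c ac cp a ad.
have sf0 y : img c y -> local_rep c s y = 0 -> local_rep c f y = 0.
  exact: defining_same_zeros Ds Df ac.
apply: (unit_density_jet (metric_on_img g ac) (ss c ac) (sf c ac) (sB c ac) d0 _ sf0 _ _
  (img_fwd cp) (defining_rep0 Ds ac cp Sp) ad).
- by move=> y; exact: (defining_dcol Ds ac).
- move=> y iy sy.
  have [l l0 ->] := oriented_dcol Df os ac iy (sf0 y iy sy).
  (* The orientation hypothesis compares [s] with [f], while uniqueness asks for [f] relative to
     [s]. *)
  exists l^-1; first by rewrite invr_gt0.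
  by rewrite scalerA mulVf ?scale1r// gt_eqF.
- by move=> _ [q cq <-]; rewrite I1// chart_bwdK.
Qed.

End HypersurfaceInvariant.

Theorem theorem6p3 (R : realType) (d : nat) (hd : (3 <= d)%N) (w : R)
    (P : scalar_assignment R d)
    (hP : coupled_conformal_covariant 1 w P)
    (hjet : depends_on_jet d P) :
  exists2 Q : scalar_assignment R d,
    conformal_hypersurface_invariant w Q &
    forall (M : omanifold R d) (cc : set (metric M)) (Sigma : set M)
        (sigma : metric M -> M -> R),
      conformal_class cc -> unit_defining_density cc Sigma sigma ->
      restricts_to cc Sigma sigma P Q.
Proof.
have d1 : (1 < d)%N by exact: ltn_trans hd.
have d0 := ltnW d1.
exists (hypersurface_restriction P); last first.
  move=> M cc Sigma sigma _ [[_ Dsigma] [B [sB _] I1]] g ccg s Ds os p Sp.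
  exact: (hypersurface_restriction_density d0 hjet (Dsigma g ccg) (sB g ccg)
    (I1 g ccg) Ds os Sp).
split; last first.
  move=> M g h Omega Sigma s sO resc Ds p Sp.
  exact: (hypersurface_restriction_conformal d1 hjet hP sO resc Ds Sp).
have [[natP [n [v [q [vN formula]]]]] _] := hP; split.
- exact: hypersurface_restriction_natural.
- move=> M g Sigma s s' Ds Ds' os p Sp.
  exact: (hypersurface_restriction_independent g d0 hjet Ds Ds' os Sp).
- have [n' [v' [q' E]]] := hypersurface_restriction_polynomial vN formula.
  exists n', v', q' => M g s c p [Sigma Ds] ac cp _.
  exact: (E M g s c p (defining_smooth Ds) ac cp).
Qed.
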